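(* There exist absolute constants $c>0$ and $C>0$ such that for every finite set $A\subset\mathbb{R}$ with more than one element, and for either choice of the sign $\pm$, $$\sum_x r^2_{A(A\pm A)}(x)\le C|A|^{9/2-c}$$ and $$\sum_x r^2_{AA\pm A}(x)\le C|A|^{9/2-c}.$$
   Context: $r_{A(A\pm A)}(x)=|\{(a,b,c)\in A^3: a(b\pm c)=x\}|$ and $r_{AA\pm A}(x)=|\{(a,b,c)\in A^3: ab\pm c=x\}|$; the sums are over all $x\in\mathbb{R}$, and $r^2(x)=(r(x))^2$. *)

(* Defs.v *)
From HB Require Import structures.
From mathcomp Require Import all_boot all_order all_algebra finmap.
From mathcomp Require Import all_classical all_reals all_analysis.

Set Implicit Arguments.
Unset Strict Implicit.
Unset Printing Implicit Defensive.

Import Order.TTheory GRing.Theory Num.Theory.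
Local Open Scope fset_scope.
Local Open Scope ring_scope.

(* In both definitions the Boolean s encodes the sign: (-1) ^+ s is 1 for
   s = false (the "+" case) and -1 for s = true (the "-" case); a triple
   (a, b, c) is t = ((a, b), c). *)

Definition r_mul_sum (R : realType) (s : bool) (A : {fset R}) (x : R) : nat :=
  #|` [fset t in A `*` A `*` A | t.1.1 * (t.1.2 + (-1) ^+ s * t.2) == x] |.

Definition r_prod_sum (R : realType) (s : bool) (A : {fset R}) (x : R) : nat :=
  #|` [fset t in A `*` A `*` A | t.1.1 * t.1.2 + (-1) ^+ s * t.2 == x] |.

(* Main.v *)
Require Import Defs.
From HB Require Import structures.
From mathcomp Require Import all_boot all_order all_algebra finmap.
From mathcomp Require Import all_classical all_reals all_analysis.
From mathcomp Require Import lra ring zify.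

(** Write n for the number of elements of A. Both sums count pairs of triples with
a common value. Fixing the two first factors a, a' and discarding the O(n^4)
solutions in which one of them vanishes, the first sum is governed by the
number G of solutions of g (x - x') = g' (y - y') with nonzero sides, g, g' in
A minus 0 and x, x', y, y' in A: the sign plus gives no more solutions than
the sign minus, by Cauchy-Schwarz ([sign_le_minus], [mul_sum_energy_le]). For
the second sum, a b + c = a' b' + c' says that the point (b, b') of the grid A
x A lies on a line determined by (a, a', c, c'); the squares of the
multiplicities with which a line arises add up to at most n (G + n^4), and
Cauchy-Schwarz against the number of rich lines gives a bound in terms of G
again ([line_energy_le], [prod_sum_energy_le]). The Szemeredi-Trotter theorem
alone bounds G by a constant times n^(9/2), and everything rests on saving a
power of n there ([quot_energy_bound]).

Let G(C, B) be the same count with x, x', y, y' in C and g, g' in B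
([quot_energy]), where n is now the size of C. The claim is G(C, B) <= n^(7/2
- e) |B| for all B with at most n elements, and the proof takes a minimal
counterexample A. Weighting the Szemeredi-Trotter bound with the
multiplicities of the quotients a / a' shows that A must have nearly n
elements and nearly maximal multiplicative energy ([quot_energy_large_card],
[mult_energy_large]). By the theorems of Balog-Szemeredi-Gowers and of
Plunnecke, A then contains a large B with a large subset Y such that the
threefold quotient Y / B B B is hardly larger than n ([structured_subset]). As
G(C, .) is a quadratic form, a sum of squares over z, and as A minus B
satisfies the claim by minimality, B must carry a fair share of the energy
([quot_energy_split]). It remains to refute G(C, B) > n^(9/2 - d) for such a
structured B, with d a fixed multiple of e ([structured_quot_energy_lt]). In
what follows factors n^O(d) are neglected, also in phrases such as almost all.

Cut C into n^(1/2) consecutive blocks of n^(1/2) elements. The monotonicity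
behind the Szemeredi-Trotter bound shows that most solutions can be found with
x, x' in one block and y, y' in one block; fixing g', x and x' by the
pigeonhole principle yields mu such that almost every pair v, y in a common
block has (y - v) / mu in B ([exists_structured_blocks]). Hence for most
triples v, y, y' in one block both beta = (y - v) / mu and beta' = (y' - v) /
mu lie in B, and their difference has n^(1/2) representations as a difference
of elements of B, one for every v that serves y and y' alike. Two triples with
the same ratio beta / beta' correspond to three points of the grid C x C on
one line and in one cell, and the third moment of the richness of lines shows
that there are about n ratios. Multiplying beta and beta' by the elements of B
gives n^2 pairs in B B whose difference has at least n^(1/2) representations
([popular_pairs_ge]).

This is impossible, since dividing B B by the n elements of Y, and multiplying
the result by the n elements of B, gives sets of size about n
([few_popular_pairs]). For a set A with two such families of dilates,
Szemeredi-Trotter leaves n^(3/2) differences with n^(1/2) representations, and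
n^2 popular pairs produce n^3 triples in A all of whose differences are
popular. By Cauchy-Schwarz, the square n^6 of this number is at most the
number of pairs of popular differences whose difference is popular, times the
sum of the cubes of the representation numbers ([sqr_triangles_le]). The first
factor is at most n^(8/3) because the dilates send popular differences to
popular differences; the second is at most n^(2/3) n^(5/2), since a nonzero
difference with f representations comes with n equally popular dilates, whence
n f^3 is at most n^3. The product n^(35/6) is smaller than n^6. *)

Set Implicit Arguments.
Unset Strict Implicit.
Unset Printing Implicit Defensive.

Import Order.TTheory GRing.Theory Num.Theory.
Local Open Scope fset_scope.
Local Open Scope ring_scope.

(** * Sums over finite sets *)

Section Counting.
Variable R : realFieldType.

Lemma ler_ind (a b : bool) : (a -> b) -> a%:R <= b%:R :> R.
Proof. by rewrite ler_nat; case: a => // ->. Qed.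

Lemma ind_ge0 (a : bool) : 0 <= a%:R :> R. Proof. exact: ler0n. Qed.

Lemma ind_le1 (a : bool) : a%:R <= 1 :> R. Proof. by rewrite lern1; case: a. Qed.

Lemma ind_andb (a b : bool) : (a && b)%:R = a%:R * b%:R :> R.
Proof. by rewrite -mulnb natrM. Qed.

Lemma sum1_fset (T : choiceType) (A : {fset T}) : \sum_(x <- A) 1 = #|` A|%:R :> R.
Proof. by rewrite big_const_seq count_predT iter_addr addr0. Qed.

Lemma sum_const_fset (T : choiceType) (A : {fset T}) (c : R) :
  \sum_(x <- A) c = #|` A|%:R * c.
Proof. by rewrite -sum1_fset big_distrl; apply: eq_bigr => x _; rewrite /= mul1r. Qed.

Lemma sum_pred1_fset (T : choiceType) (A : {fset T}) (y : T) :
  \sum_(x <- A) (x == y)%:R = (y \in A)%:R :> R.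
Proof.
case: (boolP (y \in A)) => yA; last first.
  rewrite big_seq big1 // => x xA; case: eqP => // xy.
  by rewrite xy (negbTE yA) in xA.
rewrite (big_fsetD1 y) //= eqxx big_seq big1 ?addr0 // => x.
by rewrite !inE => /andP[/negbTE ->].
Qed.

Lemma sum_pred1_fset_mul (T : choiceType) (A : {fset T}) (y : T) (h : T -> R) :
  \sum_(x <- A) (x == y)%:R * h x = (y \in A)%:R * h y.
Proof.
rewrite -sum_pred1_fset big_distrl; apply: eq_bigr => x _.
by case: eqP => [->|_] /=; rewrite ?mul0r.
Qed.

Lemma ler_sum_fset (T : choiceType) (A : {fset T}) (g h : T -> R) :
  (forall x, x \in A -> g x <= h x) -> \sum_(x <- A) g x <= \sum_(x <- A) h x.
Proof. by move=> gh; rewrite big_seq [leRHS]big_seq; apply: ler_sum. Qed.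

Lemma sum_ind_le_card (T : choiceType) (A : {fset T}) (P : T -> bool) :
  \sum_(x <- A) (P x)%:R <= #|` A|%:R :> R.
Proof. by rewrite -sum1_fset; apply: ler_sum => x _; exact: ind_le1. Qed.

Lemma cauchy_schwarz I (s : seq I) (a b : I -> R) :
  (\sum_(i <- s) a i * b i) ^+ 2
    <= (\sum_(i <- s) a i ^+ 2) * (\sum_(i <- s) b i ^+ 2).
Proof.
elim: s => [|i s IH]; first by rewrite !big_nil expr0n mul0r.
rewrite !big_cons.
set x := \sum_(j <- s) a j * b j in IH *.
set A := \sum_(j <- s) a j ^+ 2 in IH *.
set B := \sum_(j <- s) b j ^+ 2 in IH *.
have A0 : 0 <= A by apply: sumr_ge0 => j _; exact: sqr_ge0.
have B0 : 0 <= B by apply: sumr_ge0 => j _; exact: sqr_ge0.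
have h : 2 * (a i * b i) * x <= a i ^+ 2 * B + b i ^+ 2 * A.
  have [A0'|A0'] := eqVneq A 0.
    have x0 : x = 0.
      by apply/eqP; rewrite -sqrf_eq0 eq_le sqr_ge0 andbT (le_trans IH) // A0' mul0r.
    by rewrite x0 mulr0 A0' mulr0 addr0 mulr_ge0 // sqr_ge0.
  have Ap : 0 < A by rewrite lt_def A0' A0.
  rewrite -(ler_pM2l Ap).
  have := sqr_ge0 (a i * x - b i * A).
  have := ler_wpM2l (sqr_ge0 (a i)) IH.
  nra.
nra.
Qed.

Lemma sqr_sum_le I (s : seq I) (a : I -> R) :
  (\sum_(i <- s) a i) ^+ 2 <= (size s)%:R * \sum_(i <- s) a i ^+ 2.
Proof.
have := cauchy_schwarz s (fun=> 1) a.
have -> : \sum_(i <- s) 1 * a i = \sum_(i <- s) a i.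
  by apply: eq_bigr => i _; rewrite mul1r.
suff -> : \sum_(i <- s) 1 ^+ 2 = (size s)%:R :> R by [].
by rewrite big_const_seq count_predT iter_addr addr0 expr1n.
Qed.

Lemma sqr_sum_fset_le (T : choiceType) (A : {fset T}) (a : T -> R) :
  (\sum_(i <- A) a i) ^+ 2 <= #|` A|%:R * \sum_(i <- A) a i ^+ 2.
Proof. exact: sqr_sum_le. Qed.

Lemma sqr_sum I (s : seq I) (g : I -> R) :
  (\sum_(i <- s) g i) ^+ 2 = \sum_(i <- s) \sum_(j <- s) g i * g j.
Proof.
rewrite expr2 big_distrl; apply: eq_bigr => i _ /=.
by rewrite big_distrr.
Qed.

(** Cauchy-Schwarz over the [N] values of the label [v]. When [g] indicates the
    points of a line that lie in a grid, labels are meaningful only where [g]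
    does not vanish. *)
Lemma sqr_sum_classes (I : eqType) (s : seq I) (v : I -> nat) (N : nat)
    (g : I -> R) :
  (forall i, i \in s -> g i != 0 -> (v i < N)%N) ->
  (\sum_(i <- s) g i) ^+ 2
    <= N%:R * \sum_(i <- s) \sum_(j <- s) (v i == v j)%:R * (g i * g j).
Proof.
move=> vN.
have -> : \sum_(i <- s) g i
    = \sum_(k <- iota 0 N) \sum_(i <- s) (v i == k)%:R * g i.
  rewrite exchange_big; apply: eq_big_seq => i si /=.
  have [->|gi] := eqVneq (g i) 0.
    by rewrite big1 // => k _; rewrite mulr0.
  rewrite -big_distrl /= (bigD1_seq (v i)) ?iota_uniq ?mem_iota ?vN //= eqxx.
  by rewrite big1 ?addr0 ?mul1r // => k; rewrite eq_sym => /negbTE ->.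
apply: (le_trans (sqr_sum_le _ _)).
rewrite size_iota; apply: ler_wpM2l; first exact: ler0n.
under eq_bigr do rewrite sqr_sum.
rewrite exchange_big [leLHS]big_seq [leRHS]big_seq; apply: ler_sum => i si /=.
rewrite exchange_big; apply: ler_sum => j _ /=.
have [->|gi] := eqVneq (g i) 0.
  by rewrite big1 ?mul0r ?mulr0 // => k _; rewrite mulr0 mul0r.
rewrite (bigD1_seq (v i)) ?iota_uniq ?mem_iota ?vN //= eqxx big1 => [|k].
  by rewrite addr0 mul1r mulrCA eq_sym.
by rewrite eq_sym => /negbTE ->; rewrite !mul0r.
Qed.

Lemma ler_elem_sum (I : eqType) (s : seq I) (g : I -> R) (i : I) :
  i \in s -> (forall j, j \in s -> 0 <= g j) -> g i <= \sum_(j <- s) g j.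
Proof.
move=> si g0; rewrite (perm_big _ (perm_to_rem si)) big_cons lerDl big_seq.
by apply: sumr_ge0 => j /mem_rem; exact: g0.
Qed.

Lemma pigeonhole_sum (I : eqType) (s : seq I) (w N : I -> R) (T L : R) :
  0 < T -> (forall i, i \in s -> 0 <= w i) -> \sum_(i <- s) w i <= L ->
  T <= \sum_(i <- s) w i * N i -> exists i, [/\ i \in s, w i != 0 & T <= L * N i].
Proof.
move=> T0 w0 wL hT.
have [/hasP[i si /andP[wi Ni]]|/hasPn h] :=
  boolP (has (fun i => (w i != 0) && (T <= L * N i)) s).
  by exists i.
exfalso.
have lt i : i \in s -> w i != 0 -> L * N i < T.
  by move=> si wi; move: (h i si); rewrite wi /= -ltNge.
have [/hasP[j sj wj]|/hasPn hz] := boolP (has (fun i => w i != 0) s); last first.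
  move: hT; rewrite big_seq big1 ?leNgt ?T0 // => i /hz; rewrite negbK => /eqP ->.
  by rewrite mul0r.
have wjp : 0 < w j by rewrite lt_def wj w0.
have Lp : 0 < L by apply: lt_le_trans wL; exact: lt_le_trans (ler_elem_sum sj w0).
have pos i : i \in s -> 0 <= w i * (T - L * N i).
  move=> si; have [->|wi] := eqVneq (w i) 0; first by rewrite mul0r.
  by rewrite mulr_ge0 ?w0 // subr_ge0 ltW ?lt.
have : 0 < \sum_(i <- s) w i * (T - L * N i).
  apply: lt_le_trans (ler_elem_sum sj pos); rewrite mulr_gt0 // subr_gt0; exact: lt.
under eq_bigr do rewrite mulrBr mulrCA.
rewrite sumrB -mulr_suml -mulr_sumr; nra.
Qed.

End Counting.

(** * Rich lines in a grid cut into cells *)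

Section Lines.
Variable R : realFieldType.
Implicit Types (P Q S V : {fset R}) (m v x y : R).

Definition richness P Q m v : R := \sum_(x <- P) (m * x + v \in Q)%:R.

Definition cell_pairs (bP bQ : R -> nat) P Q m v : R :=
  \sum_(x <- P) \sum_(x' <- P)
    [&& x != x', bP x == bP x', bQ (m * x + v) == bQ (m * x' + v),
        m * x + v \in Q & m * x' + v \in Q]%:R.

Lemma richness_ge0 P Q m v : 0 <= richness P Q m v.
Proof. by apply: sumr_ge0 => x _; exact: ind_ge0. Qed.

Lemma richness_le P Q m v : richness P Q m v <= #|` P|%:R.
Proof. exact: sum_ind_le_card. Qed.

Lemma cell_pairs_ge0 bP bQ P Q m v : 0 <= cell_pairs bP bQ P Q m v.
Proof. by do 2!apply: sumr_ge0 => ? _; exact: ind_ge0. Qed.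

(** A line that is neither horizontal nor vertical is monotone, so it meets at
    most 2 r - 1 of the r^2 cells of a grid: along the line, the sum of the
    column and row numbers (the row number reversed for a negative slope) never
    decreases, and it determines the cell. Cauchy-Schwarz over the cells then
    bounds the square of the richness by the number of pairs of points of the
    line in a common cell. *)
Lemma sqr_richness_le_cells (bP bQ : R -> nat) (r : nat) P Q m v :
  m != 0 ->
  {homo bP : x y / x <= y >-> (x <= y)%N} ->
  {homo bQ : x y / x <= y >-> (x <= y)%N} ->
  (forall x, x \in P -> (bP x < r)%N) -> (forall y, y \in Q -> (bQ y < r)%N) ->
  richness P Q m v ^+ 2
    <= (2 * r - 1)%N%:R * (richness P Q m v + cell_pairs bP bQ P Q m v).
Proof.
move=> m0 hP hQ Pr Qr.
pose cy x := if 0 < m then bQ (m * x + v) else (r.-1 - bQ (m * x + v)%R)%N.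
have same_cell x x' : m * x + v \in Q -> m * x' + v \in Q ->
    (bP x + cy x)%N = (bP x' + cy x')%N ->
    bP x = bP x' /\ bQ (m * x + v) = bQ (m * x' + v).
  wlog xx' : x x' / x <= x' => [hw|] xQ x'Q.
    have [/hw|/ltW /hw] := leP x x'; first exact.
    by move=> /(_ x'Q xQ) + /esym => /[apply] -[-> ->].
  have := Qr _ xQ; have := Qr _ x'Q; have := hP _ _ xx'; rewrite /cy.
  case: ltP => [mp|mn].
    have := hQ (m * x + v) (m * x' + v); rewrite lerD2r ler_pM2l // => /(_ xx').
    lia.
  have := hQ (m * x' + v) (m * x + v).
  rewrite lerD2r ler_nM2l ?lt_def 1?eq_sym ?m0 // => /(_ xx').
  lia.
apply: (@le_trans _ _ ((2 * r - 1)%N%:R * \sum_(x <- P) \sum_(x' <- P)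
  ((bP x + cy x == bP x' + cy x')%N%:R
     * ((m * x + v \in Q)%:R * (m * x' + v \in Q)%:R)))).
  apply: sqr_sum_classes => x xP; rewrite pnatr_eq0 eqb0 negbK => xQ.
  have := Pr _ xP; have := Qr _ xQ; rewrite /cy; case: ifP => _; lia.
apply: ler_wpM2l; first exact: ler0n.
rewrite /richness /cell_pairs -big_split /=; apply: ler_sum_fset => x xP.
rewrite [X in _ <= X + _](_ : (m * x + v \in Q)%:R
  = \sum_(x' <- P) (x' == x)%:R * (m * x + v \in Q)%:R); last first.
  by rewrite sum_pred1_fset_mul xP mul1r.
rewrite -big_split /=; apply: ler_sum => x' _; rewrite -!ind_andb.
have [<-|xx'] /= := eqVneq x x'; first by rewrite !eqxx /= andbb addr0.
rewrite add0r; apply: ler_ind => /and3P[/eqP e xQ x'Q].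
by have [-> ->] := same_cell _ _ xQ x'Q e; rewrite !eqxx xQ x'Q.
Qed.

Lemma sum_intercepts V Q m x (h : R -> R) :
  \sum_(v <- V) (m * x + v \in Q)%:R * h v
    = \sum_(y <- Q) (y - m * x \in V)%:R * h (y - m * x).
Proof.
under [RHS]eq_bigr do rewrite -sum_pred1_fset_mul.
rewrite [RHS]exchange_big /=; apply: eq_bigr => v _.
rewrite -sum_pred1_fset big_distrl /=; apply: eq_bigr => y _.
by rewrite [v == _]eq_sym subr_eq addrC.
Qed.

(** Two points determine a line, so summing over lines merely counts pairs of
    grid points in a common cell, weighted by their slope. *)
Lemma sum_cell_pairs_le (w : R -> R) bP bQ P Q S V :
  (forall m, m \in S -> 0 <= w m) ->
  \sum_(m <- S) \sum_(v <- V) w m * cell_pairs bP bQ P Q m v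
   <= \sum_(x <- P) \sum_(x' <- P) \sum_(y <- Q) \sum_(y' <- Q)
        [&& x != x', bP x == bP x' & bQ y == bQ y']%:R
        * (((y - y') / (x - x') \in S)%:R * w ((y - y') / (x - x'))).
Proof.
move=> w0.
under eq_bigr => m _ do under eq_bigr => v _ do rewrite mulr_sumr.
under eq_bigr => m _ do rewrite exchange_big.
rewrite exchange_big /=; apply: ler_sum => x _.
under eq_bigr => m _ do under eq_bigr => v _ do rewrite mulr_sumr.
under eq_bigr => m _ do rewrite exchange_big.
rewrite exchange_big /=; apply: ler_sum => x' _.
have [<-|xx'] := eqVneq x x'.
  rewrite big1 => [|m _]; last by rewrite big1 // => v _; rewrite mulr0.
  by do 2!apply: sumr_ge0 => ? _; rewrite mul0r.
have dx0 : x - x' != 0 by rewrite subr_eq0.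
have [bxx|_] := eqVneq (bP x) (bP x'); last first.
  rewrite big1 => [|m _]; last by rewrite big1 // => v _; rewrite mulr0.
  by do 2!apply: sumr_ge0 => ? _; rewrite mul0r.
under eq_bigr => m _.
  under eq_bigr => v _.
    rewrite /= (_ : _%:R = (m * x + v \in Q)%:R
        * ((bQ (m * x + v) == bQ (m * x' + v)) && (m * x' + v \in Q))%:R); last first.
      by rewrite -ind_andb; congr (_%:R); rewrite andbCA.
    rewrite mulrCA; over.
  rewrite (@sum_intercepts V Q m x (fun v => w m *
     ((bQ (m * x + v) == bQ (m * x' + v)) && (m * x' + v \in Q))%:R)); over.
rewrite exchange_big /=; apply: ler_sum => y _.
under [leRHS]eq_bigr => y' _ do rewrite -sum_pred1_fset_mul mulr_sumr.
rewrite [leRHS]exchange_big /=; apply: ler_sum_fset => m mS.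
have -> : m * x + (y - m * x) = y by rewrite addrC subrK.
have -> : m * x' + (y - m * x) = y - m * (x - x') by ring.
apply: (@le_trans _ _ (w m * ((bQ y == bQ (y - m * (x - x')))
    && (y - m * (x - x') \in Q))%:R)).
  by rewrite ler_piMl ?ind_le1 // mulr_ge0 ?w0 ?ind_ge0.
rewrite andbC ind_andb -(@sum_pred1_fset R _ Q) big_distrl /= mulr_sumr.
apply: ler_sum => y' _; rewrite mulrC [leRHS]mulrA; apply: ler_wpM2r; first exact: w0.
rewrite -!ind_andb; apply: ler_ind => /andP[/eqP -> /eqP ->].
by rewrite eqxx /= opprB addrC subrK mulfK ?eqxx.
Qed.

End Lines.

(** * Cutting a finite set of reals into consecutive blocks *)

Section Blocks.
Variable R : realFieldType.
Implicit Types (P : {fset R}) (x y : R).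

Definition rank P x : nat := count (fun p => p < x) P.

Definition block P (z : nat) x : nat := (rank P x %/ z)%N.

Lemma rank_homo P : {homo rank P : x y / x <= y >-> (x <= y)%N}.
Proof. by move=> x y xy; apply: sub_count => p /= px; exact: lt_le_trans xy. Qed.

(** Ranks separate the elements of [P], so that a block of z ranks has at most z
    elements. *)
Lemma rank_lt P x y : x \in P -> x < y -> (rank P x < rank P y)%N.
Proof.
move=> xP xy; rewrite -addn1 /rank.
have <- : count (pred1 x) P = 1%N by rewrite count_uniq_mem ?fset_uniq ?xP.
rewrite -count_predUI [X in (_ + X)%N](_ : _ = 0)%N ?addn0.
  by apply: sub_count => p /= /orP[/lt_trans|/eqP ->]; first exact.
by apply/eqP; rewrite -leqn0 leqNgt -has_count; apply/hasPn => p _ /=;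
   case: eqP => [->|_]; rewrite ?ltxx ?andbF.
Qed.

Lemma block_homo P z : {homo block P z : x y / x <= y >-> (x <= y)%N}.
Proof. by move=> x y xy; apply: leq_div2r; exact: rank_homo. Qed.

Lemma block_lt P z r x : (0 < z)%N -> (#|` P| <= r * z)%N -> x \in P ->
  (block P z x < r)%N.
Proof.
move=> z0 Pz xP; rewrite ltn_divLR //; apply: leq_trans Pz.
rewrite /rank -(count_predC (fun p => p < x)) -addn1 leq_add2l.
by rewrite -has_count; apply/hasP; exists x => //=; rewrite ltxx.
Qed.

Lemma card_block P z i : (0 < z)%N ->
  \sum_(x <- P) (block P z x == i)%:R <= z%:R :> R.
Proof.
move=> z0; rewrite -natr_sum ler_nat -big_mkcond /= sum1_count -size_filter.
set s := [seq _ <- _ | _].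
have inj : {in s &, injective (rank P)}.
  move=> x y; rewrite !mem_filter => /andP[_ xP] /andP[_ yP] e.
  by case: (ltgtP x y) => // h;
    [have := rank_lt xP h|have := rank_lt yP h]; rewrite e ltnn.
rewrite -(size_map (rank P)) -(size_iota (i * z) z).
apply: uniq_leq_size.
  by rewrite map_inj_in_uniq // filter_uniq // fset_uniq.
move=> _ /mapP[x + ->]; rewrite mem_filter => /andP[/eqP <- _].
rewrite mem_iota /block leq_divM /= -mulSnr.
by rewrite ltn_ceil.
Qed.

End Blocks.

(** * Szemeredi-Trotter bounds for Cartesian products *)

Section SzemerediTrotter.
Variable R : archiRealFieldType.
Implicit Types (P Q S V : {fset R}) (m v x y T W : R).

Lemma richness_le_codom P Q m v : m != 0 -> richness P Q m v <= #|` Q|%:R.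
Proof.
move=> m0; rewrite /richness.
under eq_bigr do rewrite -sum_pred1_fset.
rewrite exchange_big -sum1_fset; apply: ler_sum => y _ /=.
under eq_bigr => x _.
  rewrite (_ : (y == m * x + v) = (x == (y - v) / m)); first over.
  by rewrite -subr_eq eq_sym -(inj_eq (mulfI m0) x) [m * (_ / m)]mulrC divfK.
by rewrite sum_pred1_fset ind_le1.
Qed.

(** The first bound makes [2 * r - 1] at most half of the richness of a line
    with at least [T] points; the second keeps the number of cells large. *)
Lemma truncation_exists (T : R) : 2 <= T ->
  exists r : nat, [/\ (0 < r)%N, 4 * r%:R - 2 <= T & T <= 8 * r%:R].
Proof.
move=> T2; have [T8|T8] := leP T 8; first by exists 1%N; split=> //; lra.
have T0 : 0 <= T / 4 by lra.
have := Num.Theory.truncn_itv T0.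
set r := Num.truncn _ => /andP[h1]; rewrite -[r.+1]addn1 natrD => h2; exists r.
split; rewrite -?(ltr0n R); lra.
Qed.

Lemma ceil_div_bounds (n r : nat) : (0 < r <= n)%N ->
  (n <= r * (n.-1 %/ r).+1)%N /\ (r * (n.-1 %/ r).+1 <= 2 * n)%N.
Proof.
move=> /andP[r0 rn]; have := ltn_ceil n.-1 r0; have := leq_divM n.-1 r.
rewrite mulnC [(_.+1 * r)%N]mulnC mulnS; move: (r * _)%N => q; lia.
Qed.

(** A form of the Szemeredi-Trotter theorem for Cartesian products with an
    elementary proof. Cut P and Q into r blocks with r close to T / 4. On a line
    with k >= T points, k^2 <= (2 r - 1) (k + pairs in common cells) and (2 r -
    1) k <= k^2 / 2, so k^2 is at most 4 r times the number of pairs in common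
    cells. Every pair of grid points lies on one line, and there are about (|P|
    |Q| / r)^2 such pairs. The weights depend on slopes only, as the application
    to quotients with multiplicity needs. *)
Lemma sum_rich_sqr_le (w : R -> R) P Q S V T W :
  2 <= T -> 0 <= W -> 0 \notin S -> (forall m, m \in S -> 0 <= w m <= W) ->
  \sum_(m <- S) \sum_(v <- V)
      w m * ((T <= richness P Q m v)%R%:R * richness P Q m v ^+ 2)
    <= 128 * W * (#|` P|%:R * #|` Q|%:R) ^+ 2 / T.
Proof.
move=> T2 W0 S0 wW; have T0 : 0 < T by lra.
have Snz m : m \in S -> m != 0 by apply: contraTneq => ->.
have RHS0 : 0 <= 128 * W * (#|` P|%:R * #|` Q|%:R) ^+ 2 / T.
  by rewrite divr_ge0 ?(ltW T0) // mulr_ge0 ?sqr_ge0 // mulr_ge0.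
have triv : (forall m v, m \in S -> richness P Q m v < T) ->
  \sum_(m <- S) \sum_(v <- V)
      w m * ((T <= richness P Q m v)%R%:R * richness P Q m v ^+ 2)
    <= 128 * W * (#|` P|%:R * #|` Q|%:R) ^+ 2 / T.
  move=> h; rewrite big_seq big1 // => m mS; rewrite big1 // => v _.
  by rewrite leNgt h // mul0r mulr0.
have [TP|TP] := ltP (#|` P|%:R) T.
  by apply: triv => m v _; exact: le_lt_trans (richness_le _ _ _ _) TP.
have [TQ|TQ] := ltP (#|` Q|%:R) T.
  by apply: triv => m v mS; apply: le_lt_trans TQ; rewrite richness_le_codom ?Snz.
have [r [r0 rT Tr]] := truncation_exists T2.
have r1 : 1 <= r%:R :> R by rewrite ler1n.
have rP : (r <= #|` P|)%N by rewrite -(ler_nat R); lra.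
have rQ : (r <= #|` Q|)%N by rewrite -(ler_nat R); lra.
pose z (A : {fset R}) := (#|` A|.-1 %/ r).+1.
have zA (A : {fset R}) : (r <= #|` A|)%N ->
    (#|` A| <= r * z A)%N /\ (r * z A <= 2 * #|` A|)%N.
  by move=> rA; apply: ceil_div_bounds; rewrite r0.
have [Pz Pz'] := zA _ rP; have [Qz Qz'] := zA _ rQ.
pose bP := block P (z P); pose bQ := block Q (z Q).
have line m v : m \in S ->
    (T <= richness P Q m v)%R%:R * richness P Q m v ^+ 2
      <= 4 * r%:R * cell_pairs bP bQ P Q m v.
  move=> mS; have pc0 := cell_pairs_ge0 bP bQ P Q m v.
  have [Tk|_] := leP T (richness P Q m v); last first.
    by rewrite mul0r !mulr_ge0 ?ler0n.
  have := sqr_richness_le_cells v (Snz _ mS) (@block_homo _ P (z P))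
    (@block_homo _ Q (z Q)) (fun x => @block_lt _ P (z P) r x isT Pz)
    (fun x => @block_lt _ Q (z Q) r x isT Qz).
  rewrite natrB ?muln_gt0 // natrM; rewrite mul1r.
  move: Tk pc0; rewrite -/bP -/bQ.
  set k := richness _ _ _ _; set pc := cell_pairs _ _ _ _ _ _.
  nra.
apply: (@le_trans _ _ (4 * r%:R * (\sum_(m <- S) \sum_(v <- V)
   w m * cell_pairs bP bQ P Q m v))).
  rewrite mulr_sumr; apply: ler_sum_fset => m mS.
  rewrite mulr_sumr; apply: ler_sum => v _.
  rewrite [leRHS]mulrCA; apply: ler_wpM2l; first by case/andP: (wW _ mS).
  exact: line.
have pairs : \sum_(m <- S) \sum_(v <- V) w m * cell_pairs bP bQ P Q m v
    <= W * (#|` P|%:R * (z P)%:R) * (#|` Q|%:R * (z Q)%:R).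
  apply: (le_trans (sum_cell_pairs_le _ _ _ _ _ _)).
    by move=> m /wW /andP[].
  have cb (A : {fset R}) : \sum_(x <- A) \sum_(x' <- A)
      (block A (z A) x == block A (z A) x')%:R <= #|` A|%:R * (z A)%:R :> R.
    rewrite -sum_const_fset; apply: ler_sum => x _.
    by under eq_bigr do rewrite eq_sym; exact: card_block.
  apply: (@le_trans _ _ (W * ((\sum_(x <- P) \sum_(x' <- P)
       (bP x == bP x')%:R) * (\sum_(y <- Q) \sum_(y' <- Q)
       (bQ y == bQ y')%:R)))); last first.
    rewrite -mulrA; apply: ler_wpM2l => //.
    by apply: ler_pM; rewrite ?cb //; do 2!apply: sumr_ge0 => ? _; exact: ind_ge0.
  rewrite mulrC !mulr_suml; apply: ler_sum => x _.
  rewrite !mulr_suml; apply: ler_sum => x' _.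
  rewrite mulr_sumr mulr_suml; apply: ler_sum => y _.
  rewrite mulr_sumr mulr_suml; apply: ler_sum => y' _.
  rewrite -ind_andb; apply: ler_pM; rewrite ?ind_ge0 //.
  - case: (boolP (_ \in S)) => [/wW /andP[h _]|_]; first by rewrite mul1r.
    by rewrite mul0r.
  - by apply: ler_ind => /and3P[_ -> ->].
  - case: (boolP (_ \in S)) => [/wW /andP[_ h]|_]; first by rewrite mul1r.
    by rewrite mul0r.
have rPR : r%:R * (z P)%:R <= 2 * #|` P|%:R :> R by rewrite -!natrM ler_nat.
have rQR : r%:R * (z Q)%:R <= 2 * #|` Q|%:R :> R by rewrite -!natrM ler_nat.
have r4 : 0 <= 4 * r%:R :> R by rewrite mulr_ge0 ?ler0n.
apply: (le_trans (ler_wpM2l r4 pairs)); rewrite ler_pdivlMr //.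
move: rPR rQR (ler0n R (z P)) (ler0n R (z Q)) (ler0n R #|` P|) (ler0n R #|` Q|).
set p := #|` P|%:R; set q := #|` Q|%:R; set zp := (z P)%:R; set zq := (z Q)%:R.
move=> rPR rQR zp0 zq0 p0 q0.
have h1 : (r%:R * zp) * (r%:R * zq) <= (2 * p) * (2 * q).
  by apply: ler_pM => //; rewrite mulr_ge0 ?ler0n.
have X0 : 0 <= W * (p * zp) * (q * zq) by rewrite !mulr_ge0.
have h2 := ler_wpM2l (mulr_ge0 r4 X0) Tr.
have Y0 : 0 <= 32 * (W * (p * q)) by rewrite !mulr_ge0.
have h3 := ler_wpM2l Y0 h1.
move: h2 h3 => /= h2 h3.
lra.
Qed.

End SzemerediTrotter.

(** * Popular differences *)

Section Differences.
Variable R : archiRealFieldType.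
Implicit Types (A B C P Q S U V X Y : {fset R}) (m v x y T M t : R).

Lemma sum_rich_sqr1_le P Q S V T :
  2 <= T -> 0 \notin S ->
  \sum_(m <- S) \sum_(v <- V)
      (T <= richness P Q m v)%R%:R * richness P Q m v ^+ 2
    <= 128 * (#|` P|%:R * #|` Q|%:R) ^+ 2 / T.
Proof.
move=> T2 S0.
have := @sum_rich_sqr_le R (fun=> 1) P Q S V T 1 T2 ler01 S0.
rewrite mulr1; under eq_bigr => m _ do under eq_bigr => v _ do rewrite mul1r.
by apply=> m _; rewrite ler01 lexx.
Qed.

Lemma incidences_le P Q S V T :
  2 <= T -> 0 \notin S ->
  \sum_(m <- S) \sum_(v <- V) richness P Q m v
    <= T * (#|` S|%:R * #|` V|%:R)
       + 128 * (#|` P|%:R * #|` Q|%:R) ^+ 2 / T ^+ 2.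
Proof.
move=> T2 S0; have T0 : 0 < T by lra.
apply: (@le_trans _ _ (\sum_(m <- S) \sum_(v <- V)
   (T + T^-1 * ((T <= richness P Q m v)%R%:R * richness P Q m v ^+ 2)))).
  apply: ler_sum => m _; apply: ler_sum => v _.
  have k0 := richness_ge0 P Q m v.
  have [Tk|/ltW Tk] := leP T (richness P Q m v); last by rewrite mul0r mulr0 addr0.
  rewrite mul1r -[leLHS]add0r; apply: lerD; first exact: ltW.
  by rewrite ler_pdivlMl // expr2; apply: ler_wpM2r.
under eq_bigr do rewrite big_split /= -mulr_sumr.
rewrite big_split /= -mulr_sumr; apply: lerD.
  under eq_bigr do rewrite sum_const_fset.
  by rewrite sum_const_fset mulrA mulrC.
have := ler_wpM2l (ltW (_ : 0 < T^-1)) (sum_rich_sqr1_le P Q V T2 S0).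
rewrite invr_gt0 T0 => /(_ isT)/le_trans; apply.
have e z : T^-1 * (z / T) = z / T ^+ 2 by field; rewrite lt0r_neq0.
by rewrite e.
Qed.

(** If d / p lies in X for every p in P and d in D, then every u - v in D equals
    p x with x in X in |P| ways. Each is an incidence between the point (p, u)
    and the line u = x p + v, so that many differences in D force many
    incidences. *)
Lemma differences_in_le P (D : {pred R}) U V X T :
  2 <= T -> 0 \notin P -> 0 \notin X ->
  (forall p d, p \in P -> d \in D -> d / p \in X) ->
  #|` P|%:R * (\sum_(u <- U) \sum_(v <- V) (u - v \in D)%:R)
    <= T * (#|` X|%:R * #|` V|%:R)
       + 128 * (#|` P|%:R * #|` U|%:R) ^+ 2 / T ^+ 2.
Proof.
move=> T2 P0 X0 PD; apply: le_trans (incidences_le P U V T2 X0).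
rewrite -sum_const_fset [leRHS]exchange_big /=.
under eq_bigr => p _ do rewrite exchange_big /=.
rewrite exchange_big /=; apply: ler_sum => v _.
rewrite /richness [leRHS]exchange_big /=; apply: ler_sum_fset => p pP.
have p0 : p != 0 by apply: contraNneq P0 => <-.
under [leRHS]eq_bigr => x _ do rewrite -sum_pred1_fset.
rewrite [leRHS]exchange_big /=; apply: ler_sum => u _.
under eq_bigr => x _.
  rewrite (_ : (u == x * p + v) = (x == (u - v) / p)); first over.
  by rewrite -subr_eq eq_sym -(inj_eq (mulIf p0) x) divfK.
rewrite sum_pred1_fset; apply: ler_ind; exact: PD.
Qed.

Definition diffs A x : R := \sum_(a <- A) (a - x \in A)%:R.

Lemma diffs_ge0 A x : 0 <= diffs A x.
Proof. by apply: sumr_ge0 => a _; exact: ind_ge0. Qed.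

Lemma diffs_le_card A x : diffs A x <= #|` A|%:R.
Proof. exact: sum_ind_le_card. Qed.

Lemma diffsN A x : diffs A (- x) = diffs A x.
Proof.
rewrite /diffs; under eq_bigr => a _ do rewrite -sum_pred1_fset.
rewrite exchange_big; apply: eq_bigr => b _ /=.
rewrite -sum_pred1_fset; apply: eq_bigr => a _.
by rewrite eq_sym subr_eq.
Qed.

Lemma diffs_gt0P A x : 0 < diffs A x -> exists a b, [/\ a \in A, b \in A & x = a - b].
Proof.
move=> h; have [/hasP[a aA /= bA]|/hasPn h'] := boolP (has (fun a => a - x \in A) A).
  by exists a, (a - x); split => //; rewrite subKr.
by move: h; rewrite /diffs big_seq big1 ?ltxx // => a /h' /negbTE ->.
Qed.

Lemma sum_diffs A Y (h : R -> R) :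
  \sum_(y <- Y) diffs A y * h y
    = \sum_(a <- A) \sum_(b <- A) (a - b \in Y)%:R * h (a - b).
Proof.
rewrite /diffs; under eq_bigr do rewrite mulr_suml.
rewrite exchange_big; apply: eq_bigr => a _ /=.
under [RHS]eq_bigr do rewrite -sum_pred1_fset_mul.
rewrite [RHS]exchange_big; apply: eq_bigr => y _ /=.
rewrite -sum_pred1_fset mulr_suml; apply: eq_bigr => b _.
by rewrite eq_sym subr_eq [y == _]eq_sym subr_eq addrC.
Qed.

(** A dilate of A inside B carries all representations of x along. *)
Lemma diffs_scale A B (c x : R) : (forall a, a \in A -> c * a \in B) -> c != 0 ->
  diffs A x <= diffs B (c * x).
Proof.
move=> AB c0; rewrite /diffs.
apply: (@le_trans _ _ (\sum_(a <- A) (c * a - c * x \in B)%:R)).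
  by apply: ler_sum => a _; apply: ler_ind; rewrite -mulrBr; exact: AB.
rewrite -(big_map ( *%R c) xpredT (fun b => (b - c * x \in B)%:R)) /=.
have e : perm_eq (map ( *%R c) A)
    [seq b <- B | b \in map ( *%R c) A].
  apply: uniq_perm; rewrite ?filter_uniq ?fset_uniq //.
    by rewrite map_inj_uniq ?fset_uniq //; exact: mulfI.
  move=> b; rewrite mem_filter; apply/idP/andP => [bA|[]//].
  by split=> //; case/mapP: bA => a /AB ? ->.
rewrite (perm_big _ e) big_filter big_mkcond; apply: ler_sum => b _ /=.
by case: ifP => // _; exact: ind_ge0.
Qed.

(** With t0 of order 1 and M of order |A|^3, this is the level-set estimate for
    representation numbers that Szemeredi-Trotter provides: there are at most M
    / t^3 differences with t representations. The form weighted by [diffs] is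
    what [sum_dyadic] sums. *)
Definition tail_bounded A M t0 := forall t Y, t0 <= t ->
  (forall y, y \in Y -> t <= diffs A y) -> \sum_(y <- Y) diffs A y <= M / t ^+ 2.

(** An element v of Y has t differences u - v with values in A, u in A. If A / S
    is contained in the small set X, [differences_in_le] applies with S acting
    on A. *)
Lemma tail_bound A S X :
  S != fset0 -> 0 \notin S -> 0 \notin X ->
  (forall s a, s \in S -> a \in A -> a / s \in X) ->
  tail_bounded A (1024 * (#|` A|%:R * #|` X|%:R) ^+ 2 / #|` S|%:R)
     (8 * #|` X|%:R / #|` S|%:R).
Proof.
move=> Sn0 S0 X0 SA t Y tt Yt.
have [->|/fset0Pn[a0 a0A]] := eqVneq A fset0.
  rewrite (_ : \sum_(y <- Y) _ = 0) ?cardfs0 ?mul0r ?expr0n ?mulr0 ?mul0r//.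
  by apply: big1 => y _; rewrite /diffs big_seq big1.
have s0 : 0 < #|` S|%:R :> R by rewrite ltr0n cardfs_gt0.
have x0 : 0 < #|` X|%:R :> R.
  have /fset0Pn[s sS] := Sn0; rewrite ltr0n cardfs_gt0.
  by apply/fset0Pn; exists (a0 / s); exact: SA.
have t0 : 0 < t by apply: lt_le_trans tt; rewrite divr_gt0 ?mulr_gt0.
(* With this threshold the first term of the incidence bound is at most half of
   the left-hand side, into which it is absorbed. *)
pose T := t * #|` S|%:R / (2 * #|` X|%:R).
have T2 : 2 <= T.
  move: tt; rewrite /T ler_pdivlMr ?mulr_gt0 // ler_pdivrMr // => tt.
  apply: le_trans tt; nra.
set F := \sum_(y <- Y) _.
have FE : F = \sum_(u <- A) \sum_(v <- Y) (u - v \in A)%:R.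
  by rewrite /F exchange_big.
have := differences_in_le A Y T2 S0 X0 SA.
rewrite -FE => hF.
have YF : t * #|` Y|%:R <= F.
  by rewrite mulrC -sum_const_fset; apply: ler_sum_fset.
have hT : T * (#|` X|%:R * #|` Y|%:R) = #|` S|%:R * (t * #|` Y|%:R) / 2.
  by rewrite /T; field; rewrite lt0r_neq0.
rewrite hT in hF.
have h3 : #|` S|%:R * F <= 256 * (#|` S|%:R * #|` A|%:R) ^+ 2 / T ^+ 2.
  have := ler_wpM2l (ltW s0) YF; lra.
have -> : 1024 * (#|` A|%:R * #|` X|%:R) ^+ 2 / #|` S|%:R / t ^+ 2
   = #|` S|%:R^-1 * (256 * (#|` S|%:R * #|` A|%:R) ^+ 2 / T ^+ 2).
  by rewrite /T; field; rewrite !lt0r_neq0.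
by rewrite ler_pdivlMl.
Qed.

Lemma tail_bounded_card A M t0 t Y : tail_bounded A M t0 -> t0 <= t -> 0 < t ->
  (forall y, y \in Y -> t <= diffs A y) -> #|` Y|%:R <= M / t ^+ 3.
Proof.
move=> hA tt tp Yt; have h := hA _ _ tt Yt.
rewrite exprSr invfM mulrA ler_pdivlMr //; apply: le_trans h.
by rewrite -sum_const_fset; exact: ler_sum_fset.
Qed.

(** Upper bounds on the layers [t * 2 ^+ j <= k] bound the sum weighted by [k],
    with a geometric or a constant series in j according to the decay of [B]. *)
Lemma sum_dyadic (I : Type) (s : seq I) (k g : I -> R) (B : R -> R) t (J : nat) :
  0 < t -> (forall i, 0 <= k i) -> (forall i, 0 <= g i) ->
  (forall i, k i < t * 2 ^+ J) ->
  (forall j : nat, (j < J)%N ->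
     \sum_(i <- s) (t * 2 ^+ j <= k i)%R%:R * g i <= B (t * 2 ^+ j)) ->
  \sum_(i <- s) (t <= k i)%R%:R * (g i * k i)
    <= \sum_(j < J) (t * 2 ^+ j.+1) * B (t * 2 ^+ j).
Proof.
elim: J t => [|J IH] t t0 k0 g0 kt hB.
  rewrite big1 ?big_ord0 // => i _.
  by have := kt i; rewrite expr0 mulr1 ltNge => /negbTE ->; rewrite mul0r.
rewrite big_ord_recl /=.
apply: (@le_trans _ _ (\sum_(i <- s) (t * 2 * ((t <= k i)%R%:R * g i)
    + (t * 2 <= k i)%R%:R * (g i * k i)))).
  apply: ler_sum => i _; have gi := g0 i.
  have [tk|kt'] := leP t (k i); have [t2|t2] := leP (t * 2) (k i).
  - by rewrite !mul1r lerDr !mulr_ge0 // ltW.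
  - by rewrite mul0r addr0 !mul1r mulrC; apply: ler_wpM2r => //; exact: ltW.
  - by exfalso; lra.
  - by rewrite !mul0r mulr0 addr0.
rewrite big_split /= -mulr_sumr; apply: lerD.
  rewrite expr1 expr0 mulr1; apply: ler_wpM2l; first by rewrite mulr_ge0 // ltW.
  by have := hB 0%N isT; rewrite expr0 mulr1.
apply: (le_trans (IH (t * 2) _ k0 g0 _ _)).
- by rewrite mulr_gt0.
- by move=> i; rewrite -mulrA -exprS.
- by move=> j jJ; have := hB j.+1 jJ; rewrite exprS mulrA.
- by apply: ler_sum => j _; rewrite !exprS /bump /= !mulrA.
Qed.

End Differences.

(** * Growth of product sets *)

Section ProductSets.
Variable F : fieldType.
Implicit Types (A B C D X Y : {fset F}).

Definition mulset A B : {fset F} := [fset a * b | a in A, b in B].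
Definition invset A : {fset F} := [fset a^-1 | a in A].

Lemma mulsetP A B x :
  reflect (exists a b, [/\ a \in A, b \in B & x = a * b]) (x \in mulset A B).
Proof.
apply: (iffP (imfset2P _ _ _ _ _)) => [[a /= aA [b /= bB ->]]|[a [b [aA bB ->]]]].
  by exists a, b.
by exists a => //; exists b.
Qed.

Lemma mem_mulset A B a b : a \in A -> b \in B -> a * b \in mulset A B.
Proof. by move=> aA bB; apply/mulsetP; exists a, b. Qed.

Lemma mem_invset A a : (a \in invset A) = (a^-1 \in A).
Proof.
apply/imfsetP/idP => [[b /= bA ->]|aA]; first by rewrite invrK.
by exists a^-1 => //; rewrite invrK.
Qed.

Lemma card_invset A : #|` invset A| = #|` A|.
Proof. by rewrite card_imfset //; exact: invr_inj. Qed.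

Lemma mulset_neq0 A B : 0 \notin A -> 0 \notin B -> 0 \notin mulset A B.
Proof.
move=> A0 B0; apply/mulsetP => -[a [b [aA bB /esym/eqP]]].
by rewrite mulf_eq0 => /orP[] /eqP z; move: aA bB; rewrite z ?(negbTE A0) ?(negbTE B0).
Qed.

Lemma invset_neq0 A : 0 \notin A -> 0 \notin invset A.
Proof. by rewrite mem_invset invr0. Qed.

Lemma mulsetA A B C : mulset A (mulset B C) = mulset (mulset A B) C.
Proof.
apply/fsetP => x; apply/mulsetP/mulsetP => -[a [b [aA bB ->]]].
  have /mulsetP[b1 [c [b1B cC ->]]] := bB.
  by exists (a * b1), c; rewrite mem_mulset ?mulrA.
have /mulsetP[a1 [b1 [a1B b1B ->]]] := aA.
by exists a1, (b1 * b); rewrite mem_mulset ?mulrA.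
Qed.

Lemma mulsetSl A B C : A `<=` B -> mulset A C `<=` mulset B C.
Proof.
move=> /fsubsetP AB; apply/fsubsetP => x /mulsetP[a [c [aA cC ->]]].
by rewrite mem_mulset ?AB.
Qed.

Lemma card_scale A x : x != 0 -> #|` [fset a * x | a in A]| = #|` A|.
Proof. by move=> x0; rewrite card_imfset //; exact: mulIf. Qed.

Lemma card_mulset_ge A B b : b != 0 -> b \in B -> (#|` A| <= #|` mulset A B|)%N.
Proof.
move=> b0 bB; rewrite -(card_scale A b0).
by apply/fsubset_leq_card/fsubsetP => _ /imfsetP[a /= aA ->]; exact: mem_mulset.
Qed.

(** Induction on C, adding one element x. Let Y1 consist of the y in Y for which
    y D x is already covered by Y D C'. Passing from C' to C adds at most |Y D|
    - |Y1 D| elements to Y D C, while Y C gains at least |Y| - |Y1| elements, as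
    x y in Y C' puts y into Y1. The minimality of |Y D| / |Y| among subsets,
    used for Y1, says that the first gain is at most |Y D| / |Y| times the
    second. *)
Lemma petridis Y D C : 0 \notin C ->
  (forall Y', Y' `<=` Y ->
     (#|` mulset Y D| * #|` Y'| <= #|` mulset Y' D| * #|` Y|)%N) ->
  (#|` mulset (mulset Y D) C| * #|` Y| <= #|` mulset Y D| * #|` mulset Y C|)%N.
Proof.
move=> C0 hY; elim/finSet_rect: C C0 => C IH C0.
have [->|[x xC]] := fset_0Vmem C.
  suff -> : mulset (mulset Y D) fset0 = fset0 by rewrite cardfs0.
  by apply/fsetP => z; rewrite inE; apply/mulsetP => -[a [b []]]; rewrite inE.
have x0 : x != 0 by apply: contraNneq C0 => <-.
have C'0 : 0 \notin C `\ x by rewrite !inE negb_and C0 orbT.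
have {}IH := IH _ (fproperD1 xC) C'0.
set C' := C `\ x in IH C'0 *.
pose Y1 := [fset y in Y | [fset y * d * x | d in D] `<=` mulset (mulset Y D) C'].
pose Y2 := [fset y in Y | y * x \in mulset Y C'].
have Y1Y : Y1 `<=` Y by exact: fset_sub.
have Y21 : Y2 `<=` Y1.
  apply/fsubsetP => y; rewrite !inE /= => /andP[yY /mulsetP[y1 [c [y1Y cC e]]]].
  rewrite yY /=; apply/fsubsetP => _ /imfsetP[d /= dD ->].
  by rewrite mulrAC e mulrAC !mem_mulset.
(* Only y d x with y d outside Y1 D can be new. *)
have YD : (#|` mulset (mulset Y D) C| + #|` mulset Y1 D|
    <= #|` mulset (mulset Y D) C'| + #|` mulset Y D|)%N.
  have sub : mulset (mulset Y D) C `<=`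
      mulset (mulset Y D) C' `|` [fset z * x | z in mulset Y D `\` mulset Y1 D].
    apply/fsubsetP => z /mulsetP[p [c [pYD cC ->]]].
    rewrite inE; have [cx|cx] := eqVneq c x; last first.
      by rewrite mem_mulset // !inE cx.
    rewrite cx; have [pY1|pY1] := boolP (p \in mulset Y1 D).
      have /mulsetP[y [d [yY1 dD ->]]] := pY1.
      move: yY1; rewrite !inE /= => /andP[_ /fsubsetP ->//].
      by apply/imfsetP; exists d.
    by apply/orP; right; apply/imfsetP; exists p => //=; rewrite inE pY1.
  have h1 := fsubset_leq_card sub.
  have h2 := cardfsUI (mulset (mulset Y D) C')
    [fset z * x | z in mulset Y D `\` mulset Y1 D].
  have h3 := cardfsDS (mulsetSl D Y1Y).
  have h4 := fsubset_leq_card (mulsetSl D Y1Y).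
  by rewrite card_scale // in h2; lia.
have YC : (#|` mulset Y C'| + #|` Y| <= #|` mulset Y C| + #|` Y2|)%N.
  have sub : mulset Y C' `|` [fset y * x | y in Y `\` Y2] `<=` mulset Y C.
    apply/fsubsetP => z; rewrite inE => /orP[/mulsetP[y [c [yY cC ->]]]|].
      by apply: mem_mulset => //; move: cC; rewrite !inE => /andP[].
    case/imfsetP => y /=; rewrite inE => /andP[_ yY] ->; exact: mem_mulset.
  have dis : mulset Y C' `&` [fset y * x | y in Y `\` Y2] = fset0.
    apply/fsetP => z; rewrite !inE; apply/negbTE/andP => -[zC /imfsetP[y /=]].
    by rewrite !inE => /andP[+ yY] e; rewrite -e yY zC.
  have h1 := fsubset_leq_card sub.
  have h2 := cardfsUI (mulset Y C') [fset y * x | y in Y `\` Y2].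
  have Y2Y : Y2 `<=` Y by exact: fset_sub.
  have h3 := cardfsDS Y2Y; have h4 := fsubset_leq_card Y2Y.
  by rewrite dis cardfs0 card_scale // in h2; lia.
have h1 := hY _ Y1Y; have h2 := fsubset_leq_card Y21.
have {}YD := leq_mul YD (leqnn #|` Y|).
have {}YC := leq_mul (leqnn #|` mulset Y D|) YC.
have {}h2 := leq_mul (leqnn #|` mulset Y D|) h2.
rewrite !mulnDl in YD; rewrite !mulnDr in YC.
lia.
Qed.

(** A minimiser of |Y D| / |Y|, with the ratios multiplied out to remain in the
    natural numbers. *)
Lemma exists_min_ratio B D : B != fset0 ->
  exists Y, [/\ Y `<=` B, Y != fset0,
    (#|` mulset Y D| * #|` B| <= #|` mulset B D| * #|` Y|)%N &
    forall Y', Y' `<=` Y ->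
     (#|` mulset Y D| * #|` Y'| <= #|` mulset Y' D| * #|` Y|)%N].
Proof.
elim/finSet_rect: B => B IH B0.
pose better Y' := (#|` mulset Y' D| * #|` B| < #|` mulset B D| * #|` Y'|)%N.
have [/hasP[Y']|/hasPn h] := boolP (has better (fpowerset B)); last first.
  exists B; split => // Y' Y'B; rewrite leqNgt; apply: h.
  by rewrite fpowersetE.
rewrite fpowersetE /better => Y'B lt.
have Y'0 : Y' != fset0 by apply: contraTneq lt => ->; rewrite cardfs0 muln0 ltn0.
have Y'p : Y' `<` B.
  rewrite fproperEneq Y'B andbT; apply: contraTneq lt => ->; by rewrite ltnn.
have [Y [YY' Y0 hY hmin]] := IH _ Y'p Y'0.
exists Y; split => //; first exact: fsubset_trans YY' Y'B.
rewrite -cardfs_gt0 in Y'0; rewrite -(leq_pmul2r Y'0).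
have {}hY := leq_mul hY (leqnn #|` B|).
have {}lt := leq_mul (ltnW lt) (leqnn #|` Y|).
lia.
Qed.

(** Two applications of [petridis], with C equal to D and to D D: each further
    factor D costs a factor |Y D| / |Y|. *)
Lemma plunnecke B D : 0 \notin D -> B != fset0 ->
  exists Y, [/\ Y `<=` B, Y != fset0,
    (#|` mulset Y D| * #|` B| <= #|` mulset B D| * #|` Y|)%N &
    (#|` mulset (mulset (mulset Y D) D) D| * #|` Y| ^ 2 <= #|` mulset Y D| ^ 3)%N].
Proof.
move=> D0 B0; have [Y [YB Y0 hY hmin]] := exists_min_ratio D B0.
exists Y; split => //.
have h1 := petridis D0 hmin.
have h2 := petridis (mulset_neq0 D0 D0) hmin.
rewrite !mulsetA in h2.
have {}h1 := leq_mul (leqnn #|` mulset Y D|) h1.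
have {}h2 := leq_mul h2 (leqnn #|` Y|).
lia.
Qed.

End ProductSets.

(** * Multiplicative energy and sets of small quotient set *)

Section Energy.
Variable R : realFieldType.
Implicit Types (A B C : {fset R}) (x y q : R).

(** Injective changes of variables into A are used throughout to compare counts;
    the terms that leave A are dropped. *)
Lemma sum_inj_le (A C : {fset R}) (phi : R -> R) (h : R -> R) :
  {in C &, injective phi} -> (forall x, x \in A -> 0 <= h x) ->
  \sum_(c <- C) (phi c \in A)%:R * h (phi c) <= \sum_(x <- A) h x.
Proof.
move=> inj h0.
under eq_bigr => c _ do rewrite -sum_pred1_fset_mul.
rewrite exchange_big; apply: ler_sum_fset => x xA /=.
rewrite -mulr_suml -[leRHS]mul1r; apply: ler_wpM2r; first exact: h0.
have [/hasP[c cC /= /eqP xc]|/hasPn hx] := boolP (has (fun c => x == phi c) C).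
  rewrite (@eq_big_seq _ _ _ _ _ _ (fun c' => (c' == c)%:R)).
    by rewrite sum_pred1_fset ind_le1.
  move=> c' c'C; rewrite xc; congr ((nat_of_bool _)%:R).
  by apply/eqP/eqP => [/esym/inj ->//|->].
by rewrite big_seq big1 ?ler01 // => c /hx /negbTE ->.
Qed.

Definition quots A q : R := \sum_(a <- A) (q * a \in A)%:R.

Lemma quots_ge0 A q : 0 <= quots A q.
Proof. by apply: sumr_ge0 => a _; exact: ind_ge0. Qed.

Lemma quots_le_card A q : quots A q <= #|` A|%:R.
Proof. exact: sum_ind_le_card. Qed.

Lemma quotsV A q : q != 0 -> quots A q^-1 = quots A q.
Proof.
move=> q0; rewrite /quots; under eq_bigr => a _ do rewrite -sum_pred1_fset.
rewrite exchange_big; apply: eq_bigr => b _ /=.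
rewrite -sum_pred1_fset; apply: eq_bigr => a _.
by rewrite -(inj_eq (mulfI q0)) mulVKf // eq_sym.
Qed.

Lemma sum_quots A (Y : {fset R}) (h : R -> R) : 0 \notin A ->
  \sum_(y <- Y) quots A y * h y
    = \sum_(a <- A) \sum_(b <- A) (a / b \in Y)%:R * h (a / b).
Proof.
move=> A0; rewrite exchange_big /= /quots; under eq_bigr do rewrite mulr_suml.
rewrite exchange_big; apply: eq_big_seq => b bA /=.
have b0 : b != 0 by apply: contraNneq A0 => <-.
under [RHS]eq_bigr do rewrite -sum_pred1_fset_mul.
rewrite [RHS]exchange_big; apply: eq_bigr => y _ /=.
rewrite -sum_pred1_fset mulr_suml; apply: eq_bigr => a _.
by rewrite -(inj_eq (mulIf b0) y) divfK // eq_sym.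
Qed.

Definition mult_energy A : R := \sum_(a <- A) \sum_(b <- A) quots A (a / b).

(** Average over the quotients q of A. The squares of the sizes of the sets of
    all a in A with q a in A add up to the multiplicative energy, whereas an
    unpopular pair (a, b) lies in few of the sets, since q a and q b in A
    represent the unpopular quotient a / b. So some set is large and contains
    few unpopular pairs. *)
Lemma popular_dilate A (K : R) : 0 \notin A -> A != fset0 -> 0 < K ->
  #|` A|%:R ^+ 3 <= K * mult_energy A ->
  exists q, q != 0 /\ (#|` A|%:R <= 4 * K * quots A q /\
    8 * (\sum_(a <- A) \sum_(b <- A) [&& q * a \in A, q * b \in A
        & (quots A (a / b) * (16 * K) < #|` A|%:R)%R]%:R) <= quots A q ^+ 2).
Proof.
move=> A0 An K0; set k : R := #|` A|%:R => hE.
have kp : 0 < k by rewrite ltr0n cardfs_gt0.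
pose S := mulset A (invset A).
pose bad q : R := \sum_(a <- A) \sum_(b <- A) [&& q * a \in A, q * b \in A
        & (quots A (a / b) * (16 * K) < k)%R]%:R.
(* The sum of G over q is positive, as the energy exceeds the two subtracted
   sums; any q with G q positive will do. *)
pose G q := quots A q ^+ 2 - 8 * bad q
   - (quots A q * (4 * K) < k)%R%:R * quots A q ^+ 2.
have SA a b : a \in A -> b \in A -> a / b \in S.
  by move=> aA bA; apply: mem_mulset; rewrite // mem_invset invrK.
have S_sum (h : R -> R) : \sum_(q <- S) quots A q * h q
    = \sum_(a <- A) \sum_(b <- A) h (a / b).
  rewrite sum_quots //; apply: eq_big_seq => a aA; apply: eq_big_seq => b bA.
  by rewrite SA // mul1r.
have hsq : \sum_(q <- S) quots A q ^+ 2 = mult_energy A.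
  by rewrite /mult_energy -S_sum; apply: eq_bigr => q _; rewrite expr2.
have hs1 : \sum_(q <- S) quots A q = k ^+ 2.
  under eq_bigr do rewrite -[quots _ _]mulr1.
  by rewrite (S_sum (fun=> 1)) sum_const_fset sum_const_fset mulr1 expr2.
have hbad : (16 * K) * \sum_(q <- S) bad q <= k ^+ 3.
  rewrite /bad exchange_big /=; under eq_bigr => a _ do rewrite exchange_big /=.
  apply: (@le_trans _ _ (\sum_(a <- A) \sum_(b <- A) k)); last first.
    by rewrite !sum_const_fset -/k !exprS expr0 mulr1.
  rewrite mulr_sumr; apply: ler_sum_fset => a aA.
  rewrite mulr_sumr; apply: ler_sum_fset => b bA.
  have b0 : b != 0 by apply: contraNneq A0 => <-.
  have [f|f] := boolP (quots A (a / b) * (16 * K) < k); last first.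
    by rewrite big1 ?mulr0 ?(ltW kp) // => q _; rewrite !andbF.
  apply: le_trans (ltW f); rewrite mulrC; apply: ler_wpM2r; first by rewrite mulr_ge0 ?ltW.
  apply: le_trans (@sum_inj_le A S (fun q => q * b)
     (fun x => (a / b * x \in A)%:R) _ _); last 2 first.
  - by move=> q q' _ _; exact: mulIf.
  - by move=> x _; exact: ind_ge0.
  apply: ler_sum => q _; rewrite -ind_andb; apply: ler_ind.
  by rewrite andbT andbC mulrCA mulrC divfK // mulrC.
have hsmall : (4 * K) * \sum_(q <- S) (quots A q * (4 * K) < k)%R%:R * quots A q ^+ 2
   <= k ^+ 3.
  rewrite exprS -hs1 !mulr_sumr; apply: ler_sum => q _.
  have q0 := quots_ge0 A q.
  case: (ltP (quots A q * (4 * K)) k) => [lt|_]; last first.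
    by rewrite mul0r mulr0 mulr_ge0 // ltW.
  rewrite mul1r expr2 mulrA; apply: ler_wpM2r => //.
  by rewrite mulrC ltW.
have Gpos : 0 < \sum_(q <- S) G q.
  rewrite /G !sumrB hsq -mulr_sumr -(pmulr_rgt0 _ K0).
  have : 0 < k ^+ 3 by exact: exprn_gt0.
  lra.
have [/hasP[q qS /= Gq]|/hasPn h] := boolP (has (fun q => 0 < G q) S); last first.
  by move: Gpos; rewrite big_seq ltNge sumr_le0 // => q /h; rewrite leNgt.
exists q; split.
  apply: contraNneq (mulset_neq0 A0 (invset_neq0 A0)) => q0; by rewrite -q0.
have b0 : 0 <= bad q by do 2!apply: sumr_ge0 => ? _; exact: ind_ge0.
move: Gq; rewrite /G -/(bad q); case: (ltP (quots A q * (4 * K)) k) => [_|lt].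
  by rewrite mul1r => Gq; exfalso; lra.
rewrite mul0r subr0 => Gq; split; last by rewrite -/(bad q); lra.
by rewrite mulrC.
Qed.

(** Inside the set Aq of all a in A with q a in A, for the q given by
    [popular_dilate], let B consist of the elements with few unpopular partners.
    Two elements a, b of B have at least half of Aq as common popular partners
    c, and a / b = (a / c) (c / b) then has many representations as a product of
    two quotients of A. There are only |A|^4 such products, so B / B is small.
    *)
Lemma balog_szemeredi_gowers A (K : R) : 0 \notin A -> A != fset0 -> 0 < K ->
  #|` A|%:R ^+ 3 <= K * mult_energy A ->
  exists B, [/\ B `<=` A, B != fset0, #|` A|%:R <= 8 * K * #|` B|%:R &
    #|` mulset B (invset B)|%:R <= 2048 * K ^+ 3 * #|` A|%:R].
Proof.
move=> A0 An K0 hE; have [q [q0 [hq hbad]]] := popular_dilate A0 An K0 hE.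
set k : R := #|` A|%:R in hE hq hbad *.
have kp : 0 < k by rewrite ltr0n cardfs_gt0.
pose Aq := [fset a in A | q * a \in A].
have AqA : Aq `<=` A by exact: fset_sub.
pose s : R := quots A q.
have sE : #|` Aq|%:R = s.
  rewrite /s /quots -sum1_fset big_fset /= big_mkcond; apply: eq_bigr => a _.
  by case: ifP.
have sp : 0 < s by move: hq; rewrite -/s; nra.
pose unpop a b := (quots A (a / b) * (16 * K) < k)%R.
(* By Markov, at least half of Aq has few unpopular partners. *)
pose bad a : R := \sum_(b <- Aq) (unpop a b)%:R.
have badE : \sum_(a <- Aq) bad a = \sum_(a <- A) \sum_(b <- A)
    [&& q * a \in A, q * b \in A & unpop a b]%:R.
  rewrite big_fset /= big_mkcond; apply: eq_bigr => a _.
  case: ifP => _ /=; last by rewrite big1.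
  rewrite /bad big_fset /= big_mkcond; apply: eq_bigr => b _.
  by case: ifP.
pose B := [fset a in Aq | (4 * bad a <= s)%R].
have BAq : B `<=` Aq by exact: fset_sub.
have cardB : #|` B|%:R = \sum_(a <- Aq) (4 * bad a <= s)%R%:R :> R.
  rewrite -sum1_fset /B big_fset /= big_mkcond; apply: eq_bigr => a _.
  by case: ifP.
have Bs : s <= 2 * #|` B|%:R.
  have : s * (s - #|` B|%:R) <= 4 * \sum_(a <- Aq) bad a.
    rewrite -{2}sE cardB -sum1_fset -sumrB !mulr_sumr; apply: ler_sum => a _.
    have b0 : 0 <= bad a by apply: sumr_ge0 => ? _; exact: ind_ge0.
    case: (leP (4 * bad a) s) => [_|/ltW]; first by rewrite subrr mulr0 mulr_ge0.
    by rewrite subr0 mulr1.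
  move: hbad; rewrite -badE -/s; nra.
have B0 : B != fset0.
  by rewrite -cardfs_gt0 -(ltr0n R); lra.
exists B; split => //; first exact: fsubset_trans BAq AqA.
  by rewrite -/s in hq; nra.
have nzA a : a \in A -> a != 0 by apply: contraTneq => ->.
have inA a : a \in Aq -> a \in A by apply: (fsubsetP AqA).
(* [W x] counts the ways to write x = (z / y) (u / w) with entries in A. *)
pose W x : R := \sum_(y <- A) \sum_(w <- A) \sum_(u <- A) (x * y * w / u \in A)%:R.
have Wlow x : x \in mulset B (invset B) -> s / 2 * (k / (16 * K)) ^+ 2 <= W x.
  case/mulsetP => a [b' [aB]]; rewrite mem_invset => bB ->.
  move: (b'^-1) bB (invrK b') => b bB <- {b'}.
  have [aA bA] := (inA _ (fsubsetP BAq _ aB), inA _ (fsubsetP BAq _ bB)).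
  have [a0 b0] := (nzA _ aA, nzA _ bA).
  apply: (@le_trans _ _ (\sum_(c <- Aq) quots A (a / c) * quots A (c / b))).
    have good : s / 2 <= \sum_(c <- Aq) (~~ unpop a c && ~~ unpop b c)%:R.
      have ha : 4 * bad a <= s by move: aB; rewrite !inE => /andP[].
      have hb : 4 * bad b <= s by move: bB; rewrite !inE => /andP[].
      have : s <= \sum_(c <- Aq) (~~ unpop a c && ~~ unpop b c)%:R + (bad a + bad b).
        rewrite -sE -sum1_fset -!big_split /=; apply: ler_sum => c _.
        by case: (unpop a c) (unpop b c) => -[]; rewrite /=; lra.
      lra.
    have t0 : 0 <= (k / (16 * K)) ^+ 2 by exact: sqr_ge0.
    apply: (le_trans (ler_wpM2r t0 good)); rewrite mulr_suml.
    apply: ler_sum_fset => c cAq; have c0 := nzA _ (inA _ cAq).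
    have q1 := quots_ge0 A (a / c); have q2 := quots_ge0 A (c / b).
    case: (boolP (_ && _)) => [/andP[]|_]; last by rewrite mul0r mulr_ge0.
    rewrite /unpop -!leNgt mul1r expr2 => h1 h2.
    have K16 : 0 < 16 * K by rewrite mulr_gt0.
    rewrite -(ler_pdivrMr _ _ K16) in h1; rewrite -(ler_pdivrMr _ _ K16) in h2.
    rewrite -quotsV ?mulf_neq0 ?invr_eq0 // invf_div in h2.
    by apply: ler_pM => //; apply: divr_ge0; exact: ltW.
  under eq_bigr => c _ do rewrite /quots mulr_suml.
  rewrite exchange_big; apply: ler_sum_fset => y yA /=.
  under eq_bigr => c _ do rewrite mulr_sumr.
  rewrite exchange_big; apply: ler_sum_fset => w wA /=.
  apply: le_trans (@sum_inj_le A Aq (fun c => a / c * y)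
     (fun u => (a / b * y * w / u \in A)%:R) _ _); last 2 first.
  - move=> c c' _ _ /(mulIf (nzA _ yA)) /(mulfI a0); exact: invr_inj.
  - by move=> u _; exact: ind_ge0.
  apply: ler_sum_fset => c cAq; have c0 := nzA _ (inA _ cAq).
  have y0 := nzA _ yA.
  rewrite (_ : a / b * y * w / (a / c * y) = c / b * w) //.
  by field; rewrite ?a0 ?b0 ?c0 ?y0.
have Wup : \sum_(x <- mulset B (invset B)) W x <= k ^+ 4.
  have -> : k ^+ 4 = \sum_(y <- A) \sum_(w <- A) \sum_(u <- A) k.
    by rewrite !sum_const_fset -/k !exprS expr0 mulr1.
  rewrite exchange_big; apply: ler_sum_fset => y yA /=.
  rewrite exchange_big; apply: ler_sum_fset => w wA /=.
  rewrite exchange_big; apply: ler_sum_fset => u uA /=.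
  have -> : k = \sum_(z <- A) 1 by rewrite sum1_fset.
  apply: le_trans (@sum_inj_le A _ (fun x => x * (y * w / u)) (fun=> 1) _ _).
  - by apply: ler_sum => x _; rewrite mulr1 !mulrA.
  - by move=> x x' _ _; apply: mulIf; rewrite !mulf_neq0 ?invr_eq0 ?nzA.
  - by [].
have := le_trans (ler_sum_fset Wlow) Wup.
rewrite sum_const_fset; set L : R := _%:R => hL.
have sk : k / (4 * K) <= s by rewrite ler_pdivrMr ?mulr_gt0 // mulrC.
have L0 : 0 <= L by exact: ler0n.
have h1 : k ^+ 3 / (2048 * K ^+ 3) <= s / 2 * (k / (16 * K)) ^+ 2.
  rewrite (_ : k ^+ 3 / _ = (k / (4 * K)) / 2 * (k / (16 * K)) ^+ 2).
    apply: ler_wpM2r; first exact: sqr_ge0.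
    by apply: ler_wpM2r => //; rewrite invr_ge0.
  by field; rewrite lt0r_neq0.
have := le_trans (ler_wpM2l L0 h1) hL.
have K3 : 0 < 2048 * K ^+ 3 by rewrite pmulr_rgt0 ?ltr0n ?exprn_gt0.
rewrite mulrA ler_pdivrMr //.
rewrite (_ : k ^+ 4 * _ = (2048 * K ^+ 3 * k) * k ^+ 3); last by ring.
by rewrite ler_pM2r // exprn_gt0.
Qed.

End Energy.

(** * Triangles of popular differences *)

Section PopularTriangles.
Variable R : archiRealFieldType.
Implicit Types (A D S : {fset R}) (x y z t M : R).

Definition diffset A : {fset R} := [fset a - b | a in A, b in A].

Lemma mem_diffset A a b : a \in A -> b \in A -> a - b \in diffset A.
Proof. by move=> aA bA; apply/imfset2P; exists a => //; exists b. Qed.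

Lemma sum_pairs_diff A (h : R -> R) :
  \sum_(a <- A) \sum_(b <- A) h (a - b) = \sum_(y <- diffset A) diffs A y * h y.
Proof.
rewrite sum_diffs; apply: eq_big_seq => a aA; apply: eq_big_seq => b bA.
by rewrite mem_diffset // mul1r.
Qed.

(** Dyadic summation of the tail bound; the series is geometric and so costs no
    logarithm. *)
Lemma tail_bounded_sqr A M t0 t : tail_bounded A M t0 -> t0 <= t -> 0 < t -> 0 <= M ->
  \sum_(a <- A) \sum_(b <- A) (t <= diffs A (a - b))%R%:R * diffs A (a - b) <= 4 * M / t.
Proof.
move=> hA tt tp M0; rewrite (sum_pairs_diff A (fun y => (t <= diffs A y)%R%:R * diffs A y)).
pose J := (Num.truncn (#|` A|%:R / t)).+1.
have hJ : #|` A|%:R < t * 2 ^+ J.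
  rewrite -ltr_pdivrMl // mulrC; have := Num.Theory.truncnS_gt (#|` A|%:R / t).
  move/lt_le_trans; apply; rewrite -natrX ler_nat; exact/ltnW/ltn_expl.
under eq_bigr do rewrite mulrCA.
apply: (le_trans (@sum_dyadic R R (diffset A) (diffs A) (diffs A)
    (fun u => M / u ^+ 2) t J tp (diffs_ge0 A) (diffs_ge0 A) _ _)).
- by move=> y; apply: le_lt_trans hJ; exact: diffs_le_card.
- move=> j _; set u := t * 2 ^+ j.
  have tu : t <= u by rewrite ler_peMr ?(ltW tp) // exprn_ege1 // ler1n.
  have := hA u [fset y in diffset A | (u <= diffs A y)%R] (le_trans tt tu).
  rewrite big_fset /= big_mkcond.
  rewrite [X in _ -> X <= _](eq_bigr (fun y => if u <= diffs A y then diffs A y else 0)).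
    by apply=> y; rewrite !inE => /andP[].
  by move=> y _; case: ifP => _; rewrite ?mul1r ?mul0r.
have e (j : nat) : t * 2 ^+ j.+1 * (M / (t * 2 ^+ j) ^+ 2) = 2 * M / t * (2^-1) ^+ j.
  rewrite exprVn exprS; field; rewrite ?lt0r_neq0 ?exprn_gt0 //.
under eq_bigr do rewrite e.
rewrite -mulr_sumr.
have g : \sum_(j < J) (2^-1 : R) ^+ j <= 2.
  suff : \sum_(j < J) (2^-1 : R) ^+ j = 2 - 2 * 2^-1 ^+ J.
    by move=> ->; rewrite gerBl mulr_ge0 // exprn_ge0 // invr_ge0.
  elim: J {hJ} => [|j IH]; first by rewrite big_ord0 expr0 mulr1 subrr.
  by rewrite big_ord_recr /= IH exprS; field.
have c0 : 0 <= 2 * M / t by rewrite divr_ge0 ?(ltW tp) // mulr_ge0.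
by apply: (le_trans (ler_wpM2l c0 g)); rewrite le_eqVlt; apply/orP; left;
   apply/eqP; field; rewrite lt0r_neq0.
Qed.

(** Zero, the most popular difference, is left out: the estimates below rely on
    the dilates of a popular difference being distinct. *)
Definition popular A t : {fset R} :=
  [fset z in diffset A | (z != 0) && (t <= diffs A z)%R].

Lemma mem_popular A t z : 0 < t ->
  (z \in popular A t) = (z != 0) && (t <= diffs A z).
Proof.
move=> t0; rewrite !inE; apply: andb_idl => /andP[_ tz].
have [a [b [aA bA ->]]] := diffs_gt0P (lt_le_trans t0 tz).
by rewrite mem_diffset.
Qed.

Lemma popularN A t z : 0 < t -> (- z \in popular A t) = (z \in popular A t).
Proof. by move=> t0; rewrite !mem_popular // oppr_eq0 diffsN. Qed.

Definition shift_count A D c z : R :=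
  \sum_(c1 <- A) ((c1 - c \in D) && (c1 + z \in A))%:R.

(** For a symmetric D, the sum of [shift_count] counts the paths c, u, u + z in
    the graph joining elements whose difference lies in D. Two applications of
    Cauchy-Schwarz bound the number of edges by that of the paths and then by
    the second moment of [shift_count]. *)
Lemma many_shifts A D : (forall z, (- z \in D) = (z \in D)) ->
  (\sum_(u <- A) \sum_(w <- A) (u - w \in D)%:R) ^+ 4
    <= #|` A|%:R ^+ 3 * #|` D|%:R
       * \sum_(c <- A) \sum_(z <- D) shift_count A D c z ^+ 2.
Proof.
move=> sD; set m : R := (X in X ^+ 4).
pose deg u : R := \sum_(w <- A) (u - w \in D)%:R.
have gE : \sum_(c <- A) \sum_(z <- D) shift_count A D c z = \sum_(u <- A) deg u ^+ 2.
  under eq_bigr => c _ do rewrite exchange_big /=.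
  rewrite exchange_big /=; apply: eq_bigr => u _.
  rewrite expr2 /deg {1}mulr_suml; apply: eq_bigr => c _.
  under eq_bigr => z _ do rewrite ind_andb.
  rewrite -mulr_sumr; congr (_ * _).
  under eq_bigr => z _ do rewrite -sum_pred1_fset.
  rewrite exchange_big; apply: eq_bigr => s _ /=.
  rewrite -sD opprB -sum_pred1_fset; apply: eq_bigr => z _.
  by rewrite [z == _]eq_sym subr_eq addrC.
have h1 : m ^+ 2 <= #|` A|%:R * \sum_(u <- A) deg u ^+ 2 by exact: sqr_sum_fset_le.
have h2 : (\sum_(u <- A) deg u ^+ 2) ^+ 2 <= #|` A|%:R * (#|` D|%:R *
    \sum_(c <- A) \sum_(z <- D) shift_count A D c z ^+ 2).
  rewrite -gE; apply: (le_trans (sqr_sum_fset_le _ _)).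
  apply: ler_wpM2l; first exact: ler0n.
  by rewrite mulr_sumr; apply: ler_sum => c _; exact: sqr_sum_fset_le.
rewrite (_ : m ^+ 4 = (m ^+ 2) ^+ 2); last by rewrite -exprM.
have h3 : (m ^+ 2) ^+ 2 <= (#|` A|%:R * \sum_(u <- A) deg u ^+ 2) ^+ 2.
  by rewrite lerXn2r // nnegrE ?sqr_ge0 // mulr_ge0 // sumr_ge0 // => u _; exact: sqr_ge0.
apply: (le_trans h3); rewrite exprMn.
apply: (le_trans (ler_wpM2l (sqr_ge0 _) h2)).
by rewrite !exprS expr0 !mulr1 !mulrA.
Qed.

Lemma common_shifts_le A D c1 c2 :
  \sum_(z <- D) ((c1 + z \in A) && (c2 + z \in A))%:R <= diffs A (c1 - c2).
Proof.
apply: le_trans (@sum_inj_le R A D (fun z => c1 + z)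
  (fun x => (x - (c1 - c2) \in A)%:R) _ _); last 2 first.
- by move=> z z' _ _; exact: addrI.
- by move=> *; exact: ind_ge0.
apply: ler_sum => z _; rewrite -ind_andb; apply: ler_ind.
by rewrite (_ : c1 + z - (c1 - c2) = c2 + z) //; ring.
Qed.

Lemma sum_translate A D c (h : R -> R) :
  \sum_(a <- A) (a - c \in D)%:R * h a = \sum_(u <- D) (c + u \in A)%:R * h (c + u).
Proof.
under [RHS]eq_bigr do rewrite -sum_pred1_fset_mul.
rewrite [RHS]exchange_big; apply: eq_bigr => a _ /=.
rewrite -sum_pred1_fset mulr_suml; apply: eq_bigr => u _.
by rewrite eq_sym subr_eq addrC.
Qed.

Definition triangles A D : R := \sum_(c <- A) \sum_(c1 <- A) \sum_(c2 <- A)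
  [&& c1 - c \in D, c2 - c \in D & c1 - c2 \in D]%:R.

(** Expanding the square gives pairs c1, c2 whose differences with c are in D,
    with at most [diffs A (c1 - c2)] common shifts. Pairs with fewer than t
    common shifts are counted trivially, those with more than th through the
    tail of [diffs]; in the intermediate range c1 - c2 is itself popular and (c,
    c1, c2) is a triangle. *)
Lemma shifts_le_triangles A D t th : 0 < t -> th <= #|` A|%:R -> 0 <= th ->
  (forall z, z \in D -> z \in popular A t) ->
  \sum_(c <- A) \sum_(z <- D) shift_count A D c z ^+ 2
   <= t * #|` A|%:R ^+ 3
      + #|` A|%:R * (\sum_(a <- A) \sum_(b <- A)
           (th <= diffs A (a - b))%R%:R * diffs A (a - b))
      + th * triangles A (popular A t).
Proof.
move=> t0 thA th0 DP.
have -> : #|` A|%:R ^+ 3 = \sum_(c <- A) \sum_(a <- A) \sum_(b <- A) (1 : R).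
  by rewrite !sum_const_fset !exprS expr0 mulr1.
rewrite -(sum_const_fset A (\sum_(a <- A) _)) /triangles !mulr_sumr -!big_split /=.
apply: ler_sum => c _.
under eq_bigr => z _ do rewrite /shift_count sqr_sum.
rewrite exchange_big !mulr_sumr -!big_split /=; apply: ler_sum_fset => c1 c1A.
rewrite exchange_big !mulr_sumr -!big_split /=; apply: ler_sum_fset => c2 c2A.
rewrite mulr1; set f := diffs A (c1 - c2).
have f0 : 0 <= f by exact: diffs_ge0.
apply: (@le_trans _ _ (((c1 - c \in D) && (c2 - c \in D))%:R * f)).
  apply: le_trans (ler_wpM2l (ind_ge0 _ _) (common_shifts_le A D c1 c2)).
  rewrite mulr_sumr; apply: ler_sum => z _; rewrite -!ind_andb; apply: ler_ind.
  by move=> /andP[/andP[-> ->] /andP[-> ->]].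
have [thf|fth] := leP th f.
  rewrite mul1r; apply: (@le_trans _ _ f); first by rewrite ler_piMl // ind_le1.
  rewrite addrAC lerDr addr_ge0 ?(ltW t0) // mulr_ge0 // ind_ge0.
rewrite mul0r addr0; have [ft|tf] := leP f t.
  apply: (@le_trans _ _ f); first by rewrite ler_piMl // ind_le1.
  by apply: (le_trans ft); rewrite lerDl mulr_ge0 // ind_ge0.
apply: (@le_trans _ _ (((c1 - c \in D) && (c2 - c \in D))%:R * th)).
  by apply: ler_wpM2l; [exact: ind_ge0|exact: ltW].
rewrite mulrC -[leLHS]add0r; apply: lerD; first exact: ltW.
apply: ler_wpM2l => //; apply: ler_ind => /andP[/DP -> /DP ->] /=.
rewrite mem_popular // (ltW tf) andbT subr_eq0; apply: contraTneq fth => e.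
rewrite -leNgt; apply: (le_trans thA); rewrite /f e subrr /diffs.
by rewrite -sum1_fset; apply: ler_sum_fset => a aA; rewrite subr0 aA.
Qed.

(** Group the triangles by their sides u = c1 - c and v = c2 - c. The third side
    forces u - v into D, and the second moment of the number of c with given u,
    v is at most the sum of the cubes of the representation numbers. *)
Lemma sqr_triangles_le A D :
  triangles A D ^+ 2
    <= (\sum_(u <- D) \sum_(v <- D) (u - v \in D)%:R)
       * \sum_(a <- A) \sum_(b <- A) diffs A (a - b) ^+ 2.
Proof.
pose C3 u v : R := \sum_(c <- A) ((c + u \in A) && (c + v \in A))%:R.
have tE : triangles A D
    = \sum_(p <- [seq (u, v) | u <- D, v <- D])
        (p.1 - p.2 \in D)%:R * C3 p.1 p.2.
  rewrite big_allpairs /= /C3.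
  under eq_bigr => u _ do under eq_bigr => v _ do rewrite mulr_sumr.
  under eq_bigr => u _ do rewrite exchange_big /=.
  rewrite exchange_big; apply: eq_bigr => c _ /=.
  transitivity (\sum_(c1 <- A) (c1 - c \in D)%:R * \sum_(c2 <- A) (c2 - c \in D)%:R
      * (c1 - c2 \in D)%:R : R).
    apply: eq_bigr => c1 _; rewrite mulr_sumr; apply: eq_bigr => c2 _.
    by rewrite -!ind_andb.
  rewrite (@sum_translate A D c (fun c1 => \sum_(c2 <- A) (c2 - c \in D)%:R
      * (c1 - c2 \in D)%:R)); apply: eq_bigr => u _.
  rewrite (@sum_translate A D c (fun c2 => (c + u - c2 \in D)%:R)) mulr_sumr.
  apply: eq_bigr => v _; rewrite ind_andb mulrA mulrC; congr (_ * _).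
  by congr ((nat_of_bool (_ \in D))%:R); ring.
rewrite tE; apply: (le_trans (cauchy_schwarz _ _ _)); apply: ler_pM.
- by apply: sumr_ge0 => *; exact: sqr_ge0.
- by apply: sumr_ge0 => *; exact: sqr_ge0.
- rewrite big_allpairs /=; apply: ler_sum => u _; apply: ler_sum => v _.
  by case: (_ \in _); rewrite ?expr1n ?expr0n.
rewrite big_allpairs /=.
under eq_bigr => u _ do under eq_bigr => v _ do rewrite /C3 sqr_sum.
under eq_bigr => u _ do rewrite exchange_big /=.
rewrite exchange_big; apply: ler_sum => c _ /=.
under eq_bigr => u _ do rewrite exchange_big /=.
rewrite exchange_big; apply: ler_sum => e _ /=.
rewrite expr2.
apply: (@le_trans _ _ ((\sum_(u <- D) ((c + u \in A) && (e + u \in A))%:R)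
   * (\sum_(v <- D) ((c + v \in A) && (e + v \in A))%:R))).
  rewrite mulr_suml; apply: ler_sum => u _; rewrite mulr_sumr; apply: ler_sum => v _.
  rewrite -!ind_andb; apply: ler_ind.
  by move=> /andP[/andP[-> ->] /andP[-> ->]].
by apply: ler_pM; rewrite ?common_shifts_le //; apply: sumr_ge0 => *; exact: ind_ge0.
Qed.

(** Division by s maps A into A1, so it maps representations of z as a
    difference of A to representations of z / s. *)
Lemma popular_quot A A1 S t s z : 0 < t -> 0 \notin S ->
  (forall s a, s \in S -> a \in A -> a / s \in A1) ->
  s \in S -> z \in popular A t -> z / s \in popular A1 t.
Proof.
move=> t0 S0 SA sS; have s0 : s != 0 by apply: contraNneq S0 => <-.
rewrite !mem_popular // mulf_eq0 negb_or invr_eq0 s0 andbT => /andP[-> tz] /=.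
apply: (le_trans tz); rewrite mulrC; apply: diffs_scale; last by rewrite invr_eq0.
by move=> a aA; rewrite mulrC; exact: SA.
Qed.

(** By [popular_quot] the quotients z / s are |S| distinct differences of A1,
    all at least as popular as z, and the tail bound limits their number. *)
Lemma diffs_le_tail A A1 S M t0 z : 0 < t0 -> 0 \notin S ->
  (forall s a, s \in S -> a \in A -> a / s \in A1) ->
  tail_bounded A1 M t0 -> z != 0 -> t0 <= diffs A z ->
  #|` S|%:R * diffs A z ^+ 3 <= M.
Proof.
move=> t00 S0 SA hM z0 tz; have fz : 0 < diffs A z by exact: lt_le_trans tz.
rewrite -ler_pdivlMr ?exprn_gt0 //.
apply: le_trans (tail_bounded_card (Y := popular A1 (diffs A z)) hM tz fz _); last first.
  by move=> y; rewrite mem_popular // => /andP[].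
rewrite ler_nat.
have inj : injective (fun s => z / s) by move=> s s' /(mulfI z0) /invr_inj.
have <- : #|` [fset z / s | s in S]| = #|` S| by rewrite card_imfset.
apply: fsubset_leq_card; apply/fsubsetP => _ /imfsetP[s /= sS ->].
apply: (popular_quot _ S0 SA) => //.
by rewrite mem_popular // z0 lexx.
Qed.

(** The difference zero alone contributes |A|^3; elsewhere one factor is bounded
    by its maximum. *)
Lemma sum_sqr_diffs_le A (F : R) : 0 <= F -> (forall z, z != 0 -> diffs A z <= F) ->
  \sum_(a <- A) \sum_(b <- A) diffs A (a - b) ^+ 2
    <= #|` A|%:R ^+ 3 + F * \sum_(a <- A) \sum_(b <- A) diffs A (a - b).
Proof.
move=> F0 hF.
have -> : #|` A|%:R ^+ 3 = \sum_(a <- A) \sum_(b <- A) (b == a)%:R * #|` A|%:R ^+ 2 :> R.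
  under [RHS]eq_big_seq => a aA do rewrite -mulr_suml sum_pred1_fset aA mul1r.
  by rewrite sum_const_fset -exprS.
rewrite mulr_sumr -big_split; apply: ler_sum => a _ /=.
rewrite mulr_sumr -big_split; apply: ler_sum => b _ /=.
have f0 := diffs_ge0 A (a - b).
have [->|ab] := eqVneq b a; last first.
  by rewrite mul0r add0r expr2; apply: ler_wpM2r => //; rewrite hF // subr_eq0 eq_sym.
rewrite mul1r; apply: (@le_trans _ _ (#|` A|%:R ^+ 2)).
  by rewrite lerXn2r ?nnegrE ?ler0n ?diffs_ge0 // diffs_le_card.
by rewrite lerDl mulr_ge0 ?diffs_ge0.
Qed.

Lemma sum_diffs_le A M t0 t : tail_bounded A M t0 -> t0 <= t -> 0 < t -> 0 <= M ->
  \sum_(a <- A) \sum_(b <- A) diffs A (a - b) <= t * #|` A|%:R ^+ 2 + 4 * M / t.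
Proof.
move=> hA tt tp M0; apply: le_trans (lerD (lexx _) (tail_bounded_sqr hA tt tp M0)).
have -> : #|` A|%:R ^+ 2 = \sum_(a <- A) \sum_(b <- A) (1 : R).
  by rewrite !sum_const_fset mulr1 expr2.
rewrite mulr_sumr -big_split; apply: ler_sum => a _ /=.
rewrite mulr_sumr -big_split; apply: ler_sum => b _ /=.
have f0 := diffs_ge0 A (a - b).
have [tf|/ltW ft] := leP t (diffs A (a - b)).
  by rewrite mul1r lerDr mulr1 ltW.
by rewrite mul0r addr0 mulr1.
Qed.

End PopularTriangles.

(** * Solutions of ratio equations inside blocks *)

Section ClosePairs.
Variable R : archiRealFieldType.
Implicit Types (B C S V : {fset R}) (x y m v : R).

Definition quads C m : R :=
  \sum_(x <- C) \sum_(x' <- C) (x != x')%:R * diffs C (m * (x - x')).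

Definition quot_energy C B : R :=
  \sum_(g <- B) \sum_(g' <- B) quads C (g / g').

Definition intercepts S C : {fset R} := [fset y - z | y in C, z in mulset S C].

Lemma mem_intercepts S C m x y : m \in S -> x \in C -> y \in C ->
  y - m * x \in intercepts S C.
Proof.
move=> mS xC yC; apply/imfset2P; exists y => //; exists (m * x) => //.
exact: mem_mulset.
Qed.

Lemma sum_richness S C m : m \in S ->
  \sum_(v <- intercepts S C) richness C C m v = #|` C|%:R ^+ 2.
Proof.
move=> mS; rewrite /richness exchange_big /=.
have e x : x \in C -> \sum_(v <- intercepts S C) (m * x + v \in C)%:R = #|` C|%:R :> R.
  move=> xC; under eq_bigr do rewrite -[_%:R]mulr1.
  rewrite (sum_intercepts _ _ _ _ (fun=> 1)) -sum1_fset; apply: eq_big_seq => y yC.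
  by rewrite mem_intercepts // mulr1.
by rewrite (eq_big_seq _ e) sum_const_fset expr2.
Qed.

Lemma sum_sqr_richness S C m : m \in S ->
  \sum_(v <- intercepts S C) richness C C m v ^+ 2
    = \sum_(x <- C) \sum_(x' <- C) diffs C (m * (x - x')).
Proof.
move=> mS; under eq_bigr do rewrite /richness sqr_sum.
rewrite exchange_big; apply: eq_big_seq => x xC /=.
rewrite exchange_big; apply: eq_big_seq => x' x'C /=.
rewrite (sum_intercepts _ _ _ _ (fun v => (m * x' + v \in C)%:R)).
apply: eq_big_seq => y yC; rewrite mem_intercepts // mul1r.
by congr ((nat_of_bool (_ \in C))%:R); ring.
Qed.

Lemma quads_le S C m : m \in S ->
  quads C m <= \sum_(v <- intercepts S C) richness C C m v ^+ 2.
Proof.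
move=> mS; rewrite (sum_sqr_richness C mS); apply: ler_sum => x _; apply: ler_sum => x' _.
by rewrite ler_piMl ?ind_le1 ?diffs_ge0.
Qed.

Definition close_quads C (b : R -> nat) m : R :=
  \sum_(x <- C) \sum_(x' <- C) \sum_(y <- C) \sum_(y' <- C)
    [&& x != x', b x == b x' & b y == b y']%:R * ((y - y') / (x - x') == m)%:R.

(** The same passage to cells as in the proof of Szemeredi-Trotter, applied to
    the lines of a fixed slope: up to the factor 2 r, the pairs x, x' and y, y'
    may be taken in common blocks. *)
Lemma quads_le_close C (b : R -> nat) r m : m != 0 ->
  {homo b : x y / x <= y >-> (x <= y)%N} ->
  (forall x, x \in C -> (b x < r)%N) ->
  quads C m <= 2 * r%:R * (#|` C|%:R ^+ 2 + close_quads C b m).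
Proof.
move=> m0 hb hr; have mS : m \in [fset m] by rewrite inE.
apply: (le_trans (quads_le C mS)).
apply: (@le_trans _ _ (2 * r%:R * \sum_(v <- intercepts [fset m] C)
    (richness C C m v + cell_pairs b b C C m v))).
  rewrite mulr_sumr; apply: ler_sum => v _.
  apply: (le_trans (sqr_richness_le_cells v m0 hb hb hr hr)).
  apply: ler_wpM2r; first by rewrite addr_ge0 ?richness_ge0 ?cell_pairs_ge0.
  by rewrite -natrM ler_nat leq_subr.
apply: ler_wpM2l; first by rewrite mulr_ge0 ?ler0n.
rewrite big_split /= (sum_richness C mS) lerD2l.
have := @sum_cell_pairs_le R (fun=> 1) b b C C [fset m] (intercepts [fset m] C)
   (fun _ _ => ler01).
rewrite big_seq_fset1 /=; under eq_bigr do rewrite mul1r.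
move/le_trans; apply; rewrite /close_quads.
apply: ler_sum => x _; apply: ler_sum => x' _; apply: ler_sum => y _.
by apply: ler_sum => y' _; rewrite inE mulr1.
Qed.

Definition block_diffs C (b : R -> nat) mu B : R :=
  \sum_(v <- C) \sum_(y <- C) ((b y == b v) && ((y - v) / mu \in B))%:R.

(** Fixing g', x and x' by the pigeonhole principle turns g (x - x') = g' (y -
    y') into y - y' in mu B with mu = (x - x') / g'. Since x' ranges over the
    block of x only, the choice of x' costs a factor z rather than |C|, and the
    number of pairs retained is nearly maximal. *)
Lemma exists_structured_blocks C B (b : R -> nat) r z :
  0 \notin B ->
  {homo b : x y / x <= y >-> (x <= y)%N} ->
  (forall x, x \in C -> (b x < r)%N) ->
  (forall x, \sum_(x' <- C) (b x == b x')%:R <= z%:R :> R) ->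
  2 * r%:R * (#|` C|%:R * #|` B|%:R) ^+ 2 < quot_energy C B ->
  exists mu, mu != 0 /\
   quot_energy C B - 2 * r%:R * (#|` C|%:R * #|` B|%:R) ^+ 2
    <= 2 * r%:R * (#|` B|%:R * #|` C|%:R * z%:R) * block_diffs C b mu B.
Proof.
move=> B0 hb hr hz hG.
have nzB g : g \in B -> g != 0 by apply: contraTneq => ->.
(* Three successive pigeonholes fix g', then x, then x' in the block of x. *)
pose N g' x x' : R := \sum_(g <- B) \sum_(y <- C) \sum_(y' <- C)
   ((b y == b y') && ((y - y') / (x - x') == g / g'))%:R.
pose T := quot_energy C B - 2 * r%:R * (#|` C|%:R * #|` B|%:R) ^+ 2.
have T0 : 0 < T by rewrite subr_gt0.
have r0 : 0 < r%:R :> R.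
  rewrite lt_def ler0n andbT; apply: contraTneq hG => r0.
  rewrite r0 mulr0 mul0r -leNgt /quot_energy.
  rewrite big_seq big1 // => g gB; rewrite big_seq big1 // => g' g'B.
  apply/eqP; rewrite eq_le; apply/andP; split.
    have := @quads_le_close C b r (g / g') _ hb hr; rewrite r0 mulr0 mul0r; apply.
    by rewrite mulf_neq0 ?invr_eq0 ?nzB.
  by do 2!apply: sumr_ge0 => ? _; rewrite mulr_ge0 ?ler0n ?diffs_ge0.
have hT : T / (2 * r%:R) <= \sum_(g' <- B) 1 * \sum_(x <- C) 1 * \sum_(x' <- C)
    (b x == b x')%:R * ((x != x')%:R * N g' x x').
  rewrite ler_pdivrMr ?mulr_gt0 // lerBlDl.
  apply: (@le_trans _ _ (\sum_(g <- B) \sum_(g' <- B)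
      2 * r%:R * (#|` C|%:R ^+ 2 + close_quads C b (g / g')))).
    apply: ler_sum_fset => g gB; apply: ler_sum_fset => g' g'B.
    by apply: quads_le_close => //; rewrite mulf_neq0 ?invr_eq0 ?nzB.
  under eq_bigr do rewrite -mulr_sumr big_split /=.
  rewrite -[leLHS]mulr_sumr big_split /= mulrDr; apply: lerD.
    by rewrite !sum_const_fset exprMn expr2 !mulrA; lra.
  rewrite mulrC; apply: ler_wpM2r; first by rewrite mulr_ge0 ?ler0n.
  rewrite exchange_big; apply: ler_sum => g' _ /=; rewrite mul1r.
  rewrite /close_quads exchange_big; apply: ler_sum => x _ /=; rewrite mul1r.
  rewrite exchange_big; apply: ler_sum => x' _ /=; rewrite /N !mulr_sumr.
  apply: ler_sum => g _; rewrite !mulr_sumr; apply: ler_sum => y _.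
  rewrite !mulr_sumr; apply: ler_sum => y' _; rewrite -!ind_andb.
  by apply: ler_ind => /andP[/and3P[-> -> ->] ->].
have T'0 : 0 < T / (2 * r%:R) by rewrite divr_gt0 // mulr_gt0.
have hB : \sum_(g' <- B) 1 <= #|` B|%:R :> R by rewrite sum1_fset.
have hC : \sum_(x <- C) 1 <= #|` C|%:R :> R by rewrite sum1_fset.
have [g' [g'B _ h1]] := pigeonhole_sum T'0 (fun _ _ => ler01) hB hT.
have g0 := nzB _ g'B.
have bp : 0 < #|` B|%:R :> R by rewrite ltr0n cardfs_gt0; apply/fset0Pn; exists g'.
rewrite -ler_pdivrMl // mulrC in h1.
have T1 : 0 < T / (2 * r%:R) / #|` B|%:R by rewrite divr_gt0.
have [x [xC _ h2]] := pigeonhole_sum T1 (fun _ _ => ler01) hC h1.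
have cp : 0 < #|` C|%:R :> R by rewrite ltr0n cardfs_gt0; apply/fset0Pn; exists x.
rewrite -ler_pdivrMl // mulrC in h2.
have T2 : 0 < T / (2 * r%:R) / #|` B|%:R / #|` C|%:R by rewrite divr_gt0.
have [x' [x'C _ h3]] := pigeonhole_sum T2 (fun x' _ => ind_ge0 R (b x == b x')) (hz x) h2.
have [xx'|xx'] := eqVneq x x'.
  by move: h3; rewrite xx' eqxx mul0r mulr0 leNgt T2.
have dx : x - x' != 0 by rewrite subr_eq0.
exists ((x - x') / g'); split; first by rewrite mulf_neq0 ?invr_eq0.
rewrite -/T; move: h3; rewrite xx' mul1r !ler_pdivrMr ?mulr_gt0 // => h3.
suff -> : block_diffs C b ((x - x') / g') B = N g' x x' by apply: (le_trans h3); lra.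
rewrite /N [RHS]exchange_big /block_diffs [LHS]exchange_big /=.
apply: eq_bigr => y _; rewrite [RHS]exchange_big /=; apply: eq_bigr => y' _ /=.
under [RHS]eq_bigr => g _ do rewrite ind_andb.
rewrite -mulr_sumr ind_andb; congr (_ * _).
rewrite -sum_pred1_fset; apply: eq_bigr => g _; congr ((nat_of_bool _)%:R).
rewrite -(inj_eq (mulIf (_ : g'^-1 != 0))) ?invr_eq0 // eq_sym.
by congr (_ == _); field; rewrite ?dx ?g0.
Qed.

End ClosePairs.

(** * Similar triples inside blocks *)

Section Shapes.
Variable R : archiRealFieldType.
Implicit Types (B C S V : {fset R}) (x y m v : R).

(** The third moment is the critical exponent for the richness of lines, where
    all dyadic layers contribute equally; hence the factor J, of the order of
    log |P|. *)
Lemma sum_rich_cube_le P Q S V (J : nat) : 0 \notin S -> (#|` P| <= 2 ^ J)%N ->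
  \sum_(m <- S) \sum_(v <- V) (2 <= richness P Q m v)%R%:R * richness P Q m v ^+ 3
    <= 256 * J%:R * (#|` P|%:R * #|` Q|%:R : R) ^+ 2.
Proof.
move=> S0 PJ.
pose k (l : R * R) : R := richness P Q l.1 l.2.
have -> : \sum_(m <- S) \sum_(v <- V)
      (2 <= richness P Q m v)%R%:R * richness P Q m v ^+ 3
    = \sum_(l <- [seq (m, v) | m <- S, v <- V]) (2 <= k l)%R%:R * (k l ^+ 2 * k l).
  by rewrite big_allpairs; apply: eq_bigr => m _; apply: eq_bigr => v _; rewrite -exprSr.
have two : 0 < 2 :> R by [].
apply: (le_trans (@sum_dyadic R (R * R) _ k (fun l => k l ^+ 2)
   (fun T => 128 * (#|` P|%:R * #|` Q|%:R) ^+ 2 / T) 2 J two _ _ _ _)).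
- by move=> l; exact: richness_ge0.
- by move=> l; exact: sqr_ge0.
- move=> l; apply: le_lt_trans (richness_le _ _ _ _) _.
  apply: (@le_lt_trans _ _ (2 ^+ J)); first by rewrite -natrX ler_nat.
  by rewrite ltr_pMl ?exprn_gt0 // ltrDl.
- move=> j _; rewrite big_allpairs; apply: sum_rich_sqr1_le => //.
  by rewrite ler_peMr // exprn_ege1 // ler1n.
have e (j : nat) : 2 * 2 ^+ j.+1 * (128 * (#|` P|%:R * #|` Q|%:R) ^+ 2 / (2 * 2 ^+ j))
    = 256 * (#|` P|%:R * #|` Q|%:R : R) ^+ 2.
  by rewrite exprS; field; rewrite ?lt0r_neq0 ?exprn_gt0.
under eq_bigr do rewrite e.
by rewrite sumr_const card_ord -[leLHS]mulr_natr le_eqVlt; apply/orP; left; apply/eqP; ring.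
Qed.

(** Cauchy-Schwarz: few coincidences mean many values. *)
Lemma card_image_ge (I J : eqType) (s : seq I) (t : I -> J) :
  (size s)%:R ^+ 2 <= (size (undup (map t s)))%:R
    * (\sum_(i <- s) \sum_(j <- s) (t i == t j)%:R : R).
Proof.
have -> : (size s)%:R = \sum_(i <- s) 1 :> R.
  by rewrite big_const_seq count_predT iter_addr addr0.
(* Natural numbers labelling the values of t, as required for [sqr_sum_classes].
   *)
pose v i := index (t i) (undup (map t s)).
have vN i : i \in s -> (1 : R) != 0 -> (v i < size (undup (map t s)))%N.
  by move=> si _; rewrite index_mem mem_undup map_f.
apply: le_trans (sqr_sum_classes vN) _; apply: ler_wpM2l; first exact: ler0n.
rewrite [leLHS]big_seq [leRHS]big_seq; apply: ler_sum => i si.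
rewrite [leLHS]big_seq [leRHS]big_seq; apply: ler_sum => j sj.
rewrite !mulr1; apply: ler_ind => /eqP e; apply/eqP.
have := congr1 (nth (t i) (undup (map t s))) e.
by rewrite !nth_index // mem_undup map_f.
Qed.

Definition block_fiber C (b : R -> nat) i : {fset R} := [fset x in C | b x == i].

Lemma sum_sqr_block_fibers C (b : R -> nat) r z :
  (forall x, x \in C -> (b x < r)%N) ->
  (forall i, \sum_(x' <- C) (b x' == i)%:R <= z%:R :> R) ->
  \sum_(i <- iota 0 r) #|` block_fiber C b i|%:R ^+ 2 <= #|` C|%:R * z%:R :> R.
Proof.
move=> hr hz.
have cE i : #|` block_fiber C b i|%:R = \sum_(x <- C) (b x == i)%:R :> R.
  rewrite -sum1_fset big_fset /= big_mkcond; apply: eq_bigr => x _.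
  by case: ifP.
apply: (@le_trans _ _ (\sum_(i <- iota 0 r) #|` block_fiber C b i|%:R * z%:R)).
  apply: ler_sum => i _; rewrite expr2; apply: ler_wpM2l; first exact: ler0n.
  by rewrite cE.
rewrite -mulr_suml; apply: ler_wpM2r; first exact: ler0n.
under eq_bigr do rewrite cE.
rewrite exchange_big -sum1_fset; apply: ler_sum_fset => x xC /=.
rewrite (bigD1_seq (b x)) ?iota_uniq ?mem_iota ?hr //= eqxx big1 ?addr0 // => i.
by rewrite eq_sym => /negbTE ->.
Qed.

(** Collinearity is expressed by a cross product, and the inequalities exclude
    vertical and horizontal lines, for which richness is not controlled. *)
Definition aligned (b : R -> nat) (p q s : R * R) : bool :=
  [&& b p.1 == b q.1, b p.1 == b s.1, b p.2 == b q.2, b p.2 == b s.2,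
      p.1 != q.1, p.2 != q.2
    & (q.1 - p.1) * (s.2 - p.2) == (q.2 - p.2) * (s.1 - p.1)].

(** Within one cell, collinear triples are counted by the cubes of the richness
    of lines with respect to the two sides of the cell; the third moment bound
    is then summed over all cells. *)
Lemma sum_aligned_le C (b : R -> nat) r z (J : nat) :
  (forall x, x \in C -> (b x < r)%N) ->
  (forall i, \sum_(x' <- C) (b x' == i)%:R <= z%:R :> R) ->
  (#|` C| <= 2 ^ J)%N ->
  \sum_(p <- [seq (x, y) | x <- C, y <- C]) \sum_(q <- [seq (x, y) | x <- C, y <- C])
   \sum_(s <- [seq (x, y) | x <- C, y <- C]) (aligned b p q s)%:R
    <= 256 * J%:R * (#|` C|%:R * z%:R : R) ^+ 2.
Proof.
move=> hr hz CJ; set P2 := [seq (x, y) | x <- C, y <- C].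
(* The slopes of all lines through two points of the grid that are neither
   horizontal nor vertical. *)
pose Del := [fset d in diffset C | d != 0].
pose S := mulset Del (invset Del).
have S0 : 0 \notin S.
  by apply: mulset_neq0; rewrite ?mem_invset ?invr0 !inE eqxx andbF.
pose V := intercepts S C.
pose ls := [seq (ij, mv) | ij <- [seq (i, j) | i <- iota 0 r, j <- iota 0 r],
                mv <- [seq (m, v) | m <- S, v <- V]].
pose on (l : (nat * nat) * (R * R)) (p : R * R) : R :=
  [&& b p.1 == l.1.1, b p.2 == l.1.2 & p.2 == l.2.1 * p.1 + l.2.2]%:R.
pose k (l : (nat * nat) * (R * R)) : R :=
  richness (block_fiber C b l.1.1) (block_fiber C b l.1.2) l.2.1 l.2.2.
have kE l : k l = \sum_(p <- P2) on l p.
  rewrite big_allpairs /k /richness big_fset /= big_mkcond; apply: eq_bigr => x _.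
  case: ifP => hx; last by rewrite big1 // => y _; rewrite /on /= hx.
  rewrite -sum_pred1_fset big_fset /= big_mkcond; apply: eq_bigr => y _.
  by rewrite /on /= hx /=; case: ifP.
have alE p q s : p \in P2 -> q \in P2 -> s \in P2 ->
    (aligned b p q s)%:R <= \sum_(l <- ls) (2 <= k l)%R%:R * (on l p * on l q * on l s).
  move=> pP qP sP; have on0 l p' : 0 <= on l p' by exact: ind_ge0.
  have F0 l : l \in ls -> 0 <= (2 <= k l)%R%:R * (on l p * on l q * on l s).
    by move=> _; rewrite !mulr_ge0 // ind_ge0.
  case: (boolP (aligned b p q s)) => [|_]; last first.
    by rewrite big_seq; apply: sumr_ge0.
  case/and5P => /eqP b1 /eqP b2 /eqP b3 /eqP b4 /and3P[pq1 pq2 /eqP al].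
  have /allpairsP[[x y] /= [xC yC pE]] := pP.
  have /allpairsP[[x1 y1] /= [x1C y1C qE]] := qP.
  have /allpairsP[[x2 y2] /= [x2C y2C sE]] := sP.
  rewrite ?pE ?qE ?sE /= in b1 b2 b3 b4 pq1 pq2 al.
  have dx : x1 - x != 0 by rewrite subr_eq0 eq_sym.
  have dy : y1 - y != 0 by rewrite subr_eq0 eq_sym.
  pose m := (y1 - y) / (x1 - x); pose v := y - m * x.
  pose l := ((b x, b y), (m, v)).
  have mS : m \in S.
    apply: mem_mulset; rewrite ?mem_invset ?invrK !inE ?dy ?dx andbT;
    exact: mem_diffset.
  have lls : l \in ls.
    apply/allpairsP; exists ((b x, b y), (m, v)); split => //.
      apply/allpairsP; exists (b x, b y); split => //;
      by rewrite mem_iota /= add0n hr.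
    by apply/allpairsP; exists (m, v); split => //; exact: mem_intercepts.
  have o1 : on l p = 1 by rewrite /on pE /= !eqxx /= addrC subrK eqxx.
  have o2 : on l q = 1.
    rewrite /on qE /= -b1 -b3 !eqxx /=.
    suff -> : y1 = m * x1 + v by rewrite eqxx.
    by rewrite /v /m; field.
  have o3 : on l s = 1.
    rewrite /on sE /= -b2 -b4 !eqxx /=.
    suff -> : y2 = m * x2 + v by rewrite eqxx.
    have -> : y2 = y + (y1 - y) * (x2 - x) / (x1 - x).
      by rewrite -al mulrAC divff // mul1r addrC subrK.
    by rewrite /v /m; field.
  apply: le_trans (ler_elem_sum lls F0).
  rewrite o1 o2 o3 !mulr1.
  suff -> : 2 <= k l by [].
  rewrite kE (perm_big _ (perm_to_rem pP)) big_cons o1 lerD2l -o2.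
  apply: ler_elem_sum => //; apply: rem_mem => //.
  by rewrite pE qE xpair_eqE negb_and [x1 == x]eq_sym pq1.
apply: (@le_trans _ _ (\sum_(l <- ls) (2 <= k l)%R%:R * k l ^+ 3)).
  have e l : (2 <= k l)%R%:R * k l ^+ 3 = \sum_(p <- P2) \sum_(q <- P2) \sum_(s <- P2)
      (2 <= k l)%R%:R * (on l p * on l q * on l s).
    under [RHS]eq_bigr => p _.
      under eq_bigr => q _ do rewrite -mulr_sumr -mulr_sumr -kE.
      rewrite -mulr_sumr -mulr_suml -mulr_sumr -kE; over.
    by rewrite -mulr_sumr -!mulr_suml -kE; ring.
  under [leRHS]eq_bigr do rewrite e.
  rewrite [leRHS]exchange_big /= [leLHS]big_seq [leRHS]big_seq; apply: ler_sum => p pP.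
  rewrite [leRHS]exchange_big /= [leLHS]big_seq [leRHS]big_seq; apply: ler_sum => q qP.
  rewrite [leRHS]exchange_big /= [leLHS]big_seq [leRHS]big_seq; apply: ler_sum => s sP.
  exact: alE.
rewrite /ls !big_allpairs /=.
apply: (@le_trans _ _ (\sum_(i <- iota 0 r) \sum_(j <- iota 0 r)
    256 * J%:R * (#|` block_fiber C b i|%:R * #|` block_fiber C b j|%:R) ^+ 2)).
  apply: ler_sum => i _; apply: ler_sum => j _; rewrite big_allpairs.
  have bJ : (#|` block_fiber C b i| <= 2 ^ J)%N.
    by apply: leq_trans CJ; apply/fsubset_leq_card; exact: fset_sub.
  rewrite /k /=; have := @sum_rich_cube_le _ (block_fiber C b j) S V J S0 bJ.
  by [].
under eq_bigr => i _.
  under eq_bigr => j _ do rewrite exprMn.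
  rewrite -mulr_sumr -mulr_sumr; over.
rewrite -mulr_sumr -mulr_suml -expr2; apply: ler_wpM2l; first by rewrite mulr_ge0 ?ler0n.
apply: lerXn2r; rewrite ?nnegrE ?mulr_ge0 ?ler0n //.
  by apply: sumr_ge0 => i _; exact: sqr_ge0.
exact: sum_sqr_block_fibers.
Qed.

End Shapes.

(** * From pairs inside blocks to popular differences of a product set *)

Section PopularDilates.
Variable R : archiRealFieldType.
Implicit Types (A B C : {fset R}) (x y v : R).

Definition popular_pairs A t : R :=
  \sum_(u <- A) \sum_(w <- A) (u - w \in popular A t)%:R.

Section Cherries.
Variables (C B : {fset R}) (b : R -> nat) (r z J : nat) (mu t : R).
Hypotheses (B0 : 0 \notin B) (mu0 : mu != 0) (t0 : 0 < t)
  (hr : forall x, x \in C -> (b x < r)%N)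
  (hz : forall i, \sum_(x' <- C) (b x' == i)%:R <= z%:R :> R)
  (CJ : (#|` C| <= 2 ^ J)%N).

Let edge v y := (b y == b v) && ((y - v) / mu \in B).
Let codeg y y' : R := \sum_(v <- C) (edge v y && edge v y')%:R.
Let good (p : R * (R * R)) :=
  [&& edge p.1 p.2.1, edge p.1 p.2.2, p.2.1 != p.2.2 & t <= codeg p.2.1 p.2.2].
Let cherries := [seq p <- [seq (v, yy) | v <- C, yy <- [seq (y, y') | y <- C, y' <- C]]
  | good p].
Let shape (p : R * (R * R)) := (p.2.1 - p.1) / (p.2.2 - p.1).

Let sum_cherries (F : R * (R * R) -> R) : \sum_(p <- cherries) F p
  = \sum_(v <- C) \sum_(y <- C) \sum_(y' <- C)
      (good (v, (y, y')))%:R * F (v, (y, y')).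
Proof.
rewrite /cherries big_filter big_mkcond big_allpairs; apply: eq_bigr => v _.
rewrite big_allpairs; apply: eq_bigr => y _; apply: eq_bigr => y' _.
by case: ifP; rewrite ?mul1r ?mul0r.
Qed.

Let edge_neq v y : edge v y -> y - v != 0.
Proof.
by case/andP => _; apply: contraTneq => ->; rewrite mul0r.
Qed.

(** Each common neighbour v represents (y - y') / mu as the difference of (y -
    v) / mu and (y' - v) / mu, both in B. *)
Lemma codeg_le_diffs y y' : codeg y y' <= diffs B ((y - y') / mu).
Proof.
apply: le_trans (@sum_inj_le R B C (fun v => (y - v) / mu)
   (fun x => (x - (y - y') / mu \in B)%:R) _ _); last 2 first.
- by move=> v v' _ _ /(mulIf (invr_neq0 mu0)) /addrI /oppr_inj.
- by move=> *; exact: ind_ge0.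
apply: ler_sum => v _; rewrite -ind_andb; apply: ler_ind => /andP[/andP[_ ->] /andP[_]].
by rewrite -mulrBl; have -> : y - v - (y - y') = y' - v by ring.
Qed.

(** Cauchy-Schwarz counts the pairs of edges with a common end v. Degenerate
    pairs are negligible, and so are those whose ends y, y' have fewer than t
    common neighbours, since y and y' must lie in one block. *)
Lemma many_cherries :
  block_diffs C b mu B ^+ 2 <= #|` C|%:R *
    ((size cherries)%:R + (1 + t) * (#|` C|%:R * z%:R)).
Proof.
have E : block_diffs C b mu B = \sum_(v <- C) \sum_(y <- C) (edge v y)%:R by [].
rewrite E; apply: (le_trans (sqr_sum_fset_le _ _)).
apply: ler_wpM2l; first exact: ler0n.
have -> : (size cherries)%:R = \sum_(p <- cherries) 1 :> R.
  by rewrite big_const_seq count_predT iter_addr addr0.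
rewrite sum_cherries.
have h1 : \sum_(v <- C) \sum_(y <- C) \sum_(y' <- C) (edge v y && (y' == y))%:R
    <= #|` C|%:R * z%:R :> R.
  rewrite -sum_const_fset; apply: ler_sum => v _.
  apply: le_trans (hz (b v)); apply: ler_sum_fset => y yC.
  under eq_bigr do rewrite ind_andb.
  rewrite -mulr_sumr sum_pred1_fset yC mulr1; apply: ler_ind.
  by case/andP.
have h2 : \sum_(v <- C) \sum_(y <- C) \sum_(y' <- C)
    ((codeg y y' < t)%R && (edge v y && edge v y'))%:R
    <= t * (#|` C|%:R * z%:R) :> R.
  rewrite exchange_big /= mulrCA -sum_const_fset; apply: ler_sum => y _.
  apply: (@le_trans _ _ (\sum_(y' <- C) t * (b y' == b y)%:R)); last first.
    by rewrite -mulr_sumr; apply: ler_wpM2l; [exact: ltW|exact: hz].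
  rewrite exchange_big /=; apply: ler_sum => y' _.
  under eq_bigr do rewrite ind_andb.
  rewrite -mulr_sumr -/(codeg y y').
  have [lt|ge] := ltP (codeg y y') t; last by rewrite mul0r mulr_ge0 ?ind_ge0 ?ltW.
  rewrite mul1r; have [yy|/negP yy] := boolP (b y' == b y); first by rewrite mulr1 ltW.
  rewrite mulr0 /codeg big1 // => v _; apply/eqP; rewrite pnatr_eq0 eqb0.
  by apply/negP => /andP[/andP[/eqP e _] /andP[/eqP e' _]]; apply: yy; rewrite e e'.
rewrite mulrDl mul1r; apply: le_trans (lerD (lexx _) (lerD h1 h2)).
rewrite -!big_split /=; apply: ler_sum => v _; rewrite sqr_sum.
rewrite -!big_split /=; apply: ler_sum => y _.
rewrite -!big_split /=; apply: ler_sum => y' _.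
rewrite mulr1 -ind_andb -!natrD ler_nat /good /=.
case: (edge v y) (edge v y') => -[] //=.
rewrite eq_sym; case: eqP => //= _; rewrite andbT.
by case: leP.
Qed.

(** Triples (v, y, y') and (v2, y2, y2') of the same shape are images of each
    other under an affine map, whose graph is a line through the points (v, v2),
    (y, y2), (y', y2'). *)
Lemma similar_cherries :
  \sum_(p <- cherries) \sum_(q <- cherries) (shape p == shape q)%:R
    <= 256 * J%:R * (#|` C|%:R * z%:R : R) ^+ 2.
Proof.
apply: le_trans (sum_aligned_le hr hz CJ).
rewrite sum_cherries big_allpairs; apply: ler_sum => v _.
rewrite /=; under [leRHS]eq_bigr => v2 _ do rewrite big_allpairs /=.
rewrite [leRHS]exchange_big /=; apply: ler_sum => y _.
under [leRHS]eq_bigr => v2 _ do under eq_bigr => y2 _ do rewrite big_allpairs /=.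
under [leRHS]eq_bigr => v2 _ do rewrite exchange_big /=.
rewrite [leRHS]exchange_big /=; apply: ler_sum => y' _.
rewrite sum_cherries mulr_sumr; apply: ler_sum => v2 _.
rewrite mulr_sumr; apply: ler_sum => y2 _.
rewrite mulr_sumr; apply: ler_sum => y2' _.
rewrite -!ind_andb; apply: ler_ind => /and3P[/and4P[/= e1 e2 _ _] /and4P[/= e3 e4 _ _] /eqP].
rewrite /shape /= => sh.
have [d1 d2] := (edge_neq e1, edge_neq e2); have [d3 d4] := (edge_neq e3, edge_neq e4).
case/andP: e1 e2 e3 e4 => /eqP f1 _ /andP[/eqP f2 _] /andP[/eqP f3 _] /andP[/eqP f4 _].
rewrite /aligned /= f1 f2 f3 f4 !eqxx /= eq_sym -subr_eq0 d1 eq_sym -subr_eq0 d3 /=.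
by rewrite -eqr_div // sh.
Qed.

(** A shape s is a quotient beta1 / beta2 of elements of B whose difference is
    popular. Every l in B turns it into a pair l beta1 = s (l beta2) and l beta2
    of elements of B B whose difference is at least as popular, and different
    shapes give different pairs. The number of shapes is bounded below by
    [card_image_ge]. *)
Lemma popular_pairs_ge (X : R) : 0 <= X ->
  #|` C|%:R * (X + (1 + t) * (#|` C|%:R * z%:R)) <= block_diffs C b mu B ^+ 2 ->
  C != fset0 ->
  X ^+ 2 * #|` B|%:R <= 256 * J%:R * (#|` C|%:R * z%:R) ^+ 2
     * popular_pairs (mulset B B) t.
Proof.
move=> X0 hX Cn.
have Xs : X <= (size cherries)%:R.
  have := le_trans hX many_cherries.
  by rewrite ler_pM2l ?ltr0n ?cardfs_gt0 // lerD2r.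
pose T := [fset x in map shape cherries].
have TB : #|` T|%:R * #|` B|%:R <= popular_pairs (mulset B B) t.
  rewrite -sum_const_fset.
  pose BB := mulset B B; pose D := popular BB t.
  have BB0 : 0 \notin BB by exact: mulset_neq0.
  apply: (@le_trans _ _ (\sum_(s <- T) \sum_(w <- BB)
      (s * w \in BB)%:R * (s * w - w \in D)%:R)).
    apply: ler_sum_fset => s; rewrite inE /= => /mapP[[v [y y']]].
    rewrite mem_filter => /andP[/and4P[/= e1 e2 yy' pop] _] ->.
    have d2 := edge_neq e2.
    have [/andP[_ f1] /andP[_ f2]] := (e1, e2).
    (* The pairs for the shape s are (s w, w) with w = l beta, so that w and s
   determine the pair and l is recovered from w. *)
pose beta := (y' - v) / mu.
    apply: le_trans (@sum_inj_le R BB B (fun l => l * beta)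
      (fun w => (shape (v, (y, y')) * w \in BB)%:R
         * (shape (v, (y, y')) * w - w \in D)%:R) _ _); last 2 first.
    - move=> l l' _ _; apply: mulIf; by rewrite mulf_neq0 ?invr_eq0.
    - by move=> w _; rewrite mulr_ge0 ?ind_ge0.
    rewrite -sum1_fset; apply: ler_sum_fset => l lB.
    have l0 : l != 0 by apply: contraNneq B0 => <-.
    have e : shape (v, (y, y')) * (l * beta) = l * ((y - v) / mu).
      by rewrite /shape /beta /=; field; rewrite mu0.
    rewrite e (_ : l * ((y - v) / mu) - l * beta = l * ((y - y') / mu)); last first.
      by rewrite /beta; field; rewrite mu0.
    rewrite !mem_mulset // mem_popular // mulf_neq0 ?mulf_neq0 ?invr_eq0 ?subr_eq0 //.
    rewrite !mul1r /= (le_trans pop) // (le_trans (codeg_le_diffs _ _)) //.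
    by apply: diffs_scale => // a aB; exact: mem_mulset.
  rewrite exchange_big /popular_pairs [leRHS]exchange_big /=.
  apply: ler_sum_fset => w wBB.
  have w0 : w != 0 by apply: contraNneq BB0 => <-.
  apply: (@sum_inj_le R BB T (fun s => s * w) (fun u => (u - w \in D)%:R)).
  - by move=> s s' _ _; exact: mulIf.
  - by move=> *; exact: ind_ge0.
have h1 := card_image_ge R cherries shape.
have h2 : X ^+ 2 <= #|` T|%:R * (256 * J%:R * (#|` C|%:R * z%:R : R) ^+ 2).
  apply: (@le_trans _ _ ((size cherries)%:R ^+ 2)); first by rewrite lerXn2r ?nnegrE.
  apply: (le_trans h1); rewrite card_fseq; apply: ler_wpM2l; first exact: ler0n.
  exact: similar_cherries.
apply: (le_trans (ler_wpM2r (ler0n _ _) h2)).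
set K := 256 * _ * _; rewrite mulrAC mulrC; apply: ler_wpM2l => //; rewrite /K.
by rewrite !mulr_ge0 ?ler0n ?sqr_ge0.
Qed.

End Cherries.
End PopularDilates.

(** * The quotient energy as a quadratic form *)

Section QuotEnergy.
Variable R : archiRealFieldType.
Implicit Types (A B C S Z : {fset R}) (x y z g T W : R).

Lemma sum_dilated_diffs C Z g (h : R -> R) : g != 0 ->
  \sum_(z <- Z) diffs C (z / g) * h z
    = \sum_(x <- C) \sum_(x' <- C) (g * (x - x') \in Z)%:R * h (g * (x - x')).
Proof.
move=> g0; rewrite /diffs; under eq_bigr do rewrite mulr_suml.
rewrite exchange_big; apply: eq_bigr => x _ /=.
under [RHS]eq_bigr do rewrite -sum_pred1_fset_mul.
rewrite [RHS]exchange_big; apply: eq_bigr => z _ /=.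
rewrite -sum_pred1_fset mulr_suml; apply: eq_bigr => x' _.
congr ((nat_of_bool _)%:R * _).
by rewrite eq_sym subr_eq addrC -subr_eq eq_sym -(inj_eq (mulfI g0)) mulrCA divff // mulr1 eq_sym.
Qed.

(** The products at which the correlations of dilated difference functions are
    supported; zero is left out because [quads] excludes x = x'. *)
Definition dilates C A : {fset R} := mulset A [fset d in diffset C | d != 0].

(** Both sides count the z = g (x - x') = g' (y - y'), which exhibits the
    quotient energy as a sum of squares. *)
Lemma quads_correlation C A g g' : 0 \notin A -> g \in A -> g' \in A ->
  quads C (g / g') = \sum_(z <- dilates C A) diffs C (z / g) * diffs C (z / g').
Proof.
move=> A0 gA g'A; have g0 : g != 0 by apply: contraNneq A0 => <-.
rewrite (sum_dilated_diffs C _ (fun z => diffs C (z / g')) g0).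
apply: eq_big_seq => x xC; apply: eq_big_seq => x' x'C /=.
rewrite (mulrAC g); congr ((nat_of_bool _)%:R * _).
have [->|xx'] := eqVneq x x'.
  rewrite subrr mulr0; apply/esym/negbTE; apply: mulset_neq0 => //.
  by rewrite !inE eqxx andbF.
apply/esym; apply: mem_mulset => //.
by rewrite !inE mem_diffset // subr_eq0.
Qed.

Lemma quot_energyE C A B : 0 \notin A -> B `<=` A ->
  quot_energy C B = \sum_(z <- dilates C A) (\sum_(g <- B) diffs C (z / g)) ^+ 2.
Proof.
move=> A0 /fsubsetP BA; under [RHS]eq_bigr do rewrite sqr_sum.
rewrite [RHS]exchange_big; apply: eq_big_seq => g gB /=.
rewrite [RHS]exchange_big; apply: eq_big_seq => g' g'B /=.
exact: quads_correlation A0 (BA _ gB) (BA _ g'B).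
Qed.

Lemma quot_energy_ge0 C A : 0 <= quot_energy C A.
Proof.
do 2!apply: sumr_ge0 => ? _; do 2!apply: sumr_ge0 => ? _.
by rewrite mulr_ge0 ?ind_ge0 ?diffs_ge0.
Qed.

(** For a sum of squares, (u + w)^2 <= (1 + e) u^2 + (1 + 1 / e) w^2. The free
    parameter e allows a factor arbitrarily close to 1 in front of the part
    without B, which an induction on A requires. *)
Lemma quot_energy_split C A B (e : R) : 0 < e -> 0 \notin A -> B `<=` A ->
  quot_energy C A
    <= (1 + e) * quot_energy C (A `\` B) + (1 + e^-1) * quot_energy C B.
Proof.
move=> e0 A0 BA.
rewrite (quot_energyE C A0 (fsubset_refl A)) (quot_energyE C A0 BA).
rewrite (quot_energyE C A0 (fsubsetDl A B)) !mulr_sumr -big_split /=.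
apply: ler_sum => z _.
have -> : \sum_(g <- A) diffs C (z / g)
    = \sum_(g <- A `\` B) diffs C (z / g) + \sum_(g <- B) diffs C (z / g).
  rewrite (big_fsetID _ (fun x => x \in B)) /= addrC; congr (_ + _).
    by apply: eq_fbigl => x; rewrite !inE andbC.
  by apply: eq_fbigl => x; rewrite !inE; apply: andb_idl; exact: (fsubsetP BA).
move: (\sum_(g <- A `\` B) _) (\sum_(g <- B) _) => u w.
have := mulr_ge0 (ltW e0) (sqr_ge0 (u - e^-1 * w)).
have -> : e * (u - e^-1 * w) ^+ 2 = e * u ^+ 2 - 2 * (u * w) + e^-1 * w ^+ 2.
  by field; rewrite lt0r_neq0.
lra.
Qed.

Lemma sum_weighted_quads_le C S (w : R -> R) T W :
  2 <= T -> 0 <= W -> 0 \notin S -> (forall m, m \in S -> 0 <= w m <= W) ->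
  \sum_(m <- S) w m * quads C m
    <= T * #|` C|%:R ^+ 2 * (\sum_(m <- S) w m) + 128 * W * #|` C|%:R ^+ 4 / T.
Proof.
move=> T2 W0 S0 wW; have T0 : 0 < T by lra.
have h := @sum_rich_sqr_le R w C C S (intercepts S C) T W T2 W0 S0 wW.
have e4 : #|` C|%:R ^+ 4 = (#|` C|%:R * #|` C|%:R) ^+ 2 :> R by rewrite -expr2 -exprM.
rewrite e4; apply: le_trans (lerD (lexx _) h).
rewrite mulr_sumr -big_split /=; apply: ler_sum_fset => m mS.
have /andP[wm _] := wW _ mS.
rewrite mulrC [in leRHS]mulrC -mulr_sumr -mulrDr mulrC; apply: ler_wpM2l => //.
apply: (le_trans (quads_le C mS)).
rewrite -(sum_richness C mS) mulr_sumr -big_split /=; apply: ler_sum => v _.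
have k0 := richness_ge0 C C m v.
have [Tk|/ltW Tk] := leP T (richness C C m v).
  by rewrite mul1r lerDr mulr_ge0 // ltW.
by rewrite mul0r addr0 expr2; apply: ler_wpM2r.
Qed.

Lemma quot_energy_quots C A : 0 \notin A ->
  quot_energy C A = \sum_(m <- mulset A (invset A)) quots A m * quads C m.
Proof.
move=> A0; rewrite sum_quots //; apply: eq_big_seq => g gA; apply: eq_big_seq => g' g'A.
by rewrite mem_mulset ?mul1r // mem_invset invrK.
Qed.

Lemma sum_quots_quotients A : 0 \notin A ->
  \sum_(m <- mulset A (invset A)) quots A m = #|` A|%:R ^+ 2.
Proof.
move=> A0; under eq_bigr do rewrite -[quots _ _]mulr1.
rewrite (sum_quots _ (fun=> 1) A0) expr2 -sum_const_fset -sum1_fset.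
apply: eq_big_seq => a aA; apply: eq_big_seq => b bA.
by rewrite mem_mulset ?mul1r // mem_invset invrK.
Qed.

Lemma sum_sqr_quots A : 0 \notin A ->
  \sum_(m <- mulset A (invset A)) quots A m ^+ 2 = mult_energy A.
Proof.
move=> A0; under eq_bigr do rewrite expr2.
rewrite (sum_quots _ (quots A) A0).
apply: eq_big_seq => a aA; apply: eq_big_seq => b bA.
by rewrite mem_mulset ?mul1r // mem_invset invrK.
Qed.

Lemma quotients_neq0 A : 0 \notin A -> 0 \notin mulset A (invset A).
Proof. by move=> A0; rewrite mulset_neq0 ?invset_neq0. Qed.

Lemma quot_energy_le C A T : 2 <= T -> 0 \notin A ->
  quot_energy C A <= T * #|` C|%:R ^+ 2 * #|` A|%:R ^+ 2
     + 128 * #|` A|%:R * #|` C|%:R ^+ 4 / T.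
Proof.
move=> T2 A0; rewrite quot_energy_quots // -(sum_quots_quotients A0).
apply: sum_weighted_quads_le => //; first exact: quotients_neq0.
by move=> m _; rewrite quots_ge0 quots_le_card.
Qed.

(** Quotients with multiplicity below rho enter the Szemeredi-Trotter bound with
    the weight rho instead of |A|; the others have total weight at most the
    multiplicative energy over rho. *)
Lemma quot_energy_le_mult_energy C A (rho T1 T2 : R) :
  2 <= T1 -> 2 <= T2 -> 0 < rho -> 0 \notin A ->
  quot_energy C A
    <= (T1 * #|` C|%:R ^+ 2 * #|` A|%:R ^+ 2 + 128 * rho * #|` C|%:R ^+ 4 / T1)
     + (T2 * #|` C|%:R ^+ 2 * (mult_energy A / rho)
          + 128 * #|` A|%:R * #|` C|%:R ^+ 4 / T2).
Proof.
move=> hT1 hT2 rho0 A0; rewrite quot_energy_quots //.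
have q0 := quots_ge0 A; have S0 := quotients_neq0 A0.
pose w1 m : R := (quots A m < rho)%R%:R * quots A m.
pose w2 m : R := (rho <= quots A m)%R%:R * quots A m.
have -> : \sum_(m <- mulset A (invset A)) quots A m * quads C m
  = \sum_(m <- mulset A (invset A)) w1 m * quads C m
    + \sum_(m <- mulset A (invset A)) w2 m * quads C m.
  rewrite -big_split; apply: eq_bigr => m _ /=; rewrite -mulrDl /w1 /w2 -mulrDl.
  by case: (ltP (quots A m) rho) => _; rewrite ?addr0 ?add0r mul1r.
have h1 : \sum_(m <- mulset A (invset A)) w1 m <= #|` A|%:R ^+ 2.
  rewrite -sum_quots_quotients //; apply: ler_sum => m _.
  by rewrite ler_piMl ?ind_le1.
have h2 : \sum_(m <- mulset A (invset A)) w2 m <= mult_energy A / rho.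
  rewrite -sum_sqr_quots // mulr_suml; apply: ler_sum => m _.
  rewrite ler_pdivlMr // /w2; have [h|_] := leP rho (quots A m).
    by rewrite mul1r expr2; apply: ler_wpM2l.
  by rewrite !mul0r sqr_ge0.
apply: lerD.
- apply: le_trans (sum_weighted_quads_le C hT1 (ltW rho0) S0 _) _.
    move=> m _; rewrite /w1 mulr_ge0 ?ind_ge0 //=.
    by have [/ltW h|_] := ltP (quots A m) rho; rewrite ?mul1r // mul0r ltW.
  rewrite lerD2r; apply: ler_wpM2l => //.
  by rewrite mulr_ge0 ?sqr_ge0 //; lra.
- apply: le_trans (sum_weighted_quads_le C hT2 (ler0n R #|` A|) S0 _) _.
    move=> m _; rewrite /w2 mulr_ge0 ?ind_ge0 //=.
    by rewrite (le_trans _ (quots_le_card A m)) // ler_piMl ?ind_le1.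
  rewrite lerD2r; apply: ler_wpM2l => //.
  by rewrite mulr_ge0 ?sqr_ge0 //; lra.
Qed.

End QuotEnergy.

(** * Reduction of both energies to the quotient energy *)

Section Reductions.
Variable R : archiRealFieldType.
Implicit Types (A : {fset R}) (x y a b c : R).

(** The inner product of two counting functions is at most the mean of their
    squared norms. *)
Lemma sum_coincidences (I J : eqType) (V : choiceType) (s : seq I) (u : seq J)
    (f : I -> V) (g : J -> V) :
  2 * (\sum_(i <- s) \sum_(j <- u) (f i == g j)%:R)
    <= \sum_(i <- s) \sum_(i' <- s) (f i == f i')%:R
       + \sum_(j <- u) \sum_(j' <- u) (g j == g j')%:R :> R.
Proof.
pose X := [fset v in map f s ++ map g u].
pose r1 v : R := \sum_(i <- s) (f i == v)%:R.
pose r2 v : R := \sum_(j <- u) (g j == v)%:R.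
have E (I1 I2 : eqType) (s1 : seq I1) (s2 : seq I2) (h1 : I1 -> V) (h2 : I2 -> V) :
    {subset map h1 s1 <= X} ->
    \sum_(i <- s1) \sum_(j <- s2) (h1 i == h2 j)%:R
    = \sum_(v <- X) (\sum_(i <- s1) (h1 i == v)%:R) * (\sum_(j <- s2) (h2 j == v)%:R) :> R.
  move=> sub; under [RHS]eq_bigr do rewrite mulr_suml.
  rewrite [RHS]exchange_big; apply: eq_big_seq => i si /=.
  under [RHS]eq_bigr do rewrite eq_sym.
  rewrite sum_pred1_fset_mul sub ?map_f // mul1r.
  by apply: eq_bigr => j _; rewrite eq_sym.
rewrite (E _ _ s u f g) ?(E _ _ s s f f) ?(E _ _ u u g g); first last.
- by move=> v vf; rewrite !inE vf ?orbT.
- by move=> v vf; rewrite !inE vf ?orbT.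
- by move=> v vf; rewrite !inE vf ?orbT.
rewrite mulr_sumr -big_split; apply: ler_sum => v _ /=.
move: (\sum_(i <- s) _) (\sum_(j <- u) _) => p q.
by have := sqr_ge0 (p - q); rewrite sqrrB !expr2; lra.
Qed.

Lemma sum_dilated_all A a a' : a' != 0 ->
  \sum_(b <- A) \sum_(c <- A) \sum_(b' <- A) \sum_(c' <- A)
     (a * (b - c) == a' * (b' - c'))%:R
   = quads A (a / a') + #|` A|%:R ^+ 2.
Proof.
move=> a'0.
have e b c : \sum_(b' <- A) \sum_(c' <- A) (a * (b - c) == a' * (b' - c'))%:R
    = diffs A (a / a' * (b - c)) :> R.
  apply: eq_bigr => b' _; rewrite -sum_pred1_fset; apply: eq_bigr => c' _.
  congr ((nat_of_bool _)%:R).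
  apply/eqP/eqP => [h|->]; last by field.
  by rewrite mulrAC h mulrAC divff // mul1r; ring.
under eq_bigr => b _ do under eq_bigr => c _ do rewrite e.
rewrite /quads expr2 -sum_const_fset -big_split; apply: eq_big_seq => b bA /=.
rewrite (_ : #|` A|%:R = \sum_(c <- A) (c == b)%:R * #|` A|%:R); last first.
  by rewrite -mulr_suml sum_pred1_fset bA mul1r.
rewrite -big_split; apply: eq_bigr => c _ /=; rewrite [c == b]eq_sym.
have [->|_] := eqVneq b c; last by rewrite mul1r mul0r addr0.
rewrite subrr mulr0 mul0r add0r mul1r /diffs -sum1_fset.
by apply: eq_big_seq => x xA; rewrite subr0 xA.
Qed.

(** With phi (b, b') = a b - a' b', the equation with the sign minus reads phi
    (b, b') = phi (c, c') and the one with the sign plus phi (b, b') = - phi (c,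
    c'). *)
Lemma sign_le_minus A (s : bool) a a' :
  \sum_(b <- A) \sum_(c <- A) \sum_(b' <- A) \sum_(c' <- A)
     (a * (b + (-1) ^+ s * c) == a' * (b' + (-1) ^+ s * c'))%:R
   <= \sum_(b <- A) \sum_(c <- A) \sum_(b' <- A) \sum_(c' <- A)
     (a * (b - c) == a' * (b' - c'))%:R :> R.
Proof.
case: s; first by rewrite expr1; under eq_bigr do under eq_bigr do
  under eq_bigr do under eq_bigr do rewrite !mulN1r.
rewrite expr0.
pose phi (p : R * R) := a * p.1 - a' * p.2.
pose P2 := [seq (b, b') | b <- A, b' <- A].
have reorg (h : R -> R -> R -> R -> R) :
   \sum_(b <- A) \sum_(c <- A) \sum_(b' <- A) \sum_(c' <- A) h b c b' c'
   = \sum_(p <- P2) \sum_(q <- P2) h p.1 q.1 p.2 q.2.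
  rewrite big_allpairs; apply: eq_bigr => b _ /=.
  under [RHS]eq_bigr do rewrite big_allpairs.
  by rewrite [RHS]exchange_big.
rewrite !reorg.
have -> : \sum_(p <- P2) \sum_(q <- P2)
   (a * (p.1 - q.1) == a' * (p.2 - q.2))%:R
   = \sum_(p <- P2) \sum_(q <- P2) (phi p == phi q)%:R :> R.
  apply: eq_bigr => p _; apply: eq_bigr => q _; congr ((nat_of_bool _)%:R).
  rewrite -subr_eq0 -[RHS]subr_eq0; congr (_ == _); rewrite /phi; ring.
have -> : \sum_(p <- P2) \sum_(q <- P2)
   (a * (p.1 + 1 * q.1) == a' * (p.2 + 1 * q.2))%:R
   = \sum_(p <- P2) \sum_(q <- P2) (phi p == - phi q)%:R :> R.
  apply: eq_bigr => p _; apply: eq_bigr => q _; congr ((nat_of_bool _)%:R).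
  rewrite -subr_eq0 -[RHS]subr_eq0; congr (_ == _); rewrite /phi; ring.
have := sum_coincidences P2 P2 phi (fun q => - phi q).
under [in X in _ <= _ + X]eq_bigr do under eq_bigr do rewrite eqr_opp.
lra.
Qed.

Definition triple_energy A (f : R * R * R -> R) : R :=
  \sum_(a <- A) \sum_(b <- A) \sum_(c <- A)
  \sum_(a' <- A) \sum_(b' <- A) \sum_(c' <- A)
     (f (a, b, c) == f (a', b', c'))%:R.

Lemma sum_fset_neq0 A (h : R -> R) : (forall x, x \in A -> 0 <= h x) ->
  \sum_(a <- A) h a <= \sum_(a <- A `\ 0) h a + (0 \in A)%:R * h 0.
Proof.
move=> h0; case: (boolP (0 \in A)) => zA.
  by rewrite (big_fsetD1 0) //= mul1r addrC.
rewrite mul0r addr0; suff -> : A `\ 0 = A by [].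
by apply/fsetP => x; rewrite !inE; case: eqP => // ->; rewrite (negbTE zA).
Qed.

Lemma sum_triples_pair_first A (h : R -> R -> R -> R -> R -> R -> R) :
  \sum_(a <- A) \sum_(b <- A) \sum_(c <- A)
  \sum_(a' <- A) \sum_(b' <- A) \sum_(c' <- A) h a b c a' b' c'
  = \sum_(a <- A) \sum_(a' <- A) \sum_(b <- A) \sum_(c <- A)
    \sum_(b' <- A) \sum_(c' <- A) h a b c a' b' c'.
Proof.
apply: eq_bigr => a _.
under eq_bigr => b _ do rewrite exchange_big /=.
by rewrite exchange_big.
Qed.

Lemma mul_sum_energy_le A (s : bool) :
  triple_energy A (fun t => t.1.1 * (t.1.2 + (-1) ^+ s * t.2))
    <= quot_energy A (A `\ 0) + 5 * #|` A|%:R ^+ 4.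
Proof.
set n : R := #|` A|%:R; have n0 : 0 <= n by exact: ler0n.
rewrite /triple_energy sum_triples_pair_first /=.
pose N a a' : R := \sum_(b <- A) \sum_(c <- A) \sum_(b' <- A) \sum_(c' <- A)
     (a * (b + (-1) ^+ s * c) == a' * (b' + (-1) ^+ s * c'))%:R.
have N0 a a' : 0 <= N a a' by do 4!apply: sumr_ge0 => ? _; exact: ind_ge0.
have NC a a' : N a a' = N a' a.
  rewrite /N.
  under eq_bigr => b _ do rewrite exchange_big /=.
  rewrite exchange_big; apply: eq_bigr => b' _ /=.
  under eq_bigr => b _ do rewrite exchange_big /=.
  rewrite exchange_big; apply: eq_bigr => c' _ /=.
  by apply: eq_bigr => b _; apply: eq_bigr => c _; rewrite eq_sym.
have szz a (a0 : a != 0) : N 0 a <= n ^+ 3.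
  rewrite /N !exprS expr0 mulr1 -sum_const_fset; apply: ler_sum => b _.
  rewrite -sum_const_fset; apply: ler_sum => c _.
  rewrite /n -sum1_fset; apply: ler_sum => b' _.
  apply: (@le_trans _ _ (\sum_(c' <- A) (c' == - ((-1) ^+ s * b'))%:R)).
    apply: ler_sum => c' _; apply: ler_ind; rewrite mul0r eq_sym mulf_eq0 (negbTE a0) /=.
    rewrite addrC addr_eq0 => /eqP h; apply/eqP.
    by rewrite -mulrN -h mulrA -expr2 sqrr_sign mul1r.
  by rewrite sum_pred1_fset ind_le1.
have N00 : N 0 0 <= n ^+ 4.
  rewrite /N !exprS expr0 mulr1; do 3!(rewrite -sum_const_fset; apply: ler_sum => ? _).
  by exact: sum_ind_le_card.
rewrite -/(N _ _).
have hz a : \sum_(a' <- A) N a a' <= \sum_(a' <- A `\ 0) N a a' + N a 0.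
  apply: (le_trans (sum_fset_neq0 _)) => //.
  by rewrite lerD2l ler_piMl // ind_le1.
have hA : #|` A `\ 0|%:R <= n by rewrite ler_nat fsubset_leq_card // fsubD1set.
have h1 : \sum_(a <- A `\ 0) N a 0 <= n ^+ 4.
  apply: (@le_trans _ _ (\sum_(a <- A `\ 0) n ^+ 3)).
    by apply: ler_sum_fset => a; rewrite !inE => /andP[a0 _]; rewrite NC szz.
  by rewrite sum_const_fset [n ^+ 4]exprS; apply: ler_wpM2r => //; exact: exprn_ge0.
have h2 : \sum_(a <- A) \sum_(a' <- A) N a a'
    <= \sum_(a <- A `\ 0) \sum_(a' <- A `\ 0) N a a' + 3 * n ^+ 4.
  have F0 a : a \in A -> 0 <= \sum_(a' <- A) N a a' by move=> _; apply: sumr_ge0.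
  apply: (le_trans (sum_fset_neq0 F0)).
  have h3 : (0 \in A)%:R * \sum_(a' <- A) N 0 a' <= 2 * n ^+ 4.
    apply: (@le_trans _ _ (\sum_(a' <- A) N 0 a')).
      by rewrite ler_piMl ?ind_le1 // sumr_ge0.
    apply: (le_trans (hz 0)); under eq_bigr do rewrite NC.
    move: h1 N00; clear; lra.
  have h4 : \sum_(a <- A `\ 0) \sum_(a' <- A) N a a'
     <= \sum_(a <- A `\ 0) \sum_(a' <- A `\ 0) N a a' + \sum_(a <- A `\ 0) N a 0.
    by rewrite -big_split; apply: ler_sum => a _; exact: hz.
  lra.
apply: (le_trans h2).
have h5 : \sum_(a <- A `\ 0) \sum_(a' <- A `\ 0) N a a'
    <= quot_energy A (A `\ 0) + n ^+ 4.
  apply: (@le_trans _ _ (\sum_(a <- A `\ 0) \sum_(a' <- A `\ 0)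
     (quads A (a / a') + n ^+ 2))).
    apply: ler_sum => a _; apply: ler_sum_fset => a'; rewrite !inE => /andP[a'0 _].
    by rewrite -sum_dilated_all // sign_le_minus.
  under eq_bigr do rewrite big_split sum_const_fset.
  rewrite big_split sum_const_fset /= lerD2l mulrA.
  rewrite (_ : n ^+ 4 = n * n * n ^+ 2); last by ring.
  by apply: ler_wpM2r; [exact: sqr_ge0|apply: ler_pM].
have : 0 <= n ^+ 4 by exact: exprn_ge0.
lra.
Qed.

Lemma sum_fsetM (K1 K2 : choiceType) (A1 : {fset K1}) (A2 : {fset K2}) (h : K1 * K2 -> R) :
  \sum_(p <- A1 `*` A2) h p = \sum_(x <- A1) \sum_(y <- A2) h (x, y).
Proof.
rewrite -[RHS]big_allpairs.
apply: perm_big; apply: uniq_perm; first exact: fset_uniq.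
  by apply: allpairs_uniq; rewrite ?fset_uniq // => -[x y] [x' y'] _ _ [-> ->].
move=> [x y]; rewrite in_fsetM /=; apply/andP/allpairsP => [[xA yA]|].
  by exists (x, y).
by case=> -[x' y'] /= [xA yA [-> ->]].
Qed.

Lemma sum_quads_shift A (As : {fset R}) : 0 \notin As -> (#|` As| <= #|` A|)%N ->
  \sum_(a <- As) \sum_(a' <- As)
     \sum_(b <- A) \sum_(c <- A) \sum_(b' <- A) \sum_(c' <- A)
       (a * (b - c) == a' * (b' - c'))%:R
   <= quot_energy A As + #|` A|%:R ^+ 4.
Proof.
move=> z hA.
apply: (@le_trans _ _ (\sum_(a <- As) \sum_(a' <- As) (quads A (a / a') + #|` A|%:R ^+ 2))).
  apply: ler_sum => a _; apply: ler_sum_fset => a' a'A.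
  by rewrite -sum_dilated_all //; apply: contraNneq z => <-.
under eq_bigr do rewrite big_split sum_const_fset.
rewrite big_split sum_const_fset /= lerD2l mulrA.
rewrite (_ : #|` A|%:R ^+ 4 = #|` A|%:R * #|` A|%:R * #|` A|%:R ^+ 2); last by ring.
by apply: ler_wpM2r; [exact: sqr_ge0|apply: ler_pM; rewrite ?ler0n ?ler_nat].
Qed.

(** For q = ((a, a'), (c, c')), slope and intercept of the line of all (b, b')
    with a b + sg c = a' b' + sg c'. *)
Definition line_through (sg : R) (q : (R * R) * (R * R)) : R * R :=
  (q.1.1 / q.1.2, sg * (q.2.1 - q.2.2) / q.1.2).

(** Coincidence of the lines of (a, a', c, c') and of q = ((a1, a1'), (c1, c1'))
    means a / a' = a1 / a1' together with a1' (c - c') = a' (c1 - c1'). The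
    second equation is counted by the quotient energy; the first then determines
    a, and only a1 remains free, which costs the factor |A|. *)
Lemma line_energy_le A (sg : R) : sg != 0 ->
  \sum_(q <- (A `\ 0) `*` (A `\ 0) `*` (A `*` A))
    \sum_(q' <- (A `\ 0) `*` (A `\ 0) `*` (A `*` A))
      (line_through sg q == line_through sg q')%:R
    <= #|` A|%:R * (quot_energy A (A `\ 0) + #|` A|%:R ^+ 4).
Proof.
move=> s0; set As := A `\ 0; have As0 : 0 \notin As by rewrite !inE eqxx.
have nz a : a \in As -> a != 0 by apply: contraTneq => ->.
have cA : (#|` As| <= #|` A|)%N by rewrite fsubset_leq_card // fsubD1set.
apply: le_trans (ler_wpM2l (ler0n _ _) (sum_quads_shift As0 cA)).
apply: (@le_trans _ _ (#|` As|%:R * (\sum_(a <- As) \sum_(a' <- As)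
     \sum_(b <- A) \sum_(c <- A) \sum_(b' <- A) \sum_(c' <- A)
       (a * (b - c) == a' * (b' - c'))%:R))); last first.
  apply: ler_wpM2r; last by rewrite ler_nat.
  by do 6!apply: sumr_ge0 => ? _; exact: ind_ge0.
rewrite sum_fsetM sum_fsetM exchange_big -sum_const_fset /=.
pose E (a' : R) (r : R * R) (q : (R * R) * (R * R)) : R :=
  (q.1.2 * (r.1 - r.2) == a' * (q.2.1 - q.2.2))%:R.
apply: (@le_trans _ _ (\sum_(a' <- As) \sum_(r <- A `*` A)
    \sum_(q <- As `*` As `*` (A `*` A)) E a' r q)).
  apply: ler_sum_fset => a' a'A; have a'0 := nz _ a'A.
  rewrite exchange_big; apply: ler_sum => r _ /=.
  rewrite exchange_big; apply: ler_sum_fset => q /=.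
  rewrite !in_fsetM => /andP[/andP[_ /nz q0] _].
  apply: (@le_trans _ _ (\sum_(a <- As) E a' r q * (a == q.1.1 / q.1.2 * a')%:R)).
    apply: ler_sum => a _; rewrite -ind_andb; apply: ler_ind.
    rewrite /line_through /= xpair_eqE => /andP[/eqP <- /eqP h].
    rewrite divfK // eqxx andbT; apply/eqP/(mulfI s0).
    have {}h := congr1 (fun x => x * (a' * q.1.2)) h.
    have e1 : sg * (r.1 - r.2) / a' * (a' * q.1.2) = sg * (q.1.2 * (r.1 - r.2)) by field.
    have e2 : sg * (q.2.1 - q.2.2) / q.1.2 * (a' * q.1.2)
        = sg * (a' * (q.2.1 - q.2.2)) by field.
    by move: h => /=; rewrite e1 e2.
  by rewrite -mulr_sumr sum_pred1_fset ler_piMr ?ind_le1 // ind_ge0.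
rewrite sum_const_fset [X in _ * X]exchange_big mulr_sumr; apply: ler_sum => a' _ /=.
rewrite sum_fsetM.
have e c c' : \sum_(q <- As `*` As `*` (A `*` A)) E a' (c, c') q
    = #|` As|%:R * \sum_(al <- As) \sum_(x <- A) \sum_(y <- A)
        (al * (c - c') == a' * (x - y))%:R.
  rewrite sum_fsetM sum_fsetM /E /= sum_const_fset; congr (_ * _).
  by apply: eq_bigr => al _; rewrite sum_fsetM.
apply: (@le_trans _ _ (\sum_(c <- A) \sum_(c' <- A) #|` As|%:R *
    \sum_(al <- As) \sum_(x <- A) \sum_(y <- A) (al * (c - c') == a' * (x - y))%:R)).
  by apply: ler_sum => c _; apply: ler_sum => c' _; rewrite e.
under [leLHS]eq_bigr => c _ do rewrite -mulr_sumr exchange_big /=.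
by rewrite -[leLHS]mulr_sumr exchange_big.
Qed.

(** The solutions are incidences between the grid A x A and the lines
    [line_through], taken with multiplicity rho. Lines with fewer than T points
    contribute at most T |A|^4. On the others, the inequality of arithmetic and
    geometric means with the parameter eta separates rho, whose squares are
    summed by [line_energy_le], from the richness, whose squares are summed by
    Szemeredi-Trotter. *)
Lemma prod_sum_energy_le A (s : bool) (T eta : R) : 2 <= T -> 0 < eta ->
  triple_energy A (fun t => t.1.1 * t.1.2 + (-1) ^+ s * t.2)
    <= (T + 2) * #|` A|%:R ^+ 4
       + eta / 2 * (#|` A|%:R * (quot_energy A (A `\ 0) + #|` A|%:R ^+ 4))
       + 64 * #|` A|%:R ^+ 4 / (eta * T).
Proof.
move=> T2 eta0; set n : R := #|` A|%:R; have n0 : 0 <= n by exact: ler0n.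
rewrite /triple_energy sum_triples_pair_first /=; set sg : R := (-1) ^+ s.
have sg0 : sg != 0 by rewrite signr_eq0.
pose N a a' : R := \sum_(b <- A) \sum_(c <- A) \sum_(b' <- A) \sum_(c' <- A)
     (a * b + sg * c == a' * b' + sg * c')%:R.
have N0 a a' : 0 <= N a a' by do 4!apply: sumr_ge0 => ? _; exact: ind_ge0.
have NC a a' : N a a' = N a' a.
  rewrite /N.
  under eq_bigr => b _ do rewrite exchange_big /=.
  rewrite exchange_big; apply: eq_bigr => b' _ /=.
  under eq_bigr => b _ do rewrite exchange_big /=.
  rewrite exchange_big; apply: eq_bigr => c' _ /=.
  by apply: eq_bigr => b _; apply: eq_bigr => c _; rewrite eq_sym.
have Nz a : N a 0 <= n ^+ 3.
  rewrite /N !exprS expr0 mulr1 -sum_const_fset; apply: ler_sum => b _.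
  rewrite -sum_const_fset; apply: ler_sum => c _.
  rewrite -[leRHS]mulr1 -sum_const_fset; apply: ler_sum => b' _.
  apply: (@le_trans _ _ (\sum_(c' <- A) (c' == sg^-1 * (a * b + sg * c))%:R)).
    apply: ler_sum => c' _; apply: ler_ind; rewrite mul0r add0r => /eqP ->.
    by rewrite mulKf.
  by rewrite sum_pred1_fset ind_le1.
rewrite -/(N _ _).
pose As := A `\ 0; have As0 : 0 \notin As by rewrite !inE eqxx.
have nz a : a \in As -> a != 0 by apply: contraTneq => ->.
have hA : #|` As|%:R <= n by rewrite ler_nat fsubset_leq_card // fsubD1set.
have hz a : \sum_(a' <- A) N a a' <= \sum_(a' <- As) N a a' + n ^+ 3.
  apply: (le_trans (sum_fset_neq0 _)) => //.
  by rewrite lerD2l (le_trans _ (Nz a)) // ler_piMl // ind_le1.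
have h2 : \sum_(a <- A) \sum_(a' <- A) N a a'
    <= \sum_(a <- As) \sum_(a' <- As) N a a' + 2 * n ^+ 4.
  have F0 a : a \in A -> 0 <= \sum_(a' <- A) N a a' by move=> _; apply: sumr_ge0.
  apply: (le_trans (sum_fset_neq0 F0)).
  have h3 : (0 \in A)%:R * \sum_(a' <- A) N 0 a' <= n ^+ 4.
    apply: (@le_trans _ _ (\sum_(a' <- A) n ^+ 3)); last first.
      by rewrite sum_const_fset -exprS.
    apply: (@le_trans _ _ (\sum_(a' <- A) N 0 a')).
      by rewrite ler_piMl ?ind_le1 // sumr_ge0.
    by apply: ler_sum => a' _; rewrite NC.
  have h4 : \sum_(a <- As) \sum_(a' <- A) N a a'
     <= \sum_(a <- As) \sum_(a' <- As) N a a' + n ^+ 4.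
    apply: (le_trans (ler_sum _ (fun a _ => hz a))).
    rewrite big_split sum_const_fset lerD2l [n ^+ 4]exprS.
    by apply: ler_wpM2r => //; exact: exprn_ge0.
  move: h3 h4; rewrite -/As; clear; lra.
apply: (le_trans h2).
pose Q := (As `*` As) `*` (A `*` A).
pose l := line_through sg.
pose k (p : R * R) : R := richness A A p.1 p.2.
have NE : \sum_(a <- As) \sum_(a' <- As) N a a' = \sum_(q <- Q) k (l q).
  rewrite !sum_fsetM; apply: eq_bigr => a _; apply: eq_big_seq => a' a'A.
  rewrite sum_fsetM /N exchange_big; apply: eq_bigr => c _ /=.
  under eq_bigr => b _ do rewrite exchange_big /=.
  rewrite exchange_big; apply: eq_bigr => c' _ /=.
  rewrite /k /richness /=; apply: eq_bigr => b _.
  rewrite -sum_pred1_fset; apply: eq_bigr => b' _; congr ((nat_of_bool _)%:R).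
  have a'0 := nz _ a'A.
  apply/eqP/eqP => [h|->]; last by field.
  have -> : b' = (a' * b' + sg * c' - sg * c') / a' by field.
  by rewrite -h; field.
pose S := mulset As (invset As).
pose V := mulset (diffset A) (invset As).
have S0 : 0 \notin S by exact: quotients_neq0.
pose Ls := S `*` V.
have lQ q : q \in Q -> l q \in Ls.
  rewrite !in_fsetM => /andP[/andP[q1 q2] /andP[q3 q4]] /=.
  rewrite !mem_mulset ?mem_invset ?invrK //= /sg.
  case: (s); rewrite ?expr1 ?expr0 ?mulN1r ?mul1r ?opprB; exact: mem_diffset.
pose rho p : R := \sum_(q <- Q) (l q == p)%:R.
have rhoE (h : R * R -> R) : \sum_(q <- Q) h (l q) = \sum_(p <- Ls) rho p * h p.
  rewrite /rho; under [RHS]eq_bigr do rewrite mulr_suml.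
  rewrite [RHS]exchange_big; apply: eq_big_seq => q qQ /=.
  by under [RHS]eq_bigr do rewrite eq_sym; rewrite sum_pred1_fset_mul lQ // mul1r.
have cQ : #|` Q|%:R <= n ^+ 4.
  have cM (K1 K2 : choiceType) (A1 : {fset K1}) (A2 : {fset K2}) :
      #|` A1 `*` A2|%:R = #|` A1|%:R * #|` A2|%:R :> R.
    rewrite -sum1_fset sum_fsetM -sum_const_fset; apply: eq_bigr => x _.
    exact: sum1_fset.
  rewrite !cM -/n (_ : n ^+ 4 = n * n * (n * n)); last by ring.
  by apply: ler_wpM2r; [exact: mulr_ge0|apply: ler_pM; rewrite ?ler0n].
have hrho : \sum_(p <- Ls) rho p ^+ 2
    <= n * (quot_energy A As + n ^+ 4).
  apply: le_trans (line_energy_le A sg0); rewrite -/As -/Q -/l.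
  under eq_bigr do rewrite expr2.
  rewrite -(rhoE rho) le_eqVlt; apply/orP; left; apply/eqP; apply: eq_bigr => q _.
  by apply: eq_bigr => q' _; rewrite eq_sym.
have hk : \sum_(p <- Ls) (T <= k p)%R%:R * k p ^+ 2 <= 128 * n ^+ 4 / T.
  rewrite sum_fsetM; apply: le_trans (sum_rich_sqr1_le A A V T2 S0) _.
  by rewrite -/n -expr2 -exprM.
have T0 : 0 < T by lra.
have h5 : \sum_(q <- Q) k (l q) <= T * n ^+ 4
    + \sum_(p <- Ls) rho p * ((T <= k p)%R%:R * k p).
  rewrite -rhoE; apply: (@le_trans _ _ (T * #|` Q|%:R
     + \sum_(q <- Q) (T <= k (l q))%R%:R * k (l q))); last first.
    by rewrite lerD2r; apply: ler_wpM2l => //; exact: ltW.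
  rewrite mulrC -sum_const_fset -big_split; apply: ler_sum => q _ /=.
  have [h|/ltW h] := leP T (k (l q)); last by rewrite mul0r addr0.
  by rewrite mul1r lerDr ltW.
have h6 : \sum_(p <- Ls) rho p * ((T <= k p)%R%:R * k p)
    <= eta / 2 * (\sum_(p <- Ls) rho p ^+ 2)
       + (2 * eta)^-1 * \sum_(p <- Ls) (T <= k p)%R%:R * k p ^+ 2.
  rewrite !mulr_sumr -big_split; apply: ler_sum => p _ /=.
  have e0 : 0 <= (2 * eta)^-1 by rewrite invr_ge0 mulr_ge0 // ltW.
  have := mulr_ge0 e0 (sqr_ge0 (eta * rho p - (T <= k p)%R%:R * k p)).
  have -> : (2 * eta)^-1 * (eta * rho p - (T <= k p)%R%:R * k p) ^+ 2
     = eta / 2 * rho p ^+ 2 - rho p * ((T <= k p)%R%:R * k p)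
       + (2 * eta)^-1 * ((T <= k p)%R%:R * ((T <= k p)%R%:R * k p ^+ 2)).
    by field; rewrite lt0r_neq0.
  by case: (T <= k p); rewrite ?mul1r ?mul0r ?mulr0; lra.
have e1 : 0 <= eta / 2 by rewrite divr_ge0 // ltW.
have e2 : 0 <= (2 * eta)^-1 by rewrite invr_ge0 mulr_ge0 // ltW.
have h7 := ler_wpM2l e1 hrho; have h8 := ler_wpM2l e2 hk.
have h9 : (2 * eta)^-1 * (128 * n ^+ 4 / T) = 64 * n ^+ 4 / (eta * T).
  by field; rewrite !lt0r_neq0.
rewrite h9 in h8; rewrite NE; move: h5 h6 h7 h8; clear; lra.
Qed.

End Reductions.

(** * Comparing powers of a real number *)

Section Powers.
Variables (R : realType) (n : R).
Hypothesis n1 : 1 < n.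
Implicit Types (a b c d x y : R).

Lemma pw_gt0 a : 0 < n `^ a.
Proof. by rewrite powR_gt0 // (lt_trans ltr01). Qed.

Lemma pw_ge0 a : 0 <= n `^ a.
Proof. exact: powR_ge0. Qed.

Lemma pwD a b : n `^ a * n `^ b = n `^ (a + b).
Proof. by rewrite powRD //; apply/implyP => _; rewrite gt_eqF // (lt_trans ltr01). Qed.

Lemma pwV a : (n `^ a)^-1 = n `^ (- a).
Proof. by rewrite powRN. Qed.

Lemma pwX a (k : nat) : (n `^ a) ^+ k = n `^ (k%:R * a).
Proof. by rewrite mulrC powRrM powR_mulrn ?powR_ge0. Qed.

Lemma pw_le a b : a <= b -> n `^ a <= n `^ b.
Proof. by move=> ab; apply: ler_powR => //; exact: ltW. Qed.

Lemma pw_lt a b : a < b -> n `^ a < n `^ b.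
Proof.
move=> ab; rewrite -(subrK a b) -pwD mulrC ltr_pMr ?pw_gt0 //.
have : (1 : R) `^ (b - a) < n `^ (b - a).
  by apply: gt0_ltr_powR; rewrite ?subr_gt0 // nnegrE ?ler01 // (le_trans ler01) // ltW.
by rewrite powR1.
Qed.

(** Constant factors are never tracked: once [n `^ d] exceeds them, they are
    traded for a change of the exponent by [d]. *)
Lemma pw_absorb d c x a : c <= n `^ d -> x <= c * n `^ a -> x <= n `^ (d + a).
Proof.
move=> cd /le_trans; apply; rewrite -pwD; apply: ler_wpM2r => //; exact: pw_ge0.
Qed.

Lemma pw_absorbV d c x a : 0 < c -> c <= n `^ d -> n `^ a <= c * x -> n `^ (a - d) <= x.
Proof.
move=> c0 cd h; rewrite -pwD -pwV mulrC ler_pdivrMl ?pw_gt0 //.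
have x0 : 0 <= x by rewrite -(pmulr_rge0 _ c0); apply: le_trans h; exact: pw_ge0.
by apply: (le_trans h); apply: ler_wpM2r.
Qed.

End Powers.

(** * Structured sets have few popular pairs *)

Section PowerTails.
Variables (R : realType) (n d : R).
Hypotheses (n1 : 1 < n) (hd : 4096 <= n `^ d).
Implicit Types (A S : {fset R}).

(** If S has about n elements and A and A1, containing A / S, have at most about
    n, then [tail_bound] holds with M of order n^3, up to powers n^O(d). *)
Lemma tail_bounded_powers A S A1 :
  0 \notin S -> 0 \notin A1 ->
  (forall s a, s \in S -> a \in A -> a / s \in A1) ->
  n `^ (1 - d) <= #|` S|%:R -> #|` A|%:R <= n `^ (1 + d) ->
  #|` A1|%:R <= n `^ (1 + d) ->
  tail_bounded A (n `^ (3 + 6 * d)) (n `^ (3 * d)).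
Proof.
move=> S0 A10 SA hS hA hA1 t Y tt Yt.
have sp : 0 < #|` S|%:R :> R by apply: lt_le_trans hS; exact: pw_gt0.
have Sn : S != fset0 by rewrite -cardfs_gt0 -(ltr0n R).
have si : #|` S|%:R^-1 <= n `^ (d - 1).
  rewrite -[d - 1]opprB -pwV lef_pV2 ?posrE ?pw_gt0 //.
have s0 : 0 <= #|` S|%:R^-1 :> R by rewrite invr_ge0 ltW.
have tp : 0 < t by apply: lt_le_trans tt; exact: pw_gt0.
have := @tail_bound R A S A1 Sn S0 A10 SA t Y.
move=> /(_ _ Yt) h; apply: le_trans (h _) _.
  apply: le_trans tt; rewrite -mulrA.
  have h1 := ler_pM (ler0n R _) s0 hA1 si.
  apply: (@le_trans _ _ (4096 * (n `^ (1 + d) * n `^ (d - 1)))).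
    have : 0 <= #|` A1|%:R * #|` S|%:R^-1 :> R by apply: mulr_ge0 => //; exact: ler0n.
    lra.
  rewrite pwD //; apply: le_trans (pw_absorb n1 hd (lexx _)) _.
  by apply: pw_le => //; lra.
apply: ler_wpM2r; first by rewrite invr_ge0 exprn_ge0 // ltW.
have hAA : (#|` A|%:R * #|` A1|%:R) ^+ 2 <= (n `^ (1 + d) * n `^ (1 + d)) ^+ 2.
  rewrite lerXn2r ?nnegrE ?mulr_ge0 ?ler0n ?pw_ge0 //.
  by apply: ler_pM => //; exact: ler0n.
have h1 := ler_pM (sqr_ge0 _) s0 hAA si.
apply: (@le_trans _ _ (4096 * ((n `^ (1 + d) * n `^ (1 + d)) ^+ 2 * n `^ (d - 1)))).
  have : 0 <= (#|` A|%:R * #|` A1|%:R) ^+ 2 * #|` S|%:R^-1 :> R.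
    by apply: mulr_ge0 => //; exact: sqr_ge0.
  lra.
rewrite pwD // pwX // pwD //; apply: le_trans (pw_absorb n1 hd (lexx _)) _.
by apply: pw_le => //; lra.
Qed.

End PowerTails.

(** Clearing the context confines [lra] to the linear constraints on the
    exponents. *)
Local Tactic Notation "compare_exponents" hyp(h0) hyp(h1) :=
  apply: pw_le => //; clear -h0 h1; lra.

Lemma popular_card_le (R : realType) (n d e : R) (A : {fset R}) :
  1 < n -> 3 * d <= e ->
  tail_bounded A (n `^ (3 + 6 * d)) (n `^ (3 * d)) ->
  #|` popular A (n `^ e)|%:R <= n `^ (3 + 6 * d - 3 * e).
Proof.
move=> n1 de hA.
have tp := pw_gt0 n1 e.
apply: le_trans (tail_bounded_card hA (pw_le n1 de) tp _) _.
  by move=> y; rewrite mem_popular // => /andP[].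
by rewrite pwX // pwV pwD //; apply: pw_le => //; lra.
Qed.

(** Suppose that n^2 pairs have differences with n^(1/2) representations (up to
    factors n^O(d) throughout). By the tail bound there are at most n^(3/2) such
    differences, so [many_shifts] gives n^8 <= n^3 n^(3/2) W, that is W >=
    n^(7/2). The thresholds t and th around n^(1/2) are placed so that the
    extreme ranges in [shifts_le_triangles] do not account for this, whence at
    least n^3 triangles. On the other hand [sqr_triangles_le] bounds the square
    of their number by n^(8/3) n^(19/6), and 35/6 < 6. The constant 4000 absorbs
    the accumulated multiples of d in the gap 1/6. *)
Lemma few_popular_pairs (R : realType) (n d : R) (A S A1 S' A2 : {fset R}) :
  1 < n -> 0 < d -> 4096 <= n `^ d -> 4000 * (4 * d) <= 1 ->
  0 \notin S -> 0 \notin S' -> 0 \notin A1 -> 0 \notin A2 ->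
  (forall s a, s \in S -> a \in A -> a / s \in A1) ->
  (forall s a, s \in S' -> a \in A1 -> a / s \in A2) ->
  n `^ (1 - d) <= #|` S|%:R <= n `^ (1 + d) -> n `^ (1 - d) <= #|` S'|%:R ->
  n `^ (1 - d) <= #|` A|%:R <= n `^ (1 + d) ->
  #|` A1|%:R <= n `^ (1 + d) -> #|` A2|%:R <= n `^ (1 + d) ->
  \sum_(u <- A) \sum_(w <- A) (u - w \in popular A (n `^ (1 / 2 - 10 * d)))%:R
    < n `^ (2 - 23 * d).
Proof.
move=> n1 d0 hd d1 S0 S'0 A10 A20 SA SA1 /andP[hS hS'] hS2 /andP[hA hA'] hA1 hA2.
have tA := tail_bounded_powers n1 hd S0 A10 SA hS hA' hA1.
have tA1 := tail_bounded_powers n1 hd S'0 A20 SA1 hS2 hA1 hA2.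
rewrite ltNge; apply/negP; set m := \sum_(u <- A) _ => hm.
set a : R := #|` A|%:R in hA hA' *.
have a0 : 0 <= a by exact: ler0n.
have aX k : a ^+ k <= n `^ (k%:R * (1 + d)).
  by rewrite -pwX //; apply: lerXn2r; rewrite ?nnegrE ?pw_ge0.
set tau := n `^ (1 / 2 - 10 * d) in m hm.
(* The lower bound for W below is n^(7/2 - 131 d), so that t |A|^3 and the tail
   beyond th, which is n^(4 + 7 d) / th, both have to be at most n^(7/2 - 133
   d). *)
pose t := n `^ (1 / 2 - 136 * d); pose th := n `^ (1 / 2 + 140 * d).
pose D := popular A tau; pose D' := popular A t.
have tau0 : 0 < tau by exact: pw_gt0.
have t0 : 0 < t by exact: pw_gt0.
have th0 : 0 < th by exact: pw_gt0.
have ttau : t <= tau. compare_exponents d0 d1.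
have cD : #|` D|%:R <= n `^ (3 / 2 + 36 * d).
  apply: le_trans (popular_card_le n1 _ tA) _; first by clear -d0 d1; lra.
  by compare_exponents d0 d1.
have cD' : #|` D'|%:R <= n `^ (3 / 2 + 414 * d).
  apply: le_trans (popular_card_le n1 _ tA) _; first by clear -d0 d1; lra.
  by compare_exponents d0 d1.
have cX : #|` popular A1 t|%:R <= n `^ (3 / 2 + 414 * d).
  apply: le_trans (popular_card_le n1 _ tA1) _; first by clear -d0 d1; lra.
  by compare_exponents d0 d1.
pose W : R := \sum_(c <- A) \sum_(z <- D) shift_count A D c z ^+ 2.
have W0 : 0 <= W by do 2!apply: sumr_ge0 => ? _; exact: sqr_ge0.
have Wlow : n `^ (7 / 2 - 131 * d) <= W.
  have := many_shifts A (fun z => popularN A z tau0); rewrite -/m -/W -/D -/a => h.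
  have hm4 : n `^ (8 - 92 * d) <= m ^+ 4.
    apply: (@le_trans _ _ ((n `^ (2 - 23 * d)) ^+ 4)).
      by rewrite pwX //; compare_exponents d0 d1.
    by apply: lerXn2r; rewrite ?nnegrE ?pw_ge0 // (le_trans _ hm) ?pw_ge0.
  have h2 : a ^+ 3 * #|` D|%:R <= n `^ (9 / 2 + 39 * d).
    apply: le_trans (ler_pM _ _ (aX 3%N) cD) _; rewrite ?exprn_ge0 ?ler0n //.
    by rewrite pwD //; compare_exponents d0 d1.
  have h3 := le_trans hm4 (le_trans h (ler_wpM2r W0 h2)).
  rewrite -ler_pdivrMl ?pw_gt0 // pwV pwD // in h3.
  by apply: le_trans h3; compare_exponents d0 d1.
have M0 : 0 <= n `^ (3 + 6 * d) by exact: pw_ge0.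
pose E := n `^ (7 / 2 - 133 * d).
have Wup : W <= 5 * E + th * triangles A D'.
  have tha : th <= a by apply: le_trans hA; compare_exponents d0 d1.
  have := @shifts_le_triangles R A D t th t0 tha (ltW th0).
  move=> /(_ _)/le_trans; apply.
    by move=> z; rewrite !mem_popular // => /andP[-> /(le_trans ttau)].
  have tth : n `^ (3 * d) <= th by compare_exponents d0 d1.
  have h1 := ler_wpM2l a0 (tail_bounded_sqr tA tth th0 M0).
  have h2 : a * (4 * n `^ (3 + 6 * d) / th) <= 4 * E.
    apply: (@le_trans _ _ (4 * (n `^ (1 + d) * n `^ (3 + 6 * d) / th))).
      rewrite [leLHS](_ : _ = 4 * (a * (n `^ (3 + 6 * d) / th))); last by ring.
      rewrite -mulrA; apply: ler_wpM2l; first by [].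
      apply: ler_wpM2r => //; first by rewrite divr_ge0 // ltW.
    apply: ler_wpM2l; first by [].
    by rewrite pwV !pwD //; compare_exponents d0 d1.
  have h3 : t * a ^+ 3 <= E.
    apply: le_trans (ler_wpM2l (ltW t0) (aX 3%N)) _.
    by rewrite pwD //; compare_exponents d0 d1.
  rewrite -/a -/D'; lra.
have Tri : n `^ (3 - 272 * d) <= triangles A D'.
  have E1 : 10 * E <= n `^ (7 / 2 - 131 * d).
    have h := pw_ge0 n (7 / 2 - 133 * d).
    apply: le_trans (_ : 4096 * E <= _); first by rewrite /E; lra.
    apply: le_trans (pw_absorb n1 hd (lexx _)) _.
    by compare_exponents d0 d1.
  have h : n `^ (7 / 2 - 131 * d) <= 4096 * (th * triangles A D').
    have : 0 <= E by exact: pw_ge0. lra.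
  have c0 : (0 : R) < 4096 by clear; lra.
  have {}h := pw_absorbV n1 c0 hd h.
  rewrite -ler_pdivrMl // pwV pwD // in h.
  by apply: le_trans h; compare_exponents d0 d1.
(* Division by S maps D' into the popular differences of A1, so [differences_in_le]
   applies to it; T = n^(2/3) balances the two terms of that bound. *)
pose Om : R := \sum_(u <- D') \sum_(v <- D') (u - v \in D')%:R.
have Om0 : 0 <= Om by do 2!apply: sumr_ge0 => ? _; exact: ind_ge0.
have hOm : Om <= n `^ (8 / 3 + 832 * d).
  have T2 : 2 <= n `^ (2 / 3).
    have : n `^ d <= n `^ (2 / 3) by compare_exponents d0 d1.
    by apply: le_trans; apply: le_trans hd; clear; lra.
  have X0 : 0 \notin popular A1 t by rewrite mem_popular // eqxx.
  have := @differences_in_le R S (mem D') D' D' (popular A1 t) _ T2 S0 X0.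
  move=> /(_ _); rewrite -/Om => h.
  have {}h : #|` S|%:R * Om <= _ := h (fun s z sS => popular_quot t0 S0 SA sS).
  have h1 : n `^ (1 - d) * Om <= #|` S|%:R * Om by exact: ler_wpM2r.
  have h2 : n `^ (2 / 3) * (#|` popular A1 t|%:R * #|` D'|%:R)
      <= n `^ (11 / 3 + 830 * d).
    apply: le_trans (ler_wpM2l (pw_ge0 _ _) (ler_pM _ _ cX cD')) _; rewrite ?ler0n //.
    by rewrite !pwD //; compare_exponents d0 d1.
  have h3 : (#|` S|%:R * #|` D'|%:R) ^+ 2 / n `^ (2 / 3) ^+ 2 <= n `^ (11 / 3 + 830 * d).
    rewrite pwX // pwV; apply: (@le_trans _ _ ((n `^ (5 / 2 + 415 * d)) ^+ 2
        * n `^ (- (2%:R * (2 / 3))))).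
      apply: ler_wpM2r; first exact: pw_ge0.
      apply: lerXn2r; rewrite ?nnegrE ?pw_ge0 ?mulr_ge0 ?ler0n //.
      apply: le_trans (ler_pM _ _ hS' cD') _; rewrite ?ler0n //.
      by rewrite pwD //; compare_exponents d0 d1.
    by rewrite pwX // pwD //; compare_exponents d0 d1.
  have h4 : n `^ (1 - d) * Om <= 4096 * n `^ (11 / 3 + 830 * d).
    have hp := pw_ge0 n (11 / 3 + 830 * d).
    apply: (le_trans h1); apply: (le_trans h).
    rewrite -[128 * _ / _]mulrA; clear -h2 h3 hp; lra.
  have {}h4 := pw_absorb n1 hd h4.
  rewrite -ler_pdivlMl ?pw_gt0 // pwV pwD // in h4.
  by apply: (le_trans h4); compare_exponents d0 d1.
pose F := n `^ (2 / 3 + 3 * d).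
have hF z : z != 0 -> diffs A z <= F.
  move=> z0; have [tz|zt] := leP (n `^ (3 * d)) (diffs A z); last first.
    by apply: (le_trans (ltW zt)); compare_exponents d0 d1.
  have h := diffs_le_tail (pw_gt0 n1 _) S0 SA tA1 z0 tz.
  have h1 : n `^ (1 - d) * diffs A z ^+ 3 <= n `^ (3 + 6 * d).
    by apply: le_trans h; apply: ler_wpM2r => //; rewrite exprn_ge0 ?diffs_ge0.
  rewrite -ler_pdivlMl ?pw_gt0 // pwV pwD // in h1.
  rewrite -(@ler_pXn2r _ 3) ?nnegrE ?diffs_ge0 ?pw_ge0 //.
  by apply: (le_trans h1); rewrite pwX //; compare_exponents d0 d1.
have hE3 : \sum_(c <- A) \sum_(e <- A) diffs A (c - e) ^+ 2 <= n `^ (19 / 6 + 10 * d).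
  have h1 := sum_sqr_diffs_le (pw_ge0 _ _) hF.
  have tq : n `^ (3 * d) <= n `^ (1 / 2) by compare_exponents d0 d1.
  have h2 := sum_diffs_le tA tq (pw_gt0 n1 _) M0.
  have h3 : n `^ (1 / 2) * a ^+ 2 <= n `^ (5 / 2 + 6 * d).
    apply: le_trans (ler_wpM2l (pw_ge0 _ _) (aX 2%N)) _.
    by rewrite pwD //; compare_exponents d0 d1.
  have h4 : n `^ (3 + 6 * d) / n `^ (1 / 2) <= n `^ (5 / 2 + 6 * d).
    by rewrite pwV pwD //; compare_exponents d0 d1.
  have h5 : \sum_(c <- A) \sum_(e <- A) diffs A (c - e) <= 5 * n `^ (5 / 2 + 6 * d).
    apply: (le_trans h2); rewrite -[4 * _ / _]mulrA -/a; clear -h3 h4; lra.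
  have h6 : F * \sum_(c <- A) \sum_(e <- A) diffs A (c - e) <= 5 * n `^ (19 / 6 + 9 * d).
    apply: le_trans (ler_wpM2l (pw_ge0 _ _) h5) _.
    rewrite mulrCA pwD //; apply: ler_wpM2l; first by [].
    by compare_exponents d0 d1.
  have h7 : a ^+ 3 <= n `^ (19 / 6 + 9 * d).
    by apply: (le_trans (aX 3%N)); compare_exponents d0 d1.
  have hp := pw_ge0 n (19 / 6 + 9 * d).
  have h8 : \sum_(c <- A) \sum_(e <- A) diffs A (c - e) ^+ 2 <= 4096 * n `^ (19 / 6 + 9 * d).
    apply: (le_trans h1); rewrite -/a -/F.
    move: (F * _) (a ^+ 3) (n `^ _) h6 h7 hp; clear => x y z; lra.
  by apply: le_trans (pw_absorb n1 hd h8) _; compare_exponents d0 d1.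
have := sqr_triangles_le A D'; apply/negP; rewrite -ltNge.
apply: (@le_lt_trans _ _ (n `^ (35 / 6 + 842 * d))).
  apply: le_trans (ler_pM Om0 _ hOm hE3) _.
    by do 2!apply: sumr_ge0 => ? _; exact: sqr_ge0.
  by rewrite pwD //; compare_exponents d0 d1.
apply: (@lt_le_trans _ _ ((n `^ (3 - 272 * d)) ^+ 2)).
  by rewrite pwX //; apply: pw_lt => //; clear -d0 d1; lra.
apply: lerXn2r => //; first by rewrite nnegrE pw_ge0.
by rewrite nnegrE; apply: le_trans Tri; exact: pw_ge0.
Qed.

(** * The quotient energy saves a power *)

Lemma card_quot_le (F : fieldType) (A A1 : {fset F}) s : s != 0 ->
  (forall a, a \in A -> a / s \in A1) -> (#|` A| <= #|` A1|)%N.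
Proof.
move=> s0 sub; rewrite -(@card_scale _ A s^-1) ?invr_eq0 //.
by apply/fsubset_leq_card/fsubsetP => _ /imfsetP[a /= aA ->]; exact: sub.
Qed.

(** Cutting C into n^(1/2) blocks, a quotient energy of n^(9/2) would place a
    dilate of B on almost all pairs in common blocks, by
    [exists_structured_blocks], and [popular_pairs_ge] would provide n^2 popular
    pairs in B B. This contradicts [few_popular_pairs]: dividing B B by Y and
    then by the inverses of B stays within sets of size about n, because Y / (B
    B B) has this size. *)
Lemma structured_quot_energy_lt (R : realType) (n d : R) (C B Y : {fset R}) (J : nat) :
  let D := invset B in
  n = #|` C|%:R -> 1 < n -> 0 < d -> 4096 <= n `^ d -> 4000 * (4 * d) <= 1 ->
  J%:R <= n `^ d -> (#|` C| <= 2 ^ J)%N -> 0 \notin B -> 0 \notin Y ->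
  n `^ (1 - d) <= #|` B|%:R <= n -> n `^ (1 - d) <= #|` Y|%:R <= n ->
  #|` mulset (mulset (mulset Y D) D) D|%:R <= n `^ (1 + d) ->
  quot_energy C B < n `^ (9 / 2 - d).
Proof.
move=> D nE n1 d0 hd d1 hJ CJ B0 Y0 /andP[hB hB'] /andP[hY hY'] hX.
have n0 : 0 < n by exact: lt_trans n1.
have nE1 : n = n `^ 1 by rewrite powRr1 // ltW.
have nd0 := pw_gt0 n1 d.
have c0 : (0 : R) < 4096 by clear; lra.
rewrite ltNge; apply/negP => hG.
(* The factor r in [exists_structured_blocks] multiplies n^4, so r has to stay a little
   below n^(1/2) for the diagonal term not to account for the energy. *)
have [r [r0 hr1 hr2]] : exists r : nat, [/\ (0 < r)%N, 8 * r%:R <= n `^ (1 / 2 - d) &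
    n `^ (1 / 2 - 2 * d) <= r%:R].
  have hx : 4096 * n `^ (1 / 2 - 2 * d) <= n `^ (1 / 2 - d).
    by apply: le_trans (pw_absorb n1 hd (lexx _)) _; compare_exponents d0 d1.
  have h1 : 1 <= n `^ (1 / 2 - 2 * d).
    by rewrite -[leLHS](powRr0 n); compare_exponents d0 d1.
  have x0 : 0 <= n `^ (1 / 2 - d) / 8.
    by rewrite divr_ge0 // pw_ge0.
  have := Num.Theory.truncn_itv x0; set r := Num.truncn _.
  case/andP => t1; rewrite -[r.+1]addn1 natrD => t2; exists r.
  split; rewrite -?(ltr0n R); move: hx h1 t1 t2; clear; lra.
have rN : (r <= #|` C|)%N.
  rewrite -(ler_nat R) -nE.
  have : n `^ (1 / 2 - d) <= n by rewrite [leRHS]nE1; compare_exponents d0 d1.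
  move: hr1 (ler0n R r); clear; lra.
pose z := (#|` C|.-1 %/ r).+1.
have [Cz zC] : (#|` C| <= r * z)%N /\ (r * z <= 2 * #|` C|)%N.
  by apply: ceil_div_bounds; rewrite r0.
have hz : z%:R <= n `^ (1 / 2 + 3 * d).
  have : (r * z)%:R <= (2 * #|` C|)%:R :> R by rewrite ler_nat.
  rewrite !natrM -nE => h.
  have h1 : n `^ (1 / 2 - 2 * d) * z%:R <= 4096 * n `^ 1.
    apply: le_trans (ler_wpM2r (ler0n _ _) hr2) _; apply: (le_trans h).
    by rewrite -nE1; move: n0; clear; lra.
  have {}h1 := pw_absorb n1 hd h1.
  rewrite -ler_pdivlMl ?pw_gt0 // pwV pwD // in h1.
  by apply: (le_trans h1); compare_exponents d0 d1.
pose b := block C z.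
have hb : {homo b : x y / x <= y >-> (x <= y)%N} by exact: block_homo.
have hbr x : x \in C -> (b x < r)%N by exact: block_lt.
have hbz i : \sum_(x <- C) (b x == i)%:R <= z%:R :> R by exact: card_block.
have hbz' x : \sum_(x' <- C) (b x == b x')%:R <= z%:R :> R.
  by under eq_bigr do rewrite eq_sym; exact: hbz.
have hG2 : 4 * (2 * r%:R * (#|` C|%:R * #|` B|%:R) ^+ 2) <= n `^ (9 / 2 - d).
  rewrite -nE; apply: (@le_trans _ _ (n `^ (1 / 2 - d) * (n * n) ^+ 2)).
    rewrite mulrA; apply: ler_pM; rewrite ?sqr_ge0 ?mulr_ge0 ?ler0n //.
      by move: hr1; clear; lra.
    apply: lerXn2r; rewrite ?nnegrE ?mulr_ge0 ?ler0n ?(ltW n0) //.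
    by apply: ler_wpM2l => //; exact: ltW.
  rewrite [X in _ * (X * X) ^+ 2]nE1 pwD // pwX // pwD //.
  by compare_exponents d0 d1.
have hG3 : 2 * r%:R * (#|` C|%:R * #|` B|%:R) ^+ 2 < quot_energy C B.
  have := pw_gt0 n1 (9 / 2 - d); move: hG2 hG; clear; lra.
have [mu [mu0 hmu]] := exists_structured_blocks B0 hb hbr hbz' hG3.
set E0 := block_diffs C b mu B in hmu *.
have E00 : 0 <= E0 by do 2!apply: sumr_ge0 => ? _; exact: ind_ge0.
have hE0 : n `^ (3 / 2 - 3 * d) <= E0.
  have h1 : n `^ (9 / 2 - d) <= n `^ (1 / 2 - d) * (n * n * n `^ (1 / 2 + 3 * d)) * E0.
    have h2 : 2 * r%:R * (#|` B|%:R * #|` C|%:R * z%:R) * E0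
       <= (n `^ (1 / 2 - d) / 4) * (n * n * n `^ (1 / 2 + 3 * d)) * E0.
      apply: ler_wpM2r => //; apply: ler_pM; rewrite ?mulr_ge0 ?ler0n //.
        by move: hr1; clear; lra.
      by rewrite -nE; apply: ler_pM; rewrite ?mulr_ge0 ?ler0n ?ler_pM ?(ltW n0).
    have := le_trans hmu h2; move: hG hG2 (pw_ge0 n (9 / 2 - d)); clear.
    move: (2 * r%:R * _ ^+ 2) (quot_energy C B) (n `^ (9 / 2 - d)) => q G N.
    move: (n `^ (1 / 2 - d)) (n * n * _) => w y; lra.
  rewrite [X in _ * (X * X * _) * _]nE1 !pwD // in h1.
  rewrite -ler_pdivrMl ?pw_gt0 // pwV pwD // in h1.
  by apply: le_trans h1; compare_exponents d0 d1.
pose t := n `^ (1 / 2 - 10 * d).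
have t0 : 0 < t by exact: pw_gt0.
have t1 : 1 <= t by rewrite -[leLHS](powRr0 n); compare_exponents d0 d1.
pose X := n `^ (2 - 7 * d).
have X0 : 0 <= X by exact: pw_ge0.
have Cn : C != fset0.
  by rewrite -cardfs_gt0 -(ltr0n R) -nE.
have hcond : #|` C|%:R * (X + (1 + t) * (#|` C|%:R * z%:R)) <= E0 ^+ 2.
  apply: (@le_trans _ _ (n `^ (3 - 6 * d))); last first.
    apply: (@le_trans _ _ ((n `^ (3 / 2 - 3 * d)) ^+ 2)).
      by rewrite pwX //; compare_exponents d0 d1.
    by apply: lerXn2r; rewrite ?nnegrE ?pw_ge0.
  have h1 : t * (n * z%:R) <= X.
    apply: (@le_trans _ _ (t * (n `^ 1 * n `^ (1 / 2 + 3 * d)))).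
      apply: ler_wpM2l; first exact: ltW.
      by rewrite -nE1; apply: ler_wpM2l; first exact: ltW.
    by rewrite !pwD //; compare_exponents d0 d1.
  have h2 : (1 + t) * (n * z%:R) <= 2 * X.
    have : 0 <= n * z%:R by rewrite mulr_ge0 ?ler0n ?ltW.
    move: h1 t1; rewrite mulrDl mul1r; move: (n * _) => w; clear.
    move=> h1 t1 w0; have := ler_peMl w0 t1; lra.
  have h3 : n * (X + (1 + t) * (n * z%:R)) <= 4096 * n `^ (3 - 7 * d).
    apply: (@le_trans _ _ (n * (3 * X))).
      by apply: ler_wpM2l; [exact: ltW|move: h2; clear; lra].
    rewrite [X in X * _]nE1 mulrCA pwD //.
    apply: (@le_trans _ _ (3 * n `^ (3 - 7 * d))).
      by apply: ler_wpM2l => //; compare_exponents d0 d1.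
    by have := pw_ge0 n (3 - 7 * d); clear; lra.
  rewrite -nE; apply: le_trans (pw_absorb n1 hd h3) _.
  by compare_exponents d0 d1.
have hpp := popular_pairs_ge B0 mu0 t0 hbr hbz CJ X0 hcond Cn.
set pp := popular_pairs _ _ in hpp.
have pp0 : 0 <= pp by do 2!apply: sumr_ge0 => ? _; exact: ind_ge0.
have hpp2 : n `^ (2 - 23 * d) <= pp.
  have h1 : n `^ (5 - 15 * d) <= X ^+ 2 * #|` B|%:R.
    apply: (@le_trans _ _ (X ^+ 2 * n `^ (1 - d))).
      by rewrite pwX // pwD //; compare_exponents d0 d1.
    by apply: ler_wpM2l => //; exact: sqr_ge0.
  have h2 : J%:R * (#|` C|%:R * z%:R) ^+ 2 <= n `^ (3 + 7 * d).
    apply: (@le_trans _ _ (n `^ d * (n `^ 1 * n `^ (1 / 2 + 3 * d)) ^+ 2)).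
      apply: ler_pM; rewrite ?ler0n ?sqr_ge0 // -nE -nE1.
      apply: lerXn2r; rewrite ?nnegrE ?mulr_ge0 ?ler0n ?pw_ge0 ?(ltW n0) //.
      by apply: ler_wpM2l => //; exact: ltW.
    by rewrite pwD // pwX // pwD //; compare_exponents d0 d1.
  have h3 : n `^ (5 - 15 * d) <= 4096 * (n `^ (3 + 7 * d) * pp).
    have := le_trans h1 hpp; rewrite -mulrA -[256 * _ * _]mulrA => h3.
    have h4 := ler_wpM2r pp0 h2.
    have h5 : 0 <= n `^ (3 + 7 * d) * pp by rewrite mulr_ge0 ?pw_ge0.
    apply: (le_trans h3); rewrite -mulrA in h4; rewrite -!mulrA in h3 *.
    move: h4 h5; clear; lra.
  have {}h3 := pw_absorbV n1 c0 hd h3.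
  rewrite -ler_pdivrMl ?pw_gt0 // pwV pwD // in h3.
  by apply: le_trans h3; compare_exponents d0 d1.
(* A1 and A2 are inverses of Y / (B B) and Y / (B B B): B B divided by Y lies in A1,
   and A1 divided by D lies in A2. *)
have D0 : 0 \notin D by exact: invset_neq0.
have [Yn Bn] : Y != fset0 /\ B != fset0.
  by split; rewrite -cardfs_gt0 -(ltr0n R); [apply: lt_le_trans hY|apply: lt_le_trans hB];
    exact: pw_gt0.
pose BB := mulset B B.
pose A1 := invset (mulset (mulset Y D) D).
pose A2 := invset (mulset (mulset (mulset Y D) D) D).
have q1 s a : s \in Y -> a \in BB -> a / s \in A1.
  move=> sY /mulsetP[b1 [b2 [b1B b2B ->]]].
  rewrite mem_invset invf_div invfM mulrA.
  by do 2!(apply: mem_mulset; last by rewrite mem_invset invrK).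
have q2 s a : s \in D -> a \in A1 -> a / s \in A2.
  move=> sD; rewrite !mem_invset => aA; rewrite invf_div mulrC.
  exact: mem_mulset.
have nz (S : {fset R}) s : 0 \notin S -> s \in S -> s != 0.
  by move=> S0 sS; apply: contraNneq S0 => <-.
have cA1 : #|` A1|%:R <= #|` A2|%:R :> R.
  have /fset0Pn[b0 b0B] := Bn; rewrite ler_nat; apply: (@card_quot_le _ _ _ b0^-1).
    by rewrite invr_eq0 (nz B).
  by move=> a aA; apply: q2 => //; rewrite mem_invset invrK.
have cBB : #|` BB|%:R <= #|` A1|%:R :> R.
  have /fset0Pn[y yY] := Yn; rewrite ler_nat; apply: (@card_quot_le _ _ _ y).
    exact: (nz Y).
  by move=> a aA; apply: q1.
have cA2 : #|` A2|%:R <= n `^ (1 + d) by rewrite card_invset.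
have cB : #|` B|%:R <= #|` BB|%:R :> R.
  have /fset0Pn[b0 b0B] := Bn; rewrite ler_nat; exact: card_mulset_ge (nz B _ B0 b0B) b0B.
have ny : n <= n `^ (1 + d) by rewrite [leLHS]nE1; compare_exponents d0 d1.
have := @few_popular_pairs R n d BB Y A1 D A2 n1 d0 hd d1 Y0 D0.
rewrite -/(popular_pairs BB _) -/pp => /(_ _ _ q1 q2).
rewrite ltNge hpp2 => h; suff: false by []; apply: h.
- by apply: invset_neq0; do 2!apply: mulset_neq0 => //.
- by apply: invset_neq0; do 3!apply: mulset_neq0 => //.
- by rewrite hY (le_trans hY').
- by rewrite card_invset.
- by rewrite (le_trans hB cB) (le_trans cBB) // (le_trans cA1).
- exact: le_trans cA1 cA2.
- exact: cA2.
Qed.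

(** The Szemeredi-Trotter bound [quot_energy_le] is n^3 |A|^(3/2) at the best T,
    which is less than n^(7/2 - e) |A| unless |A| is close to n. *)
Lemma quot_energy_large_card (R : realType) (n e : R) (C A : {fset R}) :
  n = #|` C|%:R -> 1 < n -> 0 < e -> 4096 <= n `^ e -> 16 * e <= 1 ->
  0 \notin A -> #|` A|%:R <= n ->
  n `^ (7 / 2 - e) * #|` A|%:R < quot_energy C A ->
  n `^ (1 - 4 * e) <= #|` A|%:R.
Proof.
move=> nE n1 e0 he e1 A0 An; apply: contraTT; rewrite -ltNge -leNgt => /ltW kn.
have n0 : 0 < n by exact: lt_trans n1.
have nE1 : n = n `^ 1 by rewrite powRr1 // ltW.
set k : R := #|` A|%:R in An kn *.
have k0 : 0 <= k by exact: ler0n.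
have [kz|kz] := eqVneq k 0.
  rewrite kz mulr0; suff -> : A = fset0 by rewrite /quot_energy big_seq_fset0.
  by apply/eqP; rewrite -cardfs_eq0 -(eqr_nat R) -/k kz.
have kp : 0 < k by rewrite lt_def kz.
pose T := n `^ (3 / 2 - 2 * e) / k.
have T2 : 2 <= T.
  rewrite ler_pdivlMr //; apply: (@le_trans _ _ (4096 * n `^ 1)).
    by move: An n0; rewrite -nE1; clear; lra.
  by apply: le_trans (pw_absorb n1 he (lexx _)) _; compare_exponents e0 e1.
have Tp : 0 < T by apply: lt_le_trans T2.
apply: (le_trans (quot_energy_le C T2 A0)); rewrite -nE -/k.
set N := n `^ (7 / 2 - 2 * e).
have h1 : T * n ^+ 2 * k ^+ 2 = N * k.
  rewrite /N (_ : T * n ^+ 2 * k ^+ 2 = n `^ (3 / 2 - 2 * e) * n ^+ 2 * k).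
    by rewrite [X in _ * X ^+ 2]nE1 pwX // pwD //; congr (_ `^ _ * _); clear; lra.
  by rewrite /T; field.
have h2 : k * n ^+ 4 / T <= N * k.
  rewrite (_ : k * n ^+ 4 / T = n ^+ 4 * n `^ (- (3 / 2 - 2 * e)) * k * k); last first.
    by rewrite /T -pwV; field; rewrite kz gt_eqF ?pw_gt0.
  apply: ler_wpM2r => //; rewrite [X in X ^+ 4 * _]nE1 pwX // pwD //.
  apply: le_trans (ler_wpM2l (pw_ge0 _ _) kn) _.
  by rewrite pwD //; compare_exponents e0 e1.
have h3 : 4096 * N <= n `^ (7 / 2 - e).
  by apply: le_trans (pw_absorb n1 he (lexx _)) _; compare_exponents e0 e1.
have h4 := ler_wpM2r k0 h3.
have h5 : 0 <= N * k by rewrite mulr_ge0 ?pw_ge0.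
rewrite h1 -[128 * _ * _]mulrA -[128 * _ / _]mulrA; move: h2 h4 h5; clear.
move: (k * n ^+ 4 / T) => x; lra.
Qed.

(** With energy below |A|^3 n^(- 10 e), the choice rho = |A| n^(- 6 e) makes
    every term of [quot_energy_le_mult_energy] smaller than the assumed energy.
    *)
Lemma mult_energy_large (R : realType) (n e : R) (C A : {fset R}) :
  n = #|` C|%:R -> 1 < n -> 0 < e -> 4096 <= n `^ e -> 16 * e <= 1 ->
  0 \notin A -> #|` A|%:R <= n ->
  n `^ (7 / 2 - e) * #|` A|%:R < quot_energy C A ->
  #|` A|%:R ^+ 3 <= n `^ (10 * e) * mult_energy A.
Proof.
move=> nE n1 e0 he e1 A0 An; apply: contraTT; rewrite -ltNge -leNgt => /ltW hE.
have n0 : 0 < n by exact: lt_trans n1.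
have nE1 : n = n `^ 1 by rewrite powRr1 // ltW.
set k : R := #|` A|%:R in An hE *.
have k0 : 0 <= k by exact: ler0n.
have [kz|kz] := eqVneq k 0.
  rewrite kz mulr0; suff -> : A = fset0 by rewrite /quot_energy big_seq_fset0.
  by apply/eqP; rewrite -cardfs_eq0 -(eqr_nat R) -/k kz.
have kp : 0 < k by rewrite lt_def kz.
set N := n `^ (7 / 2 - 2 * e).
pose rho := k * n `^ (- (6 * e)).
pose T1 := n `^ (1 / 2 - 2 * e); pose T2 := n `^ (1 / 2 + 2 * e).
have rho0 : 0 < rho by rewrite mulr_gt0 ?pw_gt0.
have big a : e <= a -> 2 <= n `^ a.
  move=> ea; apply: (@le_trans _ _ (n `^ e)); last exact: pw_le.
  by apply: le_trans he; clear; lra.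
have hT1 : 2 <= T1 by apply: big; clear -e0 e1; lra.
have hT2 : 2 <= T2 by apply: big; clear -e0 e1; lra.
apply: (le_trans (quot_energy_le_mult_energy C hT1 hT2 rho0 A0)); rewrite -nE -/k.
have e4 : n ^+ 4 = n `^ 4 by rewrite nE1 pwX // -nE1 mulr1.
have e2 : n ^+ 2 = n `^ 2 by rewrite nE1 pwX // -nE1 mulr1.
have h1 : T1 * n ^+ 2 * k ^+ 2 <= N * k.
  rewrite [k ^+ 2]expr2 mulrA e2 pwD //; apply: ler_wpM2r => //.
  apply: le_trans (ler_wpM2l (pw_ge0 _ _) An) _.
  by rewrite [X in _ * X]nE1 pwD //; compare_exponents e0 e1.
have h2 : rho * n ^+ 4 / T1 <= N * k.
  rewrite e4 /rho /T1 pwV -!mulrA pwD // pwD // mulrC; apply: ler_wpM2r => //.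
  by compare_exponents e0 e1.
have h3 : T2 * n ^+ 2 * (mult_energy A / rho) <= N * k.
  have h : mult_energy A <= k ^+ 3 * n `^ (- (10 * e)).
    by rewrite -pwV ler_pdivlMr ?pw_gt0 // mulrC.
  have h' : mult_energy A / rho <= k * k * n `^ (- (4 * e)).
    rewrite ler_pdivrMr //; apply: (le_trans h).
    rewrite /rho (_ : k * k * _ * _ = k ^+ 3 * (n `^ (- (4 * e)) * n `^ (- (6 * e)))).
      by rewrite pwD //; apply: ler_wpM2l; [exact: exprn_ge0|compare_exponents e0 e1].
    by ring.
  apply: le_trans (ler_wpM2l _ h') _; first by rewrite mulr_ge0 ?pw_ge0 ?sqr_ge0.
  rewrite e2 pwD // (_ : _ * (k * k * _) = n `^ (1 / 2 + 2 * e + 2) * n `^ (- (4 * e)) * k * k).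
    apply: ler_wpM2r => //; rewrite pwD //.
    apply: le_trans (ler_wpM2l (pw_ge0 _ _) An) _.
    by rewrite [X in _ * X]nE1 pwD //; compare_exponents e0 e1.
  by ring.
have h4 : k * n ^+ 4 / T2 <= N * k.
  rewrite e4 /T2 pwV -!mulrA pwD // mulrC; apply: ler_wpM2r => //.
  by compare_exponents e0 e1.
have h5 : 4096 * N <= n `^ (7 / 2 - e).
  by apply: le_trans (pw_absorb n1 he (lexx _)) _; compare_exponents e0 e1.
have h6 := ler_wpM2r k0 h5.
have h7 : 0 <= N * k by rewrite mulr_ge0 ?pw_ge0.
rewrite -[128 * rho * _]mulrA -[128 * _ / T1]mulrA -[128 * k * _]mulrA -[128 * _ / T2]mulrA.
move: h1 h2 h3 h4 h6 h7; clear.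
move: (rho * n ^+ 4 / T1) (k * n ^+ 4 / T2) (T1 * n ^+ 2 * k ^+ 2)
  (T2 * n ^+ 2 * _) => x y z w; lra.
Qed.

(** The energy hypothesis enters [balog_szemeredi_gowers] with K = n^(10 e), so
    that B / B has at most n^(42 e) |B| elements, and [plunnecke] cubes this
    ratio: 126 = 3 * 42. *)
Lemma structured_subset (R : realType) (n e : R) (A : {fset R}) :
  1 < n -> 0 < e -> 4096 <= n `^ e -> 126 * e <= 1 ->
  0 \notin A -> n `^ (1 - 4 * e) <= #|` A|%:R <= n ->
  #|` A|%:R ^+ 3 <= n `^ (10 * e) * mult_energy A ->
  exists B Y : {fset R}, let D := invset B in
   [/\ B `<=` A, Y `<=` B, n `^ (1 - 15 * e) <= #|` B|%:R &
     [/\ #|` A|%:R <= n `^ (11 * e) * #|` B|%:R,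
       n `^ (1 - 57 * e) <= #|` Y|%:R &
       #|` mulset (mulset (mulset Y D) D) D|%:R <= n `^ (1 + 126 * e)]].
Proof.
move=> n1 e0 he e1 A0 /andP[hA hA'] hE.
have n0 : 0 < n by exact: lt_trans n1.
have nE1 : n = n `^ 1 by rewrite powRr1 // ltW.
set k : R := #|` A|%:R in hA hA' hE *.
have kp : 0 < k by apply: lt_le_trans hA; exact: pw_gt0.
have An : A != fset0 by rewrite -cardfs_gt0 -(ltr0n R).
have [B [BA Bn hB hD]] := balog_szemeredi_gowers A0 An (pw_gt0 n1 _) hE.
rewrite -/k in hB hD.
have B0 : 0 \notin B by apply: contra A0; exact: (fsubsetP BA).
have D0 : 0 \notin invset B by exact: invset_neq0.
have [Y [YB Yn h1 h2]] := plunnecke D0 Bn.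
have bp : 0 < #|` B|%:R :> R by rewrite ltr0n cardfs_gt0.
have yp : 0 < #|` Y|%:R :> R by rewrite ltr0n cardfs_gt0.
have kB : k <= n `^ (11 * e) * #|` B|%:R.
  have : k <= 4096 * (n `^ (10 * e) * #|` B|%:R).
    apply: (le_trans hB); rewrite -mulrA.
    by have := mulr_ge0 (pw_ge0 n (10 * e)) (ltW bp); clear; lra.
  move/le_trans; apply; rewrite mulrA; apply: ler_wpM2r; first exact: ltW.
  by apply: le_trans (pw_absorb n1 he (lexx _)) _; compare_exponents e0 e1.
have hBlow : n `^ (1 - 15 * e) <= #|` B|%:R.
  rewrite -ler_pdivrMl ?pw_gt0 // pwV in kB.
  apply: le_trans kB; apply: le_trans (ler_wpM2l (pw_ge0 _ _) hA).
  by rewrite pwD //; compare_exponents e0 e1.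
pose X1 : R := #|` mulset Y (invset B)|%:R.
have rY : X1 <= n `^ (42 * e) * #|` Y|%:R.
  have h1R : X1 * #|` B|%:R <= #|` mulset B (invset B)|%:R * #|` Y|%:R.
    by rewrite /X1 -!natrM ler_nat.
  rewrite -(ler_pM2r bp); apply: (le_trans h1R).
  rewrite mulrAC; apply: ler_wpM2r; first exact: ltW.
  apply: (le_trans hD); rewrite pwX //.
  apply: (@le_trans _ _ (n `^ (31 * e) * k)).
    apply: ler_wpM2r; first exact: ltW.
    apply: (@le_trans _ _ (4096 * n `^ (3 * (10 * e)))).
      by have := pw_ge0 n (3 * (10 * e)); clear; lra.
    by apply: le_trans (pw_absorb n1 he (lexx _)) _; compare_exponents e0 e1.
  apply: le_trans (ler_wpM2l (pw_ge0 _ _) kB) _; rewrite mulrA pwD //.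
  by apply: ler_wpM2r; [exact: ltW|compare_exponents e0 e1].
have hX3 : #|` mulset (mulset (mulset Y (invset B)) (invset B)) (invset B)|%:R
    <= n `^ (126 * e) * #|` Y|%:R.
  have h2R : #|` mulset (mulset (mulset Y (invset B)) (invset B)) (invset B)|%:R
      * #|` Y|%:R ^+ 2 <= X1 ^+ 3 by rewrite /X1 -!natrX -natrM ler_nat.
  rewrite -(ler_pM2r (exprn_gt0 2 yp)); apply: (le_trans h2R).
  rewrite -mulrA -exprS; apply: (@le_trans _ _ ((n `^ (42 * e) * #|` Y|%:R) ^+ 3)).
    by apply: lerXn2r; rewrite ?nnegrE ?mulr_ge0 ?ler0n ?pw_ge0.
  rewrite exprMn pwX //; apply: ler_wpM2r; first exact: exprn_ge0 (ltW yp).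
  by compare_exponents e0 e1.
exists B, Y; split => //; split => //.
- have BX : #|` B|%:R <= X1.
    have /fset0Pn[y yY] := Yn.
    have y0 : y != 0 by apply: contraNneq B0 => <-; exact: (fsubsetP YB).
    rewrite /X1 ler_nat -[leqLHS]card_invset -(card_scale (invset B) y0).
    apply/fsubset_leq_card/fsubsetP => _ /imfsetP[b /= bB ->].
    by rewrite mulrC mem_mulset.
  have := le_trans hBlow (le_trans BX rY).
  rewrite -ler_pdivrMl ?pw_gt0 // pwV pwD //; apply: le_trans.
  by compare_exponents e0 e1.
- apply: (le_trans hX3); apply: (@le_trans _ _ (n `^ (126 * e) * n `^ 1)).
    rewrite -nE1; apply: ler_wpM2l; first exact: pw_ge0.
    apply: le_trans hA'; rewrite ler_nat; apply: fsubset_leq_card.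
    exact: fsubset_trans YB BA.
  by rewrite pwD //; compare_exponents e0 e1.
Qed.

(** A minimal counterexample A contains a structured subset B with a proportion
    be >= n^(- 11 e) of its elements. By minimality A minus B has energy at most
    (1 - be) times the claimed bound, so [quot_energy_split] with parameter be /
    2 leaves at least be^2 / 6 of the claimed bound to B. That is n^(9/2 - 27
    e), more than [structured_quot_energy_lt] allows to B, which is n^(9/2 - 126
    e). *)
Theorem quot_energy_bound (R : realType) (n e : R) (C A : {fset R}) (J : nat) :
  n = #|` C|%:R -> 1 < n -> 0 < e -> 4096 <= n `^ e -> 4000 * (4 * (126 * e)) <= 1 ->
  J%:R <= n `^ e -> (#|` C| <= 2 ^ J)%N -> 0 \notin A -> #|` A|%:R <= n ->
  quot_energy C A <= n `^ (7 / 2 - e) * #|` A|%:R.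
Proof.
move=> nE n1 e0 he e1 hJ CJ.
have n0 : 0 < n by exact: lt_trans n1.
have nE1 : n = n `^ 1 by rewrite powRr1 // ltW.
elim/finSet_rect: A => A IH A0 An; rewrite leNgt; apply/negP => hG.
have e2 : 16 * e <= 1 by clear -e0 e1; lra.
have e3 : 126 * e <= 1 by clear -e0 e1; lra.
have hk := quot_energy_large_card nE n1 e0 he e2 A0 An hG.
have hE := mult_energy_large nE n1 e0 he e2 A0 An hG.
have hkn : n `^ (1 - 4 * e) <= #|` A|%:R <= n by rewrite hk.
have [B [Y [BA YB hB [kB hY hX3]]]] := structured_subset n1 e0 he e3 A0 hkn hE.
have B0 : 0 \notin B by apply: contra A0; exact: (fsubsetP BA).
have Y0 : 0 \notin Y by apply: contra B0; exact: (fsubsetP YB).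
have Bk : #|` B|%:R <= #|` A|%:R :> R by rewrite ler_nat fsubset_leq_card.
have YA : #|` Y|%:R <= #|` B|%:R :> R by rewrite ler_nat fsubset_leq_card.
have d0 : 0 < 126 * e by rewrite mulr_gt0.
have hd a : e <= a -> 4096 <= n `^ a by move=> ea; apply: (le_trans he); exact: pw_le.
have GB : quot_energy C B < n `^ (9 / 2 - 126 * e).
  apply: (structured_quot_energy_lt (Y := Y) nE n1 d0 _ e1 _ CJ) => //.
  - by apply: hd; clear -e0; lra.
  - by apply: (le_trans hJ); compare_exponents e0 e1.
  - by rewrite (le_trans Bk An) andbT; apply: le_trans hB; compare_exponents e0 e1.
  - rewrite (le_trans YA (le_trans Bk An)) andbT; apply: le_trans hY.
    by compare_exponents e0 e1.
set k : R := #|` A|%:R in An hG hk hkn kB Bk *.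
have kp : 0 < k by apply: lt_le_trans hk; exact: pw_gt0.
have bp : 0 < #|` B|%:R :> R by apply: lt_le_trans hB; exact: pw_gt0.
have Bn : B != fset0 by rewrite -cardfs_gt0 -(ltr0n R).
set be : R := #|` B|%:R / k.
have be0 : 0 < be by exact: divr_gt0.
have be1 : be <= 1 by rewrite ler_pdivrMr // mul1r.
set g := n `^ (7 / 2 - e) in IH hG *.
have hAB : quot_energy C (A `\` B) <= (1 - be) * (g * k).
  have -> : (1 - be) * (g * k) = g * #|` A `\` B|%:R.
    rewrite cardfsDS // natrB ?fsubset_leq_card // -/k /be.
    by field; rewrite lt0r_neq0.
  apply: IH.
  - rewrite fproperEcard fsubsetDl /= cardfsDS // ltn_subrL -!(ltr0n R).
    by rewrite bp kp.
  - by rewrite inE negb_and A0 orbT.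
  - by apply: le_trans An; rewrite ler_nat fsubset_leq_card // fsubsetDl.
have hs := quot_energy_split C (_ : 0 < be / 2) A0 BA.
have {}hs : quot_energy C A <= (1 + be / 2) * quot_energy C (A `\` B)
    + (1 + (be / 2)^-1) * quot_energy C B by apply: hs; rewrite divr_gt0.
have G0 : 0 <= g * k by rewrite mulr_ge0 ?pw_ge0 ?ltW.
have hlow : be ^+ 2 * (g * k) <= 6 * quot_energy C B.
  have GB0 := quot_energy_ge0 C B.
  have c1 : 0 <= 1 + be / 2 by rewrite addr_ge0 ?divr_ge0 ?(ltW be0).
  have h1 := le_trans hs (lerD (ler_wpM2l c1 hAB) (lexx _)).
  rewrite invf_div in h1; have {}h1 := lt_le_trans hG h1.
  have h2 : be * ((1 + 2 / be) * quot_energy C B) = (be + 2) * quot_energy C B.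
    by field; rewrite lt0r_neq0.
  rewrite -(ltr_pM2l be0) mulrDr h2 in h1.
  have h3 := mulr_ge0 (sqr_ge0 be) (mulr_ge0 (ltW be0) G0).
  have h4 : be * quot_energy C B <= quot_energy C B by rewrite ler_piMl.
  move: h1 h3 h4; clear; move: (g * k) (quot_energy C B) => u w; lra.
have hbe : n `^ (- (11 * e)) <= be.
  by rewrite /be ler_pdivlMr // -pwV mulrC ler_pdivrMr ?pw_gt0 // mulrC.
have h1 : n `^ (9 / 2 - 27 * e) <= 4096 * n `^ (9 / 2 - 126 * e).
  apply: (@le_trans _ _ (be ^+ 2 * (g * k))).
    apply: (@le_trans _ _ ((n `^ (- (11 * e))) ^+ 2 * (g * n `^ (1 - 4 * e)))).
      by rewrite /g pwX // !pwD //; compare_exponents e0 e1.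
    apply: ler_pM; rewrite ?sqr_ge0 ?mulr_ge0 ?pw_ge0 //.
      by apply: lerXn2r; rewrite ?nnegrE ?pw_ge0 ?(ltW be0).
    by apply: ler_wpM2l => //; exact: pw_ge0.
  apply: (le_trans hlow); have := pw_ge0 n (9 / 2 - 126 * e).
  by move: GB; clear; lra.
have := pw_absorb n1 he h1; apply/negP; rewrite -ltNge.
by apply: pw_lt => //; clear -e0; lra.
Qed.

(** * Fibre sums and the final choice of constants *)

Local Open Scope classical_set_scope.
Local Open Scope ring_scope.

Lemma sum_sqr_fibers (R : realType) (K : choiceType) (T : {fset K}) (f : K -> R) :
  \sum_(x \in [set: R]) ((#|` [fset t in T | f t == x]|)%:R ^+ 2 : R)
    = \sum_(t <- T) \sum_(t' <- T) (f t == f t')%:R.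
Proof.
have cE x : #|` [fset t in T | f t == x]|%:R = \sum_(t <- T) (f t == x)%:R :> R.
  rewrite -sum1_fset big_fset /= big_mkcond; apply: eq_bigr => t _.
  by case: ifP.
rewrite (fsbigTE [fset f t | t in T]%fset); last first.
  move=> x xT; rewrite cE big_seq big1 ?expr0n // => t tT.
  apply/eqP; rewrite pnatr_eq0 eqb0; apply: contra xT => /eqP <-.
  by apply/imfsetP; exists t.
under eq_bigr do rewrite cE sqr_sum.
rewrite exchange_big; apply: eq_big_seq => t tT /=.
rewrite exchange_big; apply: eq_bigr => t' _ /=.
under eq_bigr => x _ do rewrite [f t == x]eq_sym.
rewrite sum_pred1_fset_mul [f t' == _]eq_sym.
suff -> : f t \in [fset f t | t in T]%fset by rewrite mul1r.
by apply/imfsetP; exists t.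
Qed.

Lemma sum_sqr_triples (R : realType) (A : {fset R}) (f : R * R * R -> R) :
  \sum_(x \in [set: R])
      ((#|` [fset t in (A `*` A `*` A)%fset | f t == x]|)%:R ^+ 2 : R)
    = triple_energy A f.
Proof.
rewrite sum_sqr_fibers /triple_energy !sum_fsetM.
apply: eq_bigr => a _; apply: eq_bigr => b _; apply: eq_bigr => c _.
by rewrite !sum_fsetM.
Qed.

Lemma triple_energy_le (R : realType) (A : {fset R}) (f : R * R * R -> R) :
  triple_energy A f <= #|` A|%:R ^+ 6.
Proof.
rewrite /triple_energy !exprS expr0 mulr1.
do 5!(rewrite -sum_const_fset; apply: ler_sum => ? _).
exact: sum_ind_le_card.
Qed.

(** By Bernoulli, the square root of N^e, at least (1 + h)^L with L = log N,
    exceeds 1 + L h; its square therefore exceeds L + 1 once L h^2 >= 1. *)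
Lemma log_le_power (R : realType) (e : R) : 0 < e ->
  exists J0 : nat, forall N : nat, (2 ^ J0 <= N)%N ->
    4096 <= (N%:R : R) `^ e /\ (trunc_log 2 N).+1%:R <= (N%:R : R) `^ e.
Proof.
move=> e0; pose h : R := 2 `^ (e / 2) - 1.
have h0 : 0 < h.
  have two : (1 : R) < 2 by lra.
  by rewrite subr_gt0 -[ltLHS](powRr0 (2 : R)); apply: pw_lt => //; rewrite divr_gt0.
pose j0 : nat := (Num.truncn (h ^- 2)).+1.
have hj0 : 1 <= j0%:R * h ^+ 2.
  rewrite -ler_pdivrMr ?exprn_gt0 // mul1r; apply: ltW.
  exact: Num.Theory.truncnS_gt.
exists (j0 + 4096)%N => N hN.
have N0 : (0 < N)%N by apply: leq_trans hN; rewrite expn_gt0.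
set L := trunc_log 2 N.
have LN : (2 ^ L <= N)%N by exact: trunc_logP.
have JL : (j0 + 4096 <= L)%N by apply: trunc_log_max.
have bern (k : nat) : 1 + k%:R * h <= (2 `^ (e / 2)) ^+ k.
  have -> : 2 `^ (e / 2) = 1 + h :> R by rewrite /h addrC subrK.
  elim: k => [|k IH]; first by rewrite expr0 mul0r addr0.
  have hk : 0 <= k%:R * h by rewrite mulr_ge0 ?ler0n ?(ltW h0).
  have h1 : 0 <= 1 + h by rewrite addr_ge0 ?ler01 ?(ltW h0).
  rewrite exprS; apply: le_trans (ler_wpM2l h1 IH).
  rewrite -[k.+1]addn1 natrD.
  by have := mulr_ge0 hk (ltW h0); lra.
have NL : (1 + L%:R * h) ^+ 2 <= (N%:R : R) `^ e.
  have -> : (N%:R : R) `^ e = ((N%:R : R) `^ (e / 2)) ^+ 2.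
    by rewrite -powR_mulrn ?powR_ge0 // -powRrM divfK.
  have p1 : 0 <= 1 + L%:R * h by rewrite addr_ge0 // mulr_ge0 // ltW.
  apply: lerXn2r; rewrite ?nnegrE ?powR_ge0 //.
  apply: (le_trans (bern L)).
  rewrite -powR_mulrn ?powR_ge0 // powRAC powR_mulrn //.
  apply: ge0_ler_powR; rewrite ?nnegrE ?exprn_ge0 ?ler0n //.
    by rewrite divr_ge0 // ltW.
  by rewrite -natrX ler_nat.
have LR : j0%:R + 4096%:R <= L%:R :> R by rewrite -natrD ler_nat.
have h2 : 0 < h ^+ 2 by exact: exprn_gt0.
have LL : L%:R + 1 <= (1 + L%:R * h) ^+ 2.
  have Lh : 1 <= L%:R * h ^+ 2.
    apply: (le_trans hj0); apply: ler_wpM2r; first exact: ltW.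
    by apply: le_trans LR; rewrite lerDl ler0n.
  have Lp : 0 <= L%:R :> R by exact: ler0n.
  have := ler_wpM2l Lp Lh; have := mulr_ge0 Lp (ltW h0).
  by lra.
split; last by rewrite -[L.+1]addn1 natrD; exact: le_trans LL NL.
apply: le_trans NL; apply: le_trans LL; have := ler0n R j0; lra.
Qed.

(** The saving n^(- e) in the quotient energy passes to the first sum directly.
    In the second it is shared between the threshold T and the parameter eta of
    [prod_sum_energy_le], and e / 6 remains. *)
Lemma energies_le (R : realType) (A : {fset R}) (n e : R) (J : nat) (s : bool) :
  n = #|` A|%:R -> 1 < n -> 0 < e -> 4096 <= n `^ e -> 4000 * (4 * (126 * e)) <= 1 ->
  J%:R <= n `^ e -> (#|` A| <= 2 ^ J)%N ->
  triple_energy A (fun t => t.1.1 * (t.1.2 + (-1) ^+ s * t.2))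
     <= 68 * n `^ (9 / 2 - e / 6) /\
  triple_energy A (fun t => t.1.1 * t.1.2 + (-1) ^+ s * t.2)
     <= 68 * n `^ (9 / 2 - e / 6).
Proof.
move=> nE n1 e0 he e1 hJ AJ.
have n0 : 0 < n by exact: lt_trans n1.
have nE1 : n = n `^ 1 by rewrite powRr1 // ltW.
have n4 : n ^+ 4 = n `^ 4 by rewrite nE1 pwX // -nE1 mulr1.
have As0 : 0 \notin (A `\ 0)%fset by rewrite !inE eqxx.
have cA : #|` (A `\ 0)%fset|%:R <= n by rewrite nE ler_nat fsubset_leq_card // fsubD1set.
have hG : quot_energy A (A `\ 0)%fset <= n `^ (9 / 2 - e).
  apply: (le_trans (quot_energy_bound nE n1 e0 he e1 hJ AJ As0 cA)).
  apply: le_trans (ler_wpM2l (pw_ge0 _ _) cA) _.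
  by rewrite [X in _ * X]nE1 pwD //; compare_exponents e0 e1.
have h4 : n ^+ 4 <= n `^ (9 / 2 - e) by rewrite n4; compare_exponents e0 e1.
set X := n `^ (9 / 2 - e / 6).
have X0 : 0 <= X by exact: pw_ge0.
have eX : n `^ (9 / 2 - e) <= X by compare_exponents e0 e1.
split.
  apply: (le_trans (mul_sum_energy_le A s)); rewrite -nE.
  by move: hG h4 eX X0; clear; lra.
pose T := n `^ (1 / 2 - e / 3); pose eta := n `^ (e / 2 - 1).
have T2 : 2 <= T.
  apply: (@le_trans _ _ (n `^ e)); first by apply: le_trans he; clear; lra.
  by compare_exponents e0 e1.
have eta0 : 0 < eta by exact: pw_gt0.
apply: (le_trans (prod_sum_energy_le A s T2 eta0)); rewrite -nE.
have h5 : (T + 2) * n ^+ 4 <= 2 * X.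
  apply: (@le_trans _ _ (2 * T * n ^+ 4)).
    by apply: ler_wpM2r; [exact: exprn_ge0 (ltW n0)|move: T2; clear; lra].
  rewrite -mulrA n4 pwD //; apply: ler_wpM2l; first by [].
  by compare_exponents e0 e1.
have h6 : eta / 2 * (n * (quot_energy A (A `\ 0)%fset + n ^+ 4)) <= X.
  have h7 : n * (quot_energy A (A `\ 0)%fset + n ^+ 4) <= n * (2 * n `^ (9 / 2 - e)).
    by apply: ler_wpM2l; [exact: ltW|move: hG h4; clear; lra].
  apply: (@le_trans _ _ (eta / 2 * (n * (2 * n `^ (9 / 2 - e))))).
    by apply: ler_wpM2l => //; rewrite divr_ge0 // ltW.
  have -> : eta / 2 * (n * (2 * n `^ (9 / 2 - e))) = eta * (n * n `^ (9 / 2 - e)) by field.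
  rewrite [X in _ * (X * _)]nE1 pwD // pwD //; compare_exponents e0 e1.
have h8 : n ^+ 4 / (eta * T) <= X.
  by rewrite n4 pwD // pwV pwD //; compare_exponents e0 e1.
move: h5 h6 h8 X0; rewrite -[64 * _ / _]mulrA; clear.
move: (n ^+ 4 / _) => y; lra.
Qed.

Theorem theorem9 (R : realType) :
  exists c C : R, [/\ 0 < c, 0 < C &
    forall (A : {fset R}) (s : bool), (1 < #|` A|)%N ->
      \sum_(x \in [set: R]) ((r_mul_sum s A x)%:R ^+ 2 : R)
        <= C * (#|` A|%:R : R) `^ (9 / 2 - c) /\
      \sum_(x \in [set: R]) ((r_prod_sum s A x)%:R ^+ 2 : R)
        <= C * (#|` A|%:R : R) `^ (9 / 2 - c)].
Proof.
pose e : R := (4000 * (4 * 126))^-1.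
have e0 : 0 < e by rewrite invr_gt0; lra.
have e1 : 4000 * (4 * (126 * e)) <= 1.
  have h (x y z : R) : 0 < x -> 0 < y -> 0 < z -> x * (y * (z * (x * (y * z))^-1)) = 1.
    by move=> *; field; rewrite !lt0r_neq0.
  by rewrite h; clear; lra.
have [J0 hJ0] := log_le_power e0.
exists (e / 6), (68 + (2 ^+ J0) ^+ 6).
have p0 : 0 <= (2 ^+ J0) ^+ 6 :> R by rewrite !exprn_ge0.
split; [by rewrite divr_gt0| by move: p0; lra|].
move=> A s A1; pose n : R := #|` A|%:R.
have n1 : 1 < n by rewrite ltr1n.
pose X := n `^ (9 / 2 - e / 6).
have X1 : 1 <= X.
  rewrite -[leLHS](powRr0 n); apply: pw_le => //.
  by clear -e0 e1; lra.
have X0 : 0 <= X by exact: pw_ge0.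
rewrite /r_mul_sum /r_prod_sum.
rewrite (sum_sqr_triples A (fun t => t.1.1 * (t.1.2 + (-1) ^+ s * t.2))).
rewrite (sum_sqr_triples A (fun t => t.1.1 * t.1.2 + (-1) ^+ s * t.2)).
rewrite -/n -/X mulrDl.
have [An|nA] := leqP (2 ^ J0) #|` A|.
  have [he hJ] := hJ0 _ An.
  have AJ : (#|` A| <= 2 ^ (trunc_log 2 #|` A|).+1)%N by apply/ltnW/trunc_log_ltn.
  have [h1 h2] := energies_le s erefl n1 e0 he e1 hJ AJ.
  have X2 : 0 <= (2 ^+ J0) ^+ 6 * X by exact: mulr_ge0.
  by split; [apply: (le_trans h1)|apply: (le_trans h2)]; rewrite lerDl.
have small f : triple_energy A f <= 68 * X + (2 ^+ J0) ^+ 6 * X.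
  apply: (le_trans (triple_energy_le A f)).
  apply: (@le_trans _ _ ((2 ^+ J0) ^+ 6 * X)); last by rewrite lerDr mulr_ge0.
  rewrite -[leLHS]mulr1; apply: ler_pM => //.
  apply: lerXn2r; rewrite ?nnegrE ?exprn_ge0 //.
  by rewrite -natrX ler_nat ltnW.
by split; exact: small.
Qed.
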